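(* Let $d>k\geq 2$ be integers with $d$ even. Let $p$ be an odd prime such that $p\nmid dk(d-k)$, and let $q=p^r$ with $r\geq 1$. Then, for $x\in\mathbb{F}_q$, $$\sum_{t\in\mathbb{F}_q}\varphi(1-t)\;{}_{d-2}G_{d-2}\left[\begin{array}{cccccc}\frac{1}{d},&\ldots,&\frac{\frac d2-1}{d},&\frac{\frac d2+1}{d},&\ldots,&\frac{d-1}{d}\\ c_1,&\ldots,&c_{\frac d2-1},&c_{\frac d2},&\ldots,&c_{d-2}\end{array}\Big|\,xt\right]_q=-{}_{d-1}G_{d-1}\left[\begin{array}{ccccccc}\frac{1}{d},&\frac{2}{d},&\ldots,&\frac{k}{d},&\frac{k+1}{d},&\ldots,&\frac{d-1}{d}\\ 0,&\frac{1}{k},&\ldots,&\frac{k-1}{k},&\frac{1}{d-k},&\ldots,&\frac{d-k-1}{d-k}\end{array}\Big|\,x\right]_q,$$ where $\{c_1,\ldots,c_{d-2}\}=\{\frac1k,\ldots,\frac{k-1}{k},\frac{1}{d-k},\ldots,\frac{d-k-1}{d-k}\}$ as multisets (i.e. $c_1,\ldots,c_{d-2}$ is a listing, with repetitions, of the $d-2$ numbers on the right).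
   Context: $\varphi$ is the quadratic character on $\mathbb{F}_q$ (with $\varphi(0)=0$). Let $\mathbb{Z}_q$ be the ring of integers of the unramified extension of $\mathbb{Q}_p$ with residue field $\mathbb{F}_q$. The $p$-adic gamma function is $\Gamma_p(n)=(-1)^n\prod_{0<j<n,\,p\nmid j}j$ for positive integers $n$, $\Gamma_p(0)=1$, extended continuously to $\mathbb{Z}_p$. Let $\omega:\mathbb{F}_q^\times\to\mathbb{Z}_q^\times$ be the Teichmüller character ($\omega(a)$ is the $(q-1)$-th root of unity in $\mathbb{Z}_q$ congruent to $a$ modulo $p$), $\overline{\omega}=\omega^{-1}$, with $\overline{\omega}^a(0)=0$ for all $a$ (including $a=0$). For $x\in\mathbb{Q}$, $\lfloor x\rfloor$ is the floor and $\langle x\rangle=x-\lfloor x\rfloor$. For an odd prime $p$, $q=p^r$, $t\in\mathbb{F}_q$, and $a_j,b_j\in\mathbb{Q}\cap\mathbb{Z}_p$ $(1\le j\le n)$, McCarthy's $p$-adic hypergeometric function is $${}_nG_n\left[\begin{array}{ccc}a_1,&\ldots,&a_n\\ b_1,&\ldots,&b_n\end{array}\Big|\,t\right]_q=\frac{-1}{q-1}\sum_{a=0}^{q-2}(-1)^{an}\,\overline{\omega}^a(t)\prod_{j=1}^n\prod_{i=0}^{r-1}(-p)^{-\lfloor\langle a_jp^i\rangle-\frac{ap^i}{q-1}\rfloor-\lfloor\langle -b_jp^i\rangle+\frac{ap^i}{q-1}\rfloor}\frac{\Gamma_p(\langle(a_j-\frac{a}{q-1})p^i\rangle)}{\Gamma_p(\langle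 a_jp^i\rangle)}\frac{\Gamma_p(\langle(-b_j+\frac{a}{q-1})p^i\rangle)}{\Gamma_p(\langle -b_jp^i\rangle)}.$$ *)

(* Defs.v *)
From HB Require Import structures.
From mathcomp Require Import all_boot all_order all_algebra all_field.
From mathcomp Require Import boolp classical_sets.

Set Implicit Arguments.
Unset Strict Implicit.
Unset Printing Implicit Defensive.

Import Order.TTheory GRing.Theory Num.Theory.
Local Open Scope ring_scope.

(* Z_p is built as the inverse limit of the rings Z/p^n: an element is a       *)
(* sequence of canonical representatives (x_n in [0, p^n)), where x_n is the   *)
(* reduction of x_(n+1).  Primality is a parameter of the type so that Z_p can *)
(* be equipped with its integral domain structure.                             *)
Record padic_int (p : nat) (p_pr : prime p) := PadicInt {
  padic_mod : nat -> int;
  padic_modP : forall n, (padic_mod n.+1 %% p%:Z ^+ n)%Z = padic_mod n }.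

Section PadicInt.
Variables (p : nat) (p_pr : prime p).
Local Notation Zp := (padic_int p_pr).
Local Notation P n := (p%:Z ^+ n).

HB.instance Definition _ := gen_eqMixin Zp.
HB.instance Definition _ := gen_choiceMixin Zp.

Lemma padic_ext (x y : Zp) : (forall n, padic_mod x n = padic_mod y n) -> x = y.
Proof.
case: x y => [x xP] [y yP] /= /funext exy.
by rewrite exy in xP *; congr PadicInt; apply: Prop_irrelevance.
Qed.

Lemma padic_mod_id (x : Zp) n : (padic_mod x n %% P n)%Z = padic_mod x n.
Proof. by rewrite -{1}(padic_modP x n) modz_mod padic_modP. Qed.

Lemma modz_pexpS (m : int) n : ((m %% P n.+1)%Z %% P n)%Z = (m %% P n)%Z.
Proof.
by rewrite {2}(divz_eq m (P n.+1)) exprS mulrA modzMDl.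
Qed.

Lemma padic_oppP (x : Zp) n :
  ((- padic_mod x n.+1 %% P n.+1)%Z %% P n)%Z = (- padic_mod x n %% P n)%Z.
Proof. by rewrite modz_pexpS -modzNm padic_modP. Qed.

Lemma padic_addP (x y : Zp) n :
  (((padic_mod x n.+1 + padic_mod y n.+1) %% P n.+1)%Z %% P n)%Z
    = ((padic_mod x n + padic_mod y n) %% P n)%Z.
Proof. by rewrite modz_pexpS -modzDm !padic_modP. Qed.

Lemma padic_mulP (x y : Zp) n :
  (((padic_mod x n.+1 * padic_mod y n.+1) %% P n.+1)%Z %% P n)%Z
    = ((padic_mod x n * padic_mod y n) %% P n)%Z.
Proof. by rewrite modz_pexpS -modzMm !padic_modP. Qed.

Definition padic_of_int (m : int) : Zp := PadicInt p_pr (modz_pexpS m).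
Definition padic_opp (x : Zp) : Zp := PadicInt p_pr (padic_oppP x).
Definition padic_add (x y : Zp) : Zp := PadicInt p_pr (padic_addP x y).
Definition padic_mul (x y : Zp) : Zp := PadicInt p_pr (padic_mulP x y).

Fact padic_addA : associative padic_add.
Proof.
by move=> x y z; apply: padic_ext => n /=; rewrite modzDmr modzDml addrA.
Qed.

Fact padic_addC : commutative padic_add.
Proof. by move=> x y; apply: padic_ext => n /=; rewrite addrC. Qed.

Fact padic_add0 : left_id (padic_of_int 0) padic_add.
Proof.
by move=> x; apply: padic_ext => n /=; rewrite modzDml add0r padic_mod_id.
Qed.

Fact padic_addN : left_inverse (padic_of_int 0) padic_opp padic_add.
Proof. by move=> x; apply: padic_ext => n /=; rewrite modzDml addNr. Qed.

HB.instance Definition _ :=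
  GRing.isZmodule.Build Zp padic_addA padic_addC padic_add0 padic_addN.

Fact padic_mulA : associative padic_mul.
Proof.
by move=> x y z; apply: padic_ext => n /=; rewrite modzMmr modzMml mulrA.
Qed.

Fact padic_mulC : commutative padic_mul.
Proof. by move=> x y; apply: padic_ext => n /=; rewrite mulrC. Qed.

Fact padic_mul1 : left_id (padic_of_int 1) padic_mul.
Proof.
by move=> x; apply: padic_ext => n /=; rewrite modzMml mul1r padic_mod_id.
Qed.

Fact padic_mulD : left_distributive padic_mul padic_add.
Proof.
by move=> x y z; apply: padic_ext => n /=; rewrite modzMml modzDm mulrDl.
Qed.

Fact padic_1neq0 : padic_of_int 1 != 0.
Proof.
apply/eqP => /(congr1 (fun x : Zp => padic_mod x 1)) /=.
by rewrite expr1 mod0z modz_small //= ltz_nat prime_gt1.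
Qed.

HB.instance Definition _ := GRing.Zmodule_isComNzRing.Build Zp
  padic_mulA padic_mulC padic_mul1 padic_mulD padic_1neq0.

Definition padic_unit : {pred Zp} := [pred x | `[< exists y, y * x = 1 >]].
Definition padic_inv (x : Zp) : Zp := xget x [set y | y * x = 1].

Fact padic_mulV : {in padic_unit, left_inverse 1 padic_inv *%R}.
Proof. by move=> x /asboolP[y yx1]; rewrite /padic_inv; case: xgetP => // /(_ y). Qed.

Fact padic_unitP x y : y * x = 1 -> x \in padic_unit.
Proof. by move=> yx1; apply/asboolP; exists y. Qed.

Fact padic_inv_out : {in [predC padic_unit], padic_inv =1 id}.
Proof.
move=> x /= xN; rewrite /padic_inv; case: xgetP => // y _ yx1.
by case/negP: xN; apply: (@padic_unitP x y).
Qed.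

HB.instance Definition _ := GRing.ComNzRing_hasMulInverse.Build Zp
  padic_mulV padic_unitP padic_inv_out.

Lemma padic_mod_leq (x : Zp) m n : (m <= n)%N ->
  (padic_mod x n %% P m)%Z = padic_mod x m.
Proof.
elim: n => [|n IHn]; first by rewrite leqn0 => /eqP ->; rewrite padic_mod_id.
rewrite leq_eqVlt => /predU1P[-> | /[!ltnS] le_mn]; first exact: padic_mod_id.
rewrite -(IHn le_mn) -(padic_modP x n).
have defPn: P n = P (n - m) * P m by rewrite -exprD subnK.
by rewrite [in LHS](divz_eq (padic_mod x n.+1) (P n)) {2}defPn mulrA modzMDl.
Qed.

Fact padic_idomain (x y : Zp) : x * y = 0 -> (x == 0) || (y == 0).
Proof.
have neq0 (z : Zp) : z != 0 -> exists n, padic_mod z n != 0.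
  move=> z_neq0; apply: contrapT => z0; case/eqP: z_neq0.
  apply: padic_ext => n /=; rewrite mod0z.
  by apply/eqP/negP => /negP zn; apply: z0; exists n.
have dvdzM (a b : int) m n : (P (m + n) %| a * b)%Z ->
    (P m %| a)%Z || (P n %| b)%Z.
  rewrite !dvdzE abszM !abszX /=.
  have [-> | a_gt0] := posnP `|a|%N; first by rewrite dvdn0.
  have [-> | b_gt0] := posnP `|b|%N; first by rewrite dvdn0 orbT.
  rewrite !pfactor_dvdn ?muln_gt0 ?a_gt0 // lognM // => le_mn.
  apply: contraTT le_mn; rewrite negb_or -!ltnNge => /andP[lt_m lt_n].
  by rewrite -addSn leq_add // ltnW.
move=> xy0; apply/norP => -[/neq0[m xm] /neq0[n yn]].
have /(congr1 (fun z : Zp => padic_mod z (m + n))) /= := xy0.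
rewrite mod0z => /dvdz_mod0P/dvdzM/orP[] /dvdz_mod0P.
  by rewrite padic_mod_leq ?leq_addr // => /eqP; rewrite (negPf xm).
by rewrite padic_mod_leq ?leq_addl // => /eqP; rewrite (negPf yn).
Qed.

HB.instance Definition _ :=
  GRing.ComUnitRing_isIntegral.Build Zp padic_idomain.

End PadicInt.

Notation padic_num p_pr := {fraction (padic_int p_pr)}.

Section PadicGamma.
Variables (p : nat) (p_pr : prime p).
Local Notation Zp := (padic_int p_pr).

Definition padic_congr (n : nat) (x y : Zp) : Prop :=
  exists z, x - y = z * p%:R ^+ n.

Definition padic_continuous (f : Zp -> Zp) : Prop :=
  forall x N, exists M, forall y, padic_congr M x y -> padic_congr N (f x) (f y).

Definition padic_gamma_nat (n : nat) : int :=
  (-1) ^+ n * \prod_(1 <= j < n | ~~ (p %| j)%N) j%:Z.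

Definition padic_gamma : Zp -> Zp :=
  xget (fun=> 0) [set f | padic_continuous f /\
                          forall n : nat, f n%:R = (padic_gamma_nat n)%:~R].

End PadicGamma.

Section IntegerRing.
Variables (p : nat) (p_pr : prime p) (K : fieldExtType (padic_num p_pr)).
Local Notation Zp := (padic_int p_pr).

Definition padic_in : Zp -> K := in_alg K \o @tofrac Zp.

Definition integer_pred : {pred K} := [pred x | `[< integralOver padic_in x >]].

Fact integer_subring : subring_closed integer_pred.
Proof.
split=> [|x y /asboolP xZ /asboolP yZ|x y /asboolP xZ /asboolP yZ].
- by apply/asboolP; apply: integral1.
- by apply/asboolP; apply: integral_sub.
- by apply/asboolP; apply: integral_mul.
Qed.

HB.instance Definition _ :=
  GRing.isSubringClosed.Build K integer_pred integer_subring.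

Record integer_ring := IntegerRing {
  integer_val :> K;
  integer_valP : integer_val \in integer_pred }.

HB.instance Definition _ := [isSub for integer_val].
HB.instance Definition _ := [Choice of integer_ring by <:].
HB.instance Definition _ :=
  [SubChoice_isSubComNzRing of integer_ring by <:].

End IntegerRing.

Section HypergeometricG.
Variables (p : nat) (p_pr : prime p) (K : fieldExtType (padic_num p_pr)).
Variable F : finFieldType.
Local Notation Zq := (integer_ring K).
Variable res : {rmorphism Zq -> F}.

(* The kernel condition says that p generates the maximal ideal of Z_q, i.e.,  *)
(* that K is unramified over Q_p.                                              *)
Definition unramified_residue_map : Prop :=
  (forall a : F, exists x : Zq, res x = a) /\
  (forall x : Zq, res x = 0 <-> exists y : Zq, x = p%:R * y).

Definition quad_char (a : F) : K :=
  if a == 0 then 0 else if [exists b, a == b ^+ 2] then 1 else -1.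

Definition teichmuller (a : F) : Zq :=
  xget 0 [set z : Zq | z ^+ #|F|.-1 = 1 /\ res z = a].

Definition teichmuller_inv (m : nat) (t : F) : K :=
  if t == 0 then 0 else (teichmuller t : K) ^- m.

Definition frac_part (x : rat) : rat := x - (Num.floor x)%:~R.

(* For x in Q with denominator prime to p, ratr x is the image of x in Z_p.    *)
Definition gammaQ (x : rat) : K := padic_in K (padic_gamma (ratr x)).

Definition mccarthyG (r n : nat) (a b : 'I_n -> rat) (t : F) : K :=
  let q := (p ^ r)%N in
  let y (m : nat) : rat := m%:R / q.-1%:R in
  - 1 / q.-1%:R *
  \sum_(0 <= m < q.-1)
    (-1) ^+ (m * n) * teichmuller_inv m t *
    \prod_(j < n) \prod_(0 <= i < r)
      ((- p%:R) ^ (- Num.floor (frac_part (a j * p%:R ^+ i) - y m * p%:R ^+ i)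
                   - Num.floor (frac_part (- b j * p%:R ^+ i) + y m * p%:R ^+ i))
       * (gammaQ (frac_part ((a j - y m) * p%:R ^+ i))
            / gammaQ (frac_part (a j * p%:R ^+ i)))
       * (gammaQ (frac_part ((- b j + y m) * p%:R ^+ i))
            / gammaQ (frac_part (- b j * p%:R ^+ i)))).

End HypergeometricG.

(* Main.v *)
Require Import Defs.
From HB Require Import structures.
From mathcomp Require Import all_boot all_order all_algebra all_solvable all_field.
From mathcomp Require Import boolp classical_sets.
From mathcomp Require Import ring lra zify.

Set Implicit Arguments.
Unset Strict Implicit.
Unset Printing Implicit Defensive.

Import Order.TTheory GRing.Theory Num.Theory.
Local Open Scope ring_scope.

(** Write [q = p^r], and let [w] be the inverse of the Teichmuller character. In
    both hypergeometric functions the term of index [a] is the product of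
    [w^a(t)] and of one factor for each parameter, upper or lower. Compared with
    the left-hand side, the right-hand side has one more upper parameter,
    [1/2 = (d/2)/d], and one more lower parameter, 0. As [w^a] is multiplicative,
    exchanging the sums over [t] and [a] reduces the theorem to an identity for
    each [a]: the sum
      [J_a = sum_t phi(1-t) w^a(t)]
    is, up to sign, the factor of the pair (1/2, 0) ([jacobi_sum_factors]).
    With [y_i] the fractional part of [a p^i / (q-1)], and [c_i] equal to 1 if
    [y_i > 1/2] and to 0 otherwise, this says ([jacobi_sum_formula])
      [(-1)^a J_a = - prod_i (-p)^(c_i) Gamma(1/2 - y_i + c_i) Gamma(y_i) / Gamma(1/2)],
    which is the formula of Gross and Koblitz for the quadratic Jacobi sums.
    The proof below follows Dwork, but avoids Gauss sums: only polynomials over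
    the unramified integers occur.

    Trace formula. For [t] other than 0 and 1, and every [m], [phi(1-t)] is the
    value of [((1-X^q)/(1-X))^(m+1/2)] at the Teichmuller representative of [t]:
    its square is 1 since [X^q = X] there, and modulo [p] it is given by Euler's
    criterion.
    Modulo [p^N] this series can be replaced by a polynomial [h]
    ([frobenius_poly_exists]), and the sum of [h(T) T^(-a)] over the roots of unity
    [T] is [q - 1] times the trace of the operator that multiplies by [h] and keeps
    the coefficients of index [q n + a], on polynomials of degree at most [m]
    ([jacobi_sum_cong]). The operators for [m + 1] and [m] commute, up to a factor
    [q], with the derivation [X d/dX] twisted by [X^alpha (1-X)^(-(m+3/2))], where
    [alpha = a / (q-1)] ([cartier_twisted_der]). The kernel of this derivation is
    trivial and its cokernel is a line, so that [J_a] is minus the eigenvalue on that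
    line ([lefschetz_trace]).

    Eigenvalue. The linear form defining the cokernel is polynomial in [alpha], and at
    a negative integer [-n] it is the coefficient of [X^n] in
    [(1-X)^(-(m+3/2)) P]. Comparing the two gives [J_a = - b(q n + a) / b(n)]
    approximately, with [b(n)] the coefficients of [(1-X)^(-1/2)], when [n] is
    close to [- alpha] ([frobenius_half_bin]). For
    [n = a (1 + q + ... + q^(s-1))], the number [q n + a] is the next one of the
    sequence, and it is obtained from [n] by appending the [r] digits of [a] in
    base [p]. Appending one digit multiplies [b], up to a correction at the ends,
    by a power of [p] and a quotient of gamma values ([half_bin_carry_step]).
    In the limit [s] to infinity this is the product above. The quantities that
    have to be cancelled on the way are not units; the degree [m] is chosen such
    that the precision [p^N] exceeds them ([precision_exists]). *)

(** * Congruences of polynomials modulo a scalar and a power of the variable *)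

Section Divisibility.
Variable R : comNzRingType.
Implicit Types (c x y : R) (f g h : {poly R}).

Definition rdvd c x := exists z, x = c * z.

Lemma rdvd_refl c : rdvd c c.
Proof. by exists 1; rewrite mulr1. Qed.

Lemma rdvdr0 c : rdvd c 0.
Proof. by exists 0; rewrite mulr0. Qed.

Lemma rdvdD c x y : rdvd c x -> rdvd c y -> rdvd c (x + y).
Proof. by move=> [z ->] [t ->]; exists (z + t); rewrite mulrDr. Qed.

Lemma rdvdMr c x y : rdvd c x -> rdvd c (x * y).
Proof. by move=> [z ->]; exists (z * y); rewrite mulrA. Qed.

Lemma rdvdMl c x y : rdvd c y -> rdvd c (x * y).
Proof. by rewrite mulrC; apply: rdvdMr. Qed.

Lemma rdvdM a b x y : rdvd a x -> rdvd b y -> rdvd (a * b) (x * y).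
Proof. by move=> [z ->] [t ->]; exists (z * t); ring. Qed.

Lemma rdvdN c x : rdvd c x -> rdvd c (- x).
Proof. by rewrite -mulN1r; apply: rdvdMl. Qed.

Lemma rdvdB c x y : rdvd c x -> rdvd c y -> rdvd c (x - y).
Proof. by move=> cx /rdvdN; apply: rdvdD. Qed.

Lemma rdvd_congl c x y : rdvd c (x - y) -> rdvd c x -> rdvd c y.
Proof. by move=> cxy cx; have := rdvdB cx cxy; rewrite opprB addrC subrK. Qed.

Lemma rdvd_trans c x y : rdvd c x -> rdvd x y -> rdvd c y.
Proof. by move=> [z ->] [t ->]; exists (z * t); rewrite mulrA. Qed.

Lemma rdvd_sum c (I : Type) (r : seq I) (P : pred I) (F : I -> R) :
  (forall i, P i -> rdvd c (F i)) -> rdvd c (\sum_(i <- r | P i) F i).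
Proof. by move=> dF; apply: big_ind => //; [apply: rdvdr0 | apply: rdvdD]. Qed.

Lemma rdvd_subX c n x y : rdvd c (x - y) -> rdvd c (x ^+ n - y ^+ n).
Proof. by rewrite subrXX; apply: rdvdMr. Qed.

Lemma rdvd_congM c x1 x2 y1 y2 :
  rdvd c (x1 - x2) -> rdvd c (y1 - y2) -> rdvd c (x1 * y1 - x2 * y2).
Proof.
have -> : x1 * y1 - x2 * y2 = (x1 - x2) * y1 + x2 * (y1 - y2) by ring.
by move=> d1 d2; apply: rdvdD; [apply: rdvdMr | apply: rdvdMl].
Qed.

Lemma rdvd_prod_sub c (I : Type) (r : seq I) (P : pred I) (F G : I -> R) :
  (forall i, P i -> rdvd c (F i - G i)) ->
  rdvd c (\prod_(i <- r | P i) F i - \prod_(i <- r | P i) G i).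
Proof.
move=> FG; apply: (big_ind2 (fun x y => rdvd c (x - y))) => //.
  by rewrite subrr; apply: rdvdr0.
by move=> x1 x2 y1 y2; apply: rdvd_congM.
Qed.

Lemma rdvd_exp c m n : (m <= n)%N -> rdvd (c ^+ m) (c ^+ n).
Proof. by move=> le_mn; exists (c ^+ (n - m)); rewrite -exprD subnKC. Qed.

(** Congruence modulo the ideal generated by [c] and ['X^M]. For [c = 0] it is
    equality of truncated power series, which lets all arguments with power
    series be carried out on polynomials. *)
Definition pcong c M f g := forall i, (i < M)%N -> rdvd c (f - g)`_i.

Lemma pcong_refl c M f : pcong c M f f.
Proof. by move=> i _; rewrite subrr coef0; apply: rdvdr0. Qed.

Arguments pcong_refl {c M} f.

Lemma pcong_sym c M f g : pcong c M f g -> pcong c M g f.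
Proof. by move=> fg i /fg; rewrite -opprB coefN => /rdvdN; rewrite opprK. Qed.

Lemma pcong_trans c M f g h : pcong c M f g -> pcong c M g h -> pcong c M f h.
Proof.
move=> fg gh i lt_i; have := rdvdD (fg i lt_i) (gh i lt_i).
by rewrite -coefD addrA subrK.
Qed.

Lemma pcongM c M f1 f2 g1 g2 :
  pcong c M f1 g1 -> pcong c M f2 g2 -> pcong c M (f1 * f2) (g1 * g2).
Proof.
move=> fg1 fg2 i lt_i.
have -> : f1 * f2 - g1 * g2 = (f1 - g1) * f2 + g1 * (f2 - g2) by ring.
rewrite coefD !coefM; apply: rdvdD; apply: rdvd_sum => j _.
  by apply/rdvdMr/fg1/(leq_ltn_trans _ lt_i); rewrite -ltnS.
by apply/rdvdMl/fg2/(leq_ltn_trans _ lt_i); rewrite leq_subr.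
Qed.

Lemma pcongD c M f1 f2 g1 g2 :
  pcong c M f1 g1 -> pcong c M f2 g2 -> pcong c M (f1 + f2) (g1 + g2).
Proof.
move=> fg1 fg2 i lt_i; have -> : f1 + f2 - (g1 + g2) = (f1 - g1) + (f2 - g2) by ring.
by rewrite coefD; apply: rdvdD; [apply: fg1 | apply: fg2].
Qed.

Lemma pcongX c M f g n : pcong c M f g -> pcong c M (f ^+ n) (g ^+ n).
Proof.
move=> fg; elim: n => [|n IHn]; first exact: pcong_refl.
by rewrite !exprS; apply: pcongM.
Qed.

Lemma pcong_sum c M (I : Type) (r : seq I) (P : pred I) (F G : I -> {poly R}) :
  (forall i, P i -> pcong c M (F i) (G i)) ->
  pcong c M (\sum_(i <- r | P i) F i) (\sum_(i <- r | P i) G i).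
Proof.
by move=> FG; apply: (big_ind2 (pcong c M)) => //;
  [apply: pcong_refl | move=> ? ? ? ?; apply: pcongD].
Qed.

Lemma pcong_sub c d M M' f g :
  rdvd c d -> (M <= M')%N -> pcong d M' f g -> pcong c M f g.
Proof. by move=> cd leM fg i lt_i; apply: rdvd_trans cd (fg i _); apply: leq_trans leM. Qed.

Lemma pcong_cstM c M f : pcong c M (c%:P * f) 0.
Proof. by move=> i _; rewrite subr0 coefCM; exists f`_i. Qed.

Lemma pcong_XnM c M f : pcong c M ('X^M * f) 0.
Proof. by move=> i lt_i; rewrite subr0 coefXnM lt_i; apply: rdvdr0. Qed.

(** The constant term 1 makes [f] a unit of the power series ring, hence
    regular modulo [c] and modulo any power of ['X]. *)
Lemma pcong_cancel c M f g h :
  f`_0 = 1 -> pcong c M (f * g) (f * h) -> pcong c M g h.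
Proof.
move=> f0 fgh; suff null k : pcong c M (f * k) 0 -> pcong c M k 0.
  have /null gh : pcong c M (f * (g - h)) 0.
    by move=> i /fgh; rewrite subr0 mulrBr.
  by move=> i /gh; rewrite subr0.
move=> fk0 i; elim/ltn_ind: i => i IHi lt_i; have := fk0 i lt_i.
rewrite !subr0 coefM big_ord_recl /= f0 mul1r subn0 => fk_i.
rewrite -[k`_i](addrK (\sum_(j < i) f`_(bump 0 j) * k`_(i - bump 0 j))).
apply: rdvdB => //; apply: rdvd_sum => j _; apply: rdvdMl.
have lt_j : (i - bump 0 j < i)%N by rewrite /bump add1n; case: i j {IHi lt_i fk_i} => [[]|] //= i j; lia.
by move: (IHi _ lt_j (ltn_trans lt_j lt_i)); rewrite subr0.
Qed.

Lemma pcong_deriv c M f g : pcong c M.+1 f g -> pcong c M f^`() g^`().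
Proof.
move=> fg i lt_i; rewrite -derivB coef_deriv -mulr_natr.
by apply/rdvdMr/fg.
Qed.

Lemma coef_comp_Xn f q i : (0 < q)%N ->
  (f \Po 'X^q)`_i = if (q %| i)%N then f`_(i %/ q) else 0.
Proof. by move=> q_gt0; rewrite coef_comp_poly_Xn. Qed.

Lemma pcong_comp_Xn c M f g q : (0 < q)%N ->
  pcong c M f g -> pcong c (q * M) (f \Po 'X^q) (g \Po 'X^q).
Proof.
move=> q_gt0 fg i lt_i; rewrite -comp_polyB coef_comp_Xn //.
by case: ifP => _; [apply: fg; rewrite ltn_divLR // mulnC | apply: rdvdr0].
Qed.

Section Half.
Variable half : R.
Hypothesis half2 : half * 2%:R = 1.

(** [(f + g) / 2] has constant term 1 and multiplies [f - g] to
    [(f ^+ 2 - g ^+ 2) / 2]. *)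
Lemma pcong_sqrt_uniq c M f g :
  f`_0 = 1 -> g`_0 = 1 -> pcong c M (f ^+ 2) (g ^+ 2) -> pcong c M f g.
Proof.
move=> f0 g0 fg2.
have k0 : (half%:P * (f + g))`_0 = 1 by rewrite coefCM coefD f0 g0.
apply: (pcong_cancel k0).
have -> : half%:P * (f + g) * f = half%:P * (f * g) + half%:P * f ^+ 2 by ring.
have -> : half%:P * (f + g) * g = half%:P * (f * g) + half%:P * g ^+ 2 by ring.
by apply: pcongD; [apply: pcong_refl | apply: pcongM => //; apply: pcong_refl].
Qed.

(** The next coefficient of the root enters the square linearly, with the
    invertible factor 2. *)
Lemma pcong_sqrt_exists f M :
  f`_0 = 1 -> exists s : {poly R}, s`_0 = 1 /\ pcong 0 M (s ^+ 2) f.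
Proof.
move=> f0; elim: M => [|[_|M [s [s0 sf]]]]; first by exists 1; rewrite coef1.
  exists 1; rewrite coef1; split=> // -[] // _.
  by rewrite expr1n coefB coef1 f0 subrr; apply: rdvdr0.
pose t := half * (f`_M.+1 - (s ^+ 2)`_M.+1).
exists (s + t%:P * 'X^(M.+1)); split.
  by rewrite coefD s0 coefCM coefXn /= mulr0 addr0.
move=> i; rewrite ltnS leq_eqVlt => /orP[/eqP-> | lt_i].
  have -> : (s + t%:P * 'X^(M.+1)) ^+ 2 - f = s ^+ 2 - f +
     (t * 2%:R)%:P * ('X^(M.+1) * s) + 'X^(M.+2) * ((t ^+ 2)%:P * 'X^M).
    by rewrite !exprS !polyCM; ring.
  rewrite !coefD coefN coefCM coefXnM ltnn subnn s0 coefXnM ltnSn addr0 mulr1.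
  rewrite /t mulrAC half2 mul1r.
  by rewrite (_ : _ + _ = 0) //; [apply: rdvdr0 | ring].
have -> : (s + t%:P * 'X^(M.+1)) ^+ 2 - f = (s ^+ 2 - f) +
     'X^(M.+1) * ((t * 2%:R)%:P * s + (t ^+ 2)%:P * 'X^(M.+1)).
  by rewrite !polyCM; ring.
by rewrite coefD coefXnM lt_i addr0; apply: sf.
Qed.

End Half.

Lemma pcong_inv_exists M : exists v : {poly R}, pcong 0 M ((1 - 'X) * v) 1.
Proof.
exists (\sum_(i < M) 'X^i).
have -> : (1 - 'X) * \sum_(i < M) 'X^i = 1 + 'X^M * (-1) :> {poly R}.
  by rewrite -opprB mulNr -subrX1; ring.
rewrite -[X in pcong _ _ _ X]addr0.
by apply: pcongD; [apply: pcong_refl | apply: pcong_XnM].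
Qed.

End Divisibility.

Arguments pcong_refl {R c M} f.

(** * Traces of linear operators on polynomials *)

Section PolyOperators.
Variable R : comNzRingType.
Implicit Types (A B : {poly R} -> {poly R}) (P Q : {poly R}).

Definition linear_op A := forall a P Q, A (a *: P + Q) = a *: A P + A Q.

Lemma linear_op_comp A B : linear_op A -> linear_op B -> linear_op (A \o B).
Proof. by move=> linA linB a P Q /=; rewrite linB linA. Qed.

Lemma poly_wide d P : (size P <= d)%N -> P = \sum_(i < d) P`_i *: 'X^i.
Proof.
move=> leP; rewrite -(poly_def d (nth 0 P)); apply/polyP => i.
rewrite coef_poly; case: ltnP => // le_di.
by rewrite nth_default // (leq_trans leP).
Qed.

Section LinearOp.
Variable A : {poly R} -> {poly R}.
Hypothesis linA : linear_op A.

Lemma linear_op0 : A 0 = 0.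
Proof. by have := linA (-1) 0 0; rewrite scaler0 addr0 scaleN1r addNr. Qed.

Lemma linear_opZ a P : A (a *: P) = a *: A P.
Proof. by rewrite -[a *: P]addr0 linA linear_op0 addr0. Qed.

Lemma linear_opD P Q : A (P + Q) = A P + A Q.
Proof. by rewrite -[P]scale1r linA !scale1r. Qed.

Lemma linear_opB P Q : A (P - Q) = A P - A Q.
Proof. by rewrite linear_opD -scaleN1r linear_opZ scaleN1r. Qed.

Lemma linear_op_sum (I : Type) (r : seq I) (P : pred I) (F : I -> {poly R}) :
  A (\sum_(i <- r | P i) F i) = \sum_(i <- r | P i) A (F i).
Proof. by rewrite (big_morph A linear_opD linear_op0). Qed.

Lemma linear_op_expand d P : (size P <= d)%N ->
  A P = \sum_(i < d) P`_i *: A 'X^i.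
Proof.
move=> /poly_wide {1}->; rewrite linear_op_sum.
by apply: eq_bigr => i _; rewrite linear_opZ.
Qed.

Lemma linear_op_rdvd c P :
  (forall i, rdvd c P`_i) -> forall i, rdvd c (A P)`_i.
Proof.
move=> cP i; rewrite (linear_op_expand (leqnn (size P))) coef_sum.
by apply: rdvd_sum => j _; rewrite coefZ; apply: rdvdMr.
Qed.

End LinearOp.

Lemma eq_linear_op d A B : linear_op A -> linear_op B ->
  (forall i, (i < d)%N -> A 'X^i = B 'X^i) ->
  forall P, (size P <= d)%N -> A P = B P.
Proof.
move=> linA linB AB P leP.
rewrite (linear_op_expand linA leP) (linear_op_expand linB leP).
by apply: eq_bigr => i _; rewrite AB.
Qed.

Definition ptrace d A : R := \sum_(i < d) (A 'X^i)`_i.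

(** The dimensions [d] and [e] differ because this is applied to the two terms
    of a complex: one operator is an almost inverse of the differential, the
    other contains the differential. *)
Lemma ptraceC d e A B : linear_op A -> linear_op B ->
  (forall i, (i < d)%N -> (size (A 'X^i) <= e)%N) ->
  (forall j, (j < e)%N -> (size (B 'X^j) <= d)%N) ->
  ptrace d (B \o A) = ptrace e (A \o B).
Proof.
move=> linA linB leA leB; rewrite /ptrace.
under eq_bigr => i _ do
  rewrite /= (linear_op_expand linB (leA _ (ltn_ord i))) coef_sum.
under [RHS]eq_bigr => j _ do
  rewrite /= (linear_op_expand linA (leB _ (ltn_ord j))) coef_sum.
rewrite exchange_big; apply: eq_bigr => j _; apply: eq_bigr => i _.
by rewrite !coefZ mulrC.
Qed.

(** * Bidiagonal operators *)

Section Bidiagonal.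
Variables (m : nat) (r s : nat -> R).

Definition bidiag P : {poly R} :=
  \sum_(l < m) P`_l *: (r l *: 'X^l - s l *: 'X^(l.+1)).

(** Up to the factor [prod r], the inverse of [bidiag]: solving
    [r l X^l = bidiag X^l + s l X^(l+1)] repeatedly and clearing the
    denominators [r l] gives these products. *)
Definition bidiag_inv P : {poly R} :=
  \sum_(l < m) P`_l *: (\sum_(l <= j < m)
    ((\prod_(l <= t < j) s t) * (\prod_(0 <= t < l) r t) *
     (\prod_(j.+1 <= t < m) r t)) *: 'X^j).

(** The linear form that vanishes on the image of [bidiag]: its values satisfy
    [r l * form X^l = s l * form X^(l+1)]. *)
Definition bidiag_form P : R :=
  \sum_(l < m.+1) P`_l * ((\prod_(0 <= t < l) r t) * (\prod_(l <= t < m) s t)).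

Lemma bidiag_linear : linear_op bidiag.
Proof.
move=> a P Q; rewrite scaler_sumr -big_split; apply: eq_bigr => i _ /=.
by rewrite coefD coefZ scalerDl scalerA.
Qed.

Lemma bidiag_inv_linear : linear_op bidiag_inv.
Proof.
move=> a P Q; rewrite scaler_sumr -big_split; apply: eq_bigr => i _ /=.
by rewrite coefD coefZ scalerDl scalerA.
Qed.

Lemma bidiag_formD a P Q : bidiag_form (a *: P + Q) = a * bidiag_form P + bidiag_form Q.
Proof.
rewrite mulr_sumr -big_split; apply: eq_bigr => i _ /=.
by rewrite coefD coefZ mulrDl mulrA.
Qed.

Lemma bidiagXn l : (l < m)%N -> bidiag 'X^l = r l *: 'X^l - s l *: 'X^(l.+1).
Proof.
move=> lt_lm; rewrite /bidiag (bigD1 (Ordinal lt_lm)) //= coefXn eqxx scale1r.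
rewrite [X in _ + X]big1 ?addr0 // => i /negPf ne_i.
by rewrite coefXn -(inj_eq val_inj) /= in ne_i *; rewrite ne_i scale0r.
Qed.

Lemma bidiag_invXn l : (l <= m)%N -> bidiag_inv 'X^l =
  \sum_(l <= j < m) ((\prod_(l <= t < j) s t) * (\prod_(0 <= t < l) r t) *
     (\prod_(j.+1 <= t < m) r t)) *: 'X^j.
Proof.
rewrite leq_eqVlt => /orP[/eqP-> | lt_lm].
  by rewrite [RHS]big_geq // /bidiag_inv big1 // => i _; rewrite coefXn ltn_eqF // scale0r.
rewrite /bidiag_inv (bigD1 (Ordinal lt_lm)) //= coefXn eqxx scale1r.
rewrite [X in _ + X]big1 ?addr0 // => i /negPf ne_i.
by rewrite coefXn -(inj_eq val_inj) /= in ne_i *; rewrite ne_i scale0r.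
Qed.

Lemma bidiag_formXn l : (l <= m)%N -> bidiag_form 'X^l =
  (\prod_(0 <= t < l) r t) * (\prod_(l <= t < m) s t).
Proof.
rewrite -ltnS => lt_lm; rewrite /bidiag_form (bigD1 (Ordinal lt_lm)) //= coefXn eqxx mul1r.
rewrite [X in _ + X]big1 ?addr0 // => i /negPf ne_i.
by rewrite coefXn -(inj_eq val_inj) /= in ne_i *; rewrite ne_i mul0r.
Qed.

Lemma size_bidiag_inv P : (size (bidiag_inv P) <= m)%N.
Proof.
apply/leq_sizeP => j le_mj; rewrite coef_sum big1 // => l _.
rewrite coefZ coef_sum [X in _ * X]big1_seq ?mulr0 // => i; rewrite mem_index_iota => /and3P[_ _ lt_im].
by rewrite coefZ coefXn gtn_eqF ?mulr0 // (leq_trans lt_im).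
Qed.

Definition bidiag_det := \prod_(0 <= t < m) r t.

Lemma bidiag_detE l : (l < m)%N -> bidiag_det =
  (\prod_(0 <= t < l) r t) * r l * \prod_(l.+1 <= t < m) r t.
Proof.
move=> lt_lm; rewrite /bidiag_det (@big_cat_nat _ _ _ l.+1) //=.
by rewrite big_nat_recr.
Qed.

Lemma bidiag_invK P : (size P <= m)%N ->
  bidiag_inv (bidiag P) = bidiag_det *: P.
Proof.
apply: (@eq_linear_op m (bidiag_inv \o bidiag) ( *:%R bidiag_det)).
- exact: linear_op_comp bidiag_inv_linear bidiag_linear.
- by move=> a {}P Q; rewrite scalerDr !scalerA mulrC.
move=> l lt_lm /=; rewrite bidiagXn // -scaleNr addrC.
rewrite bidiag_inv_linear (linear_opZ bidiag_inv_linear).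
rewrite !bidiag_invXn // 1?ltnW // [X in _ + _ *: X]big_ltn //.
rewrite scalerDr [\prod_(l <= t < l) _]big_geq // mul1r scalerA addrCA.
rewrite [X in _ + X = _](_ : _ = 0) ?addr0; last first.
  rewrite !scaler_sumr -big_split big1_seq //= => j; rewrite mem_index_iota => /andP[lt_lj lt_jm].
  rewrite !scalerA -scalerDl big_nat_recr //= (big_ltn lt_lj).
  by rewrite (_ : _ + _ = 0) ?scale0r //; ring.
by rewrite (bidiag_detE lt_lm); congr (_ *: _); ring.
Qed.

(** Each ['X^j] in [bidiag_inv 'X^l] is sent to a difference of consecutive
    terms, and only the two ends of the telescope survive. *)
Lemma bidiagK P : (size P <= m.+1)%N ->
  bidiag (bidiag_inv P) = bidiag_det *: P - bidiag_form P *: 'X^m.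
Proof.
pose B Q := bidiag_det *: Q - bidiag_form Q *: 'X^m.
have linB : linear_op B.
  rewrite /B => a {}P Q; rewrite bidiag_formD scalerDr scalerDl opprD scalerBr.
  by rewrite !scalerA [bidiag_det * a]mulrC addrACA.
apply: (@eq_linear_op m.+1 (bidiag \o bidiag_inv) B) => //.
  exact: linear_op_comp bidiag_linear bidiag_inv_linear.
move=> l; rewrite ltnS => le_lm /=; rewrite /B bidiag_invXn // bidiag_formXn //.
rewrite (linear_op_sum bidiag_linear).
pose g j := (\prod_(l <= t < j) s t) * (\prod_(0 <= t < l) r t) * (\prod_(j <= t < m) r t).
transitivity (- \sum_(l <= j < m) (g j.+1 *: 'X^(j.+1) - g j *: 'X^j : {poly R})).
  rewrite -sumrN; apply: eq_big_nat => j /andP[le_lj lt_jm].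
  rewrite (linear_opZ bidiag_linear) bidiagXn // scalerBr !scalerA opprB /g.
  rewrite [\prod_(j <= t < m) r t]big_ltn // big_nat_recr //=.
  by congr (_ *: _ - _ *: _); ring.
rewrite telescope_sumr // opprB /g [\prod_(l <= t < l) _]big_geq // [\prod_(m <= t < m) _]big_geq // mul1r mulr1.
rewrite /bidiag_det [\prod_(0 <= t < m) r t](@big_cat_nat _ _ _ l) //=.
by rewrite [X in _ - X *: _]mulrC.
Qed.

End Bidiagonal.
End PolyOperators.

(** * The twisted derivation and its Lefschetz formula *)

Section Lefschetz.
Variable R : comNzRingType.
Implicit Types (A B : {poly R} -> {poly R}) (P Q : {poly R}).

(** The substitution that exchanges the singular points 0 and 1: in powers of
    [1 - 'X] the twisted derivation becomes bidiagonal. *)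
Definition flip P : {poly R} := P \Po (1 - 'X).

Lemma flip_linear : linear_op flip.
Proof. by move=> a P Q; rewrite /flip comp_polyD comp_polyZ. Qed.

Lemma flipK : involutive flip.
Proof.
move=> P; rewrite /flip -comp_polyA comp_polyB comp_polyX comp_polyC.
by rewrite opprB addrC subrK comp_polyXr.
Qed.

Lemma flipXn j : flip 'X^j = (1 - 'X) ^+ j.
Proof. by rewrite /flip comp_Xn_poly. Qed.

Lemma size_flip P : (size (flip P) <= size P)%N.
Proof.
rewrite {1}(poly_wide (leqnn (size P))) (linear_op_sum flip_linear).
apply: leq_trans (size_sum _ _ _) _; apply/bigmax_leqP => j _.
rewrite (linear_opZ flip_linear) (leq_trans (size_scale_leq _ _)) // flipXn.
apply: leq_trans (size_poly_exp_leq _ _) _.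
by rewrite -opprB size_polyN size_XsubC mul1n.
Qed.

Variables (m : nat) (half alpha : R).

(** The connection [f |-> 'X f' + alpha f + kappa 'X/(1-'X) f] with
    [kappa = m + 1/2], i.e. the derivation [X d/dX] twisted by
    [X^alpha (1-X)^(-kappa)], applied to [f = (1-'X) Q]. *)
Definition twisted_der Q : {poly R} :=
  (1 - 'X) * ('X * Q^`() + alpha *: Q) + (m%:R - half) *: ('X * Q).

Lemma twisted_der_linear : linear_op twisted_der.
Proof.
move=> a P Q; rewrite /twisted_der derivD derivZ -!mul_polyC; ring.
Qed.

Definition flip_diag j : R := m%:R - half - j%:R.
Definition flip_offdiag j : R := flip_diag j - alpha.

Local Notation bd := (bidiag m flip_diag flip_offdiag).
Local Notation bdi := (bidiag_inv m flip_diag flip_offdiag).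

Lemma twisted_der_flip Q : (size Q <= m)%N ->
  twisted_der (flip Q) = flip (bd Q).
Proof.
apply: (@eq_linear_op _ m (twisted_der \o flip) (flip \o bd)).
- exact: linear_op_comp twisted_der_linear flip_linear.
- exact: linear_op_comp flip_linear (bidiag_linear _ _ _).
move=> j lt_jm /=; rewrite bidiagXn // -scaleNr flip_linear (linear_opZ flip_linear).
rewrite !flipXn /twisted_der deriv_exp derivB derivX derivC.
rewrite /flip_offdiag /flip_diag -!mul_polyC; case: j lt_jm => [|j] _.
  by rewrite !expr0 expr1 mulr0n !polyCB polyCN polyCB; ring.
rewrite /= !exprS -[X in _ * (X *+ _)]mulr1 -mulr_natr.
rewrite !(polyCB, polyCN, polyC_natr) -natr1; ring.
Qed.

(** An almost inverse of [twisted_der]: exact up to the factor [twist_det] and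
    to a multiple of [(1 - 'X) ^+ m], whose coefficient [twist_form] is the
    class in the one-dimensional cokernel. *)
Definition twist_inv P := flip (bdi (flip P)).
Definition twist_det := bidiag_det m flip_diag.
Definition twist_form P := bidiag_form m flip_diag flip_offdiag (flip P).

Lemma twist_inv_linear : linear_op twist_inv.
Proof.
exact: linear_op_comp flip_linear (linear_op_comp (bidiag_inv_linear _ _ _) flip_linear).
Qed.

Lemma twist_formD a P Q : twist_form (a *: P + Q) = a * twist_form P + twist_form Q.
Proof. by rewrite /twist_form flip_linear bidiag_formD. Qed.

Lemma size_twist_inv P : (size (twist_inv P) <= m)%N.
Proof. by rewrite (leq_trans (size_flip _)) ?size_bidiag_inv. Qed.

Lemma twist_invK P : (size P <= m.+1)%N ->
  twisted_der (twist_inv P) = twist_det *: P - twist_form P *: (1 - 'X) ^+ m.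
Proof.
move=> leP; rewrite twisted_der_flip ?size_bidiag_inv // bidiagK; last first.
  exact: leq_trans (size_flip _) leP.
by rewrite -scaleNr addrC flip_linear (linear_opZ flip_linear) flipK flipXn scaleNr addrC.
Qed.

Lemma twisted_derK Q : (size Q <= m)%N -> twist_inv (twisted_der Q) = twist_det *: Q.
Proof.
move=> leQ; have leTQ : (size (flip Q) <= m)%N by apply: leq_trans (size_flip _) leQ.
rewrite -{1}[Q]flipK twisted_der_flip // /twist_inv flipK bidiag_invK //.
by rewrite (linear_opZ flip_linear) flipK.
Qed.

Lemma size_twisted_der Q : (size Q <= m)%N -> (size (twisted_der Q) <= m.+1)%N.
Proof.
move=> leQ; rewrite -[Q]flipK twisted_der_flip; last first.
  exact: leq_trans (size_flip _) leQ.
apply: leq_trans (size_flip _) _; apply/leq_sizeP => j lt_mj.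
rewrite coef_sum big1 // => l _; rewrite coefZ coefB !coefZ !coefXn.
have lt_lj : (l < j)%N := ltn_trans (ltn_ord l) lt_mj.
have lt_Sl : (l.+1 < j)%N := leq_ltn_trans (ltn_ord l) lt_mj.
by rewrite !gtn_eqF // !mulr0 subrr mulr0.
Qed.

Lemma twist_form_expand P : (size P <= m.+1)%N ->
  twist_form P = \sum_(i < m.+1) P`_i * twist_form 'X^i.
Proof.
move=> /poly_wide {1}->; rewrite (big_morph twist_form (id1 := 0) (op1 := +%R)).
- by apply: eq_bigr => i _; have := twist_formD P`_i 'X^i 0;
   rewrite addr0 => ->; rewrite -[RHS]addr0; congr (_ + _);
   have := twist_formD (-1) 0 0; rewrite scaler0 addr0 mulN1r addNr.
- by move=> {}P Q; rewrite -[P]scale1r twist_formD mul1r scale1r.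
by have := twist_formD (-1) 0 0; rewrite scaler0 addr0 mulN1r addNr.
Qed.

(** Lefschetz principle: the complex [twisted_der] has the one-dimensional
    cohomology detected by [twist_form], so that the alternating trace of a
    pair of operators commuting with it is their action on that cohomology. *)
Theorem lefschetz_trace c lam A1 A0 : linear_op A1 -> linear_op A0 ->
  (forall P, (size P <= m.+1)%N -> (size (A1 P) <= m.+1)%N) ->
  (forall Q, (size Q <= m)%N -> (size (A0 Q) <= m)%N) ->
  (forall Q i, rdvd c (A1 (twisted_der Q) - lam *: twisted_der (A0 Q))`_i) ->
  rdvd c (twist_det * (ptrace m.+1 A1 - lam * ptrace m A0)
          - twist_form (A1 ((1 - 'X) ^+ m))).
Proof.
move=> lin1 lin0 size1 size0 comm.
have szXn d i : (i < d)%N -> (size ('X^i : {poly R}) <= d)%N by rewrite size_polyXn.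
have szu : (size ((1 - 'X) ^+ m : {poly R}) <= m.+1)%N.
  by rewrite -flipXn (leq_trans (size_flip _)) // size_polyXn.
have tr1 : twist_det * ptrace m.+1 A1 =
    ptrace m.+1 ((A1 \o twisted_der) \o twist_inv) + twist_form (A1 ((1 - 'X) ^+ m)).
  rewrite (twist_form_expand (size1 _ szu)) mulr_sumr -big_split.
  apply: eq_bigr => i _ /=.
  rewrite twist_invK ?szXn // -scaleNr addrC lin1 (linear_opZ lin1).
  by rewrite coefD !coefZ; ring.
rewrite mulrBr tr1 (ptraceC (d := m.+1) (e := m)); first last.
- by move=> j lt_j; apply/size1/size_twisted_der/szXn.
- by move=> i _; apply: size_twist_inv.
- exact: linear_op_comp lin1 twisted_der_linear.
- exact: twist_inv_linear.
rewrite (_ : _ - _ = ptrace m (twist_inv \o (A1 \o twisted_der)) -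
                     twist_det * (lam * ptrace m A0)); last by ring.
have -> : twist_det * (lam * ptrace m A0) =
    ptrace m (twist_inv \o (fun Q => lam *: twisted_der (A0 Q))).
  rewrite mulrCA mulr_sumr mulr_sumr; apply: eq_bigr => i _ /=.
  rewrite (linear_opZ twist_inv_linear) twisted_derK ?size0 ?szXn //.
  by rewrite !coefZ.
rewrite -sumrB; apply: rdvd_sum => i _ /=.
rewrite -coefB -[X in _ - X]scale1r -scaleNr addrC.
rewrite -twist_inv_linear scaleN1r addrC.
by apply: linear_op_rdvd => [|j]; [apply: twist_inv_linear | apply: comm].
Qed.

End Lefschetz.

(** * The Cartier operator and the twisted derivation *)

Section Frobenius.
Variable R : comNzRingType.
Implicit Types (P Q f g h : {poly R}).
Variables q a : nat.
Hypothesis lt_aq : (a < q)%N.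

Let q_gt0 : (0 < q)%N. Proof. exact: leq_ltn_trans lt_aq. Qed.

(** The Cartier operator [X^i |-> X^(i/q)] conjugated by [X^alpha], where
    [alpha = a / (q - 1)]. *)
Definition cartier P : {poly R} := \poly_(n < size P) P`_(q * n + a).

Lemma coef_cartier P n : (cartier P)`_n = P`_(q * n + a).
Proof.
rewrite coef_poly; case: ltnP => // le_Pn; rewrite nth_default //.
by rewrite (leq_trans le_Pn) // (leq_trans (leq_pmull n q_gt0)) // leq_addr.
Qed.

Lemma cartier_linear : linear_op cartier.
Proof. by move=> b P Q; apply/polyP => n; rewrite !(coef_cartier, coefD, coefZ). Qed.

Lemma cartierM_linear h : linear_op (fun P => cartier (h * P)).
Proof. by move=> b P Q; rewrite mulrDr -scalerAr cartier_linear. Qed.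

Lemma size_cartier d P : (size P <= q * d + a)%N -> (size (cartier P) <= d)%N.
Proof.
move=> leP; apply/leq_sizeP => n le_dn; rewrite coef_cartier nth_default //.
by rewrite (leq_trans leP) // leq_add2r leq_mul2l le_dn orbT.
Qed.

Lemma cartierXqM P : cartier ('X^q * P) = 'X * cartier P.
Proof.
apply/polyP => n; rewrite coef_cartier coefXM coefXnM coef_cartier.
case: n => [|n]; first by rewrite muln0 add0n lt_aq.
by rewrite ltnNge mulnS -addnA leq_addr /= addKn.
Qed.

Lemma cartier_comp_Xn f g : cartier ((f \Po 'X^q) * g) = f * cartier g.
Proof.
elim/poly_ind: f g => [|f c IHf] g.
  by rewrite comp_poly0 !mul0r (linear_op0 cartier_linear).
rewrite comp_poly_MXaddC mulrDl -mulrA addrC mul_polyC cartier_linear IHf cartierXqM.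
by rewrite mulrDl mulrA mul_polyC addrC.
Qed.

Variables (half alpha : R).
Hypothesis half2 : half * 2%:R = 1.
Hypothesis alphaE : a%:R + alpha = q%:R * alpha.

Lemma coefX_deriv g k : ('X * g^`())`_k = k%:R * g`_k.
Proof.
by rewrite coefXM coef_deriv; case: k => [|k]; rewrite ?mul0r //= mulr_natl.
Qed.

(** The exponents [n + alpha] are stable under the Cartier operator, as
    [q n + a + alpha = q (n + alpha)]. *)
Lemma cartier_der g :
  cartier ('X * g^`() + alpha *: g)
  = q%:R *: ('X * (cartier g)^`() + alpha *: cartier g).
Proof.
apply/polyP => n; rewrite !(coef_cartier, coefZ, coefD, coefX_deriv).
by rewrite natrD natrM [RHS]mulrDr [in RHS]mulrA [X in _ = _ + X]mulrA -alphaE; ring.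
Qed.

Definition geom : {poly R} := \sum_(i < q) 'X^i.

Lemma geomE : (1 - 'X) * geom = 1 - 'X^q.
Proof. by rewrite -opprB mulNr -subrX1 opprB. Qed.

Lemma deriv_geom : (1 - 'X) * geom^`() = geom - q%:R *: 'X^(q.-1).
Proof.
have := congr1 (@deriv R) geomE.
rewrite derivM !derivB !derivC derivX derivXn !sub0r mulN1r -scaler_nat => E.
by apply: (addrI (- geom)); rewrite E addKr.
Qed.

Lemma coef0_geom : geom`_0 = 1.
Proof.
rewrite /geom -(big_mkord xpredT (fun i => 'X^i)) big_ltn // expr0 coefD coef1.
rewrite coef_sum big1_seq ?addr0 // => i; rewrite mem_index_iota => /and3P[_ i_gt0 _].
by rewrite coefXn lt_eqF.
Qed.

Section FrobeniusStructure.
Variables (c : R) (m : nat) (h1 h0 : {poly R}).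
Hypothesis h1_0 : h1`_0 = 1.
Hypothesis h0_0 : h0`_0 = 1.
Hypothesis h1E : forall M, pcong c M (h1 ^+ 2) (geom ^+ (m.+1).*2.+1).
Hypothesis h0E : forall M, pcong c M (h0 ^+ 2) (geom ^+ m.*2.+1).

Lemma pcong_h1 M : pcong c M h1 (geom * h0).
Proof.
apply: (pcong_sqrt_uniq half2) => //.
  by rewrite coefM big_ord1 /= subnn coef0_geom h0_0 mulr1.
apply: pcong_trans (@h1E M) _; rewrite exprMn.
rewrite (_ : (m.+1).*2.+1 = 2 + m.*2.+1)%N ?exprD; last by lia.
by apply: pcongM; [apply: pcong_refl | apply/pcong_sym/h0E].
Qed.

(** The logarithmic derivative of [h0 = geom^(m+1/2)], cleared of
    denominators. *)
Lemma pcong_h0_deriv M :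
  pcong c M (2%:R *: (geom * h0^`())) ((m.*2.+1)%:R *: (geom^`() * h0)).
Proof.
apply: (pcong_cancel h0_0).
have /pcong_deriv dh := @h0E M.+1.
rewrite deriv_exp expr1 deriv_exp /= in dh.
have -> : h0 * (2%:R *: (geom * h0^`())) = geom * (h0^`() * h0 *+ 2).
  by rewrite -mul_polyC polyC_natr; ring.
apply: (pcong_trans (pcongM (pcong_refl geom) dh)).
have -> : geom * (geom^`() * geom ^+ m.*2 *+ m.*2.+1) =
          (m.*2.+1)%:R *: geom^`() * geom ^+ m.*2.+1.
  by rewrite exprS -mul_polyC polyC_natr -mulr_natr; ring.
have -> : h0 * ((m.*2.+1)%:R *: (geom^`() * h0)) =
          (m.*2.+1)%:R *: geom^`() * h0 ^+ 2.
  by rewrite -!mul_polyC; ring.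
by apply: pcongM; [apply: pcong_refl | apply/pcong_sym/h0E].
Qed.

(** [h1] stands for [((1-X^q)/(1-X))^(m+3/2)], which carries the twist of
    [twisted_der] to its image under [X |-> X^q]; so multiplication by [h1]
    followed by [cartier] commutes with the derivations, up to the factor [q]
    coming from [X d/dX (X^q) = q X^q]. *)
Lemma cartier_twisted_der Q i :
  rdvd c (cartier (h1 * twisted_der m.+1 half alpha Q)
          - q%:R *: twisted_der m.+1 half alpha (cartier (h0 * Q)))`_i.
Proof.
pose g := h0 * Q; pose k : R := m.+1%:R - half.
pose rhs := (1 - 'X^q) * ('X * g^`() + alpha *: g) + (q%:R * k) *: ('X^q * g).
have -> : q%:R *: twisted_der m.+1 half alpha (cartier (h0 * Q)) = cartier rhs.
  rewrite /rhs mulrBl mul1r (linear_opD cartier_linear) (linear_opB cartier_linear).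
  rewrite (linear_opZ cartier_linear) !cartierXqM cartier_der /twisted_der -/k.
  by rewrite -!mul_polyC !polyCM; ring.
suff hrhs M : pcong c M (h1 * twisted_der m.+1 half alpha Q) rhs.
  by rewrite coefB !coef_cartier -coefB; apply: (hrhs (q * i + a).+1).
apply: (pcong_trans (pcongM (@pcong_h1 M) (pcong_refl _))).
have -> : geom * h0 * twisted_der m.+1 half alpha Q =
    rhs + 'X * Q * (1 - 'X) * half%:P *
      ((m.*2.+1)%:R *: (geom^`() * h0) - 2%:R *: (geom * h0^`())).
  have kE : k = half * (m.*2.+1)%:R.
    have -> : (m.*2.+1)%:R = m.+1%:R * 2%:R - 1 :> R.
      by rewrite -addn1 -muln2 natrD natrM -(natr1 m); ring.
    by rewrite mulrBr mulrCA half2 mulr1 mulr1.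
  have -> : rhs = (1 - 'X) * geom * ('X * g^`() + alpha *: g) +
                  k *: ('X * (geom - (1 - 'X) * geom^`()) * g).
    have XqE : 'X^q = 'X * 'X^(q.-1) :> {poly R} by rewrite -exprS prednK.
    rewrite geomE deriv_geom /rhs opprB addrCA subrr addr0; congr (_ + _).
    by rewrite XqE -!mul_polyC polyCM; ring.
  have half2P : half%:P * 2%:R%:P = 1 :> {poly R} by rewrite -polyCM half2.
  rewrite /twisted_der -/k kE /g derivM -!mul_polyC polyCM.
  set A := half%:P in half2P *; set B := 2%:R%:P in half2P *.
  rewrite -[LHS]addr0 -[X in _ + X](mul0r ('X * Q * (1 - 'X) * geom * h0^`())).
  by rewrite -(subrr (A * B)) {1}half2P; ring.
rewrite -[X in pcong _ _ _ X]addr0; apply: pcongD; first exact: pcong_refl.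
rewrite -[X in pcong _ _ _ X](mulr0 ('X * Q * (1 - 'X) * half%:P)).
apply: pcongM; first exact: pcong_refl.
by move=> j lt_j; rewrite subr0; apply: (pcong_sym (@pcong_h0_deriv M)).
Qed.

End FrobeniusStructure.
End Frobenius.

(** * The Frobenius polynomial *)

Section FrobeniusPolynomial.
Variable R : comNzRingType.
Variables (half : R) (p q e m N : nat) (G : {poly R}).
Hypothesis half2 : half * 2%:R = 1.
Hypothesis qE : q = e.*2.+1.
Hypothesis G_0 : G`_0 = 0.
Hypothesis sizeG : (size G <= q)%N.
Hypothesis GE : 1 - 'X^q = (1 - 'X) ^+ q + p%:R *: G.

Local Notation u := (1 - 'X : {poly R}).
Local Notation E := (e * m.*2.+1)%N.
Hypothesis N_gt0 : (0 < N)%N.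
Hypothesis leNE : (q * N <= E)%N.

Let u0 n : (u ^+ n)`_0 = 1.
Proof. by rewrite -horner_coef0 !hornerE subr0 expr1n. Qed.

Lemma size_1subXn n : (size (u ^+ n) <= n.+1)%N.
Proof. by rewrite (leq_trans (size_poly_exp_leq _ _)) // -opprB size_polyN size_XsubC mul1n. Qed.

Lemma pcong0_split M (f : {poly R}) : pcong 0 M f 0 -> exists t, f = 'X^M * t.
Proof.
move=> f0; exists (drop_poly M f).
rewrite -{1}(poly_take_drop M f) mulrC (_ : take_poly M f = 0) ?add0r //.
apply/polyP => i; rewrite coef_take_poly coef0; case: ifP => // /f0.
by rewrite subr0 => -[z ->]; rewrite mul0r.
Qed.

(** The polynomial is [((1-X^q)/(1-X))^(m+1/2)], written with [GE] as
    [(1-X)^E (1 + pG/(1-X)^q)^(m+1/2)], with the binomial series of the second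
    factor cut at [p^N]. By [leNE] the powers of [1 - X] in the denominators of
    the remaining terms cancel against [(1-X)^E]. *)
Lemma frobenius_poly_exists : exists h : {poly R},
  [/\ h`_0 = 1, (size h <= E.+1)%N, h.[1] = 0,
      forall M, pcong p%:R M h (u ^+ E) &
      forall M, pcong (p%:R ^+ N) M (h ^+ 2) (geom R q ^+ m.*2.+1)].
Proof.
have q_gt0 : (0 < q)%N by rewrite qE.
have [s [s0 sE]] : exists s : {poly R}, s`_0 = 1 /\ pcong 0 N (s ^+ 2) ((1 + 'X) ^+ m.*2.+1).
  by apply: (pcong_sqrt_exists half2); rewrite -horner_coef0 !hornerE ?addr0 ?expr1n.
pose T k := s`_k * p%:R ^+ k *: (G ^+ k * u ^+ (E - q * k)).
have subE k : (k < N)%N -> (0 < E - q * k)%N by nia.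
have T0 : T 0 = u ^+ E by rewrite /T s0 !expr0 mulr1 scale1r mul1r muln0 subn0.
exists (\sum_(0 <= k < N) T k); split.
- rewrite big_ltn // coefD T0 u0 coef_sum big1_seq ?addr0 // => k.
  rewrite mem_index_iota => /and3P[_ k_gt0 _].
  have Gk0 : (G ^+ k)`_0 = 0.
    by rewrite -horner_coef0 horner_exp horner_coef0 G_0 expr0n gtn_eqF.
  by rewrite coefZ coefM big_ord1 /= Gk0 mul0r mulr0.
- rewrite big_mkord; apply: leq_trans (size_sum _ _ _) _.
  apply/bigmax_leqP => k _; apply: leq_trans (size_scale_leq _ _) _.
  apply: leq_trans (size_polyMleq _ _) _.
  have := size_poly_exp_leq G k; have := size_1subXn (E - q * k).
  have : ((size G).-1 * k <= q.-1 * k)%N by rewrite leq_mul2r; apply/orP; right; lia.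
  have := subE k (ltn_ord k); have : (q.-1 * k + k = q * k)%N by nia.
  by lia.
- rewrite horner_sum big1_seq // => k; rewrite mem_index_iota => /andP[_ lt_kN].
  rewrite hornerZ hornerM (_ : (u ^+ _).[1] = 0) ?mulr0 //.
  by rewrite horner_exp !hornerE subrr expr0n gtn_eqF ?subE.
- move=> M; rewrite big_ltn // T0 -[X in pcong _ _ _ X]addr0.
  apply: pcongD; first exact: pcong_refl.
  move=> i _; rewrite subr0 coef_sum big_seq; apply: rdvd_sum => k.
  rewrite mem_index_iota => /andP[k_gt0 _].
  rewrite coefZ -(prednK k_gt0) exprS mulrCA -!mulrA.
  by exists (p%:R ^+ k.-1 * (s`_k * (G ^+ k * u ^+ (E - q * k))`_i)); rewrite prednK //; ring.
move=> M; set h := \sum_(_ <= _ < _) _.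
(* Multiplied by a power of [1 - 'X], the right-hand side becomes a power of
   [1 - 'X^q], which [GE] expresses through [G]. *)
apply: (pcong_cancel (u0 m.*2.+1)).
have [v1 v1E] := pcong_inv_exists R M; pose v := v1 ^+ q.
have vE : pcong 0 M (u ^+ q * v) 1.
  by have := pcongX q v1E; rewrite expr1n exprMn.
(* Then [h] is [u^E s(z)], and [s(z)^2] differs from [(1 + z)^(2m+1)] by a
   multiple of [z^N], hence of [p^N]. *)
pose z := p%:R *: (G * v); pose s' := \poly_(k < N) s`_k.
have hE : pcong 0 M h (u ^+ E * (s' \Po z)).
  rewrite /s' poly_def (big_morph (fun f => f \Po z) (fun f g => comp_polyD f g z) (comp_poly0 z)).
  rewrite mulr_sumr /h big_mkord; apply: pcong_sum => k _.
  rewrite comp_polyZ comp_Xn_poly /z exprZn exprMn.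
  have -> : u ^+ E * (s`_k *: (p%:R ^+ k *: (G ^+ k * v ^+ k))) =
     T k * (u ^+ q * v) ^+ k.
    rewrite /T exprMn -[in LHS](subnK (_ : q * k <= E)%N); last first.
      by rewrite ltnW // -subn_gt0; apply: subE.
    rewrite exprD exprM -!mul_polyC polyCM; move: (u ^+ (E - q * k)) (u ^+ q ^+ k) (G ^+ k) (v ^+ k) => U1 U2 G' V'.
    by ring.
  rewrite -[X in pcong _ _ X]mulr1; apply: pcongM; first exact: pcong_refl.
  by apply: pcong_sym; have := pcongX k vE; rewrite expr1n.
have [t tE] : exists t, s' ^+ 2 - (1 + 'X) ^+ m.*2.+1 = 'X^N * t.
  apply: pcong0_split; apply: (pcong_trans (g := s ^+ 2 - (1 + 'X) ^+ m.*2.+1)).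
    apply: pcongD; last exact: pcong_refl.
    apply: pcongX => i lt_i; rewrite coefB coef_poly lt_i subrr; exact: rdvdr0.
  by move=> i /sE; rewrite subr0.
have s'z : (s' \Po z) ^+ 2 = (1 + z) ^+ m.*2.+1 + (p%:R ^+ N)%:P * ((G * v) ^+ N * (t \Po z)).
  have zN : z ^+ N = (p%:R ^+ N)%:P * (G * v) ^+ N by rewrite /z exprZn mul_polyC.
  move/(congr1 (comp_poly z)): tE.
  rewrite rmorphB [X in _ = X -> _]rmorphM /= comp_Xn_poly zN => /(canRL (subrK _)).
  by rewrite !rmorphXn rmorphD rmorph1 /= comp_polyX => ->; rewrite -!mulrA addrC.
have sub0 f g : pcong 0 M f g -> pcong (p%:R ^+ N) M f g.
  by apply: pcong_sub (leqnn _); apply: rdvdr0.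
have E2 : (m.*2.+1 + (E + E) = q * m.*2.+1)%N by rewrite qE; nia.
have e1 : pcong (p%:R ^+ N) M (u ^+ m.*2.+1 * h ^+ 2)
    (u ^+ (q * m.*2.+1) * ((1 + z) ^+ m.*2.+1)).
  apply: (pcong_trans (g := u ^+ m.*2.+1 * (u ^+ E * (s' \Po z)) ^+ 2)).
    by apply: pcongM; [apply: pcong_refl | apply/sub0/pcongX].
  rewrite -E2 exprD exprD exprMn s'z.
  set W := u ^+ m.*2.+1; set V := u ^+ E; set Y := _ * (t \Po z).
  have -> : W * (V ^+ 2 * ((1 + z) ^+ m.*2.+1 + (p%:R ^+ N)%:P * Y)) =
    W * (V * V) * (1 + z) ^+ m.*2.+1 + (p%:R ^+ N)%:P * (W * V ^+ 2 * Y) by ring.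
  rewrite -[X in pcong _ _ _ X]addr0.
  by apply: pcongD; [apply: pcong_refl | apply: pcong_cstM].
apply: (pcong_trans e1).
rewrite -exprMn geomE // GE exprM -exprMn; apply/sub0/pcongX.
rewrite mulrDr mulr1; apply: pcongD; first exact: pcong_refl.
have -> : u ^+ q * z = (p%:R *: G) * (u ^+ q * v).
  by rewrite /z -!mul_polyC; move: (u ^+ q) => U; ring.
rewrite -[X in pcong _ _ _ X]mulr1.
by apply: pcongM => //; apply: pcong_refl.
Qed.

End FrobeniusPolynomial.

(** * Coefficients of the inverse square root of 1 - X *)

Section HalfBinomial.
Variable R : comNzRingType.
Variable half : R.
Hypothesis half2 : half * 2%:R = 1.
Hypothesis nat_reg : forall n (x : R), n.+1%:R * x = 0 -> x = 0.

Local Notation u := (1 - 'X : {poly R}).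

(** The coefficient of ['X^n] in [(1 - 'X)^(-1/2)]. *)
Definition half_bin n : R := 'C(n.*2, n)%:R * half ^+ n.*2.

Lemma half_bin0 : half_bin 0 = 1.
Proof. by rewrite /half_bin bin0 expr0 mulr1. Qed.

Lemma half_binS n : (n.+1).*2%:R * half_bin n.+1 = (n.*2.+1)%:R * half_bin n.
Proof.
have binE : ('C(n.+1.*2, n.+1) * n.+1 = n.*2.+1 * 'C(n.*2, n) * 2)%N.
  have /= e1 := mul_bin_diag n.*2.+2 n; have /= e2 := mul_bin_diag n.*2.+1 n.
  have e3 : 'C(n.*2.+1, n.+1) = 'C(n.*2.+1, n).
    by rewrite -bin_sub; [congr 'C(_, _); lia | lia].
  rewrite doubleS mulnC -e1 e2 e3; nia.
have h4 : half ^+ 2 * 4%:R = 1.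
  by rewrite (natrM _ 2 2) expr2 mulrACA half2 mulr1.
have hS : half ^+ n.+1.*2 = half ^+ n.*2 * half ^+ 2 by rewrite doubleS -addn2 exprD.
rewrite /half_bin hS.
transitivity (('C(n.+1.*2, n.+1) * n.+1)%:R * (half ^+ n.*2 * (half ^+ 2 * 2%:R)) : R).
  by rewrite -muln2 !natrM; ring.
by rewrite binE !natrM -[RHS]mulr1 -[X in _ = _ * X]h4 (natrM _ 2 2); ring.
Qed.

(** This is the derivative of the equation [g^2 (1-X)^(K+1) = 1], divided by
    [g (1-X)^K]. *)
Lemma inv_power_deriv M K (g : {poly R}) : g`_0 = 1 ->
  pcong 0 M.+1 (g ^+ 2 * u ^+ K.+1) 1 ->
  pcong 0 M (2%:R *: (u * g^`())) (K.+1%:R *: g).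
Proof.
move=> g0 /pcong_deriv; rewrite derivM !deriv_exp derivB !derivC derivX sub0r /= => dg.
have guK_0 : (g * u ^+ K)`_0 = 1.
  by rewrite -horner_coef0 !hornerE horner_coef0 g0 subr0 expr1n mulr1.
apply: (pcong_cancel guK_0).
have -> : g * u ^+ K * (2%:R *: (u * g^`())) = g * u ^+ K * (K.+1%:R *: g) +
   (g^`() * g ^+ 2.-1 *+ 2 * u ^+ K.+1 + g ^+ 2 * (-1 * u ^+ K *+ K.+1)).
  rewrite exprS -!mul_polyC !polyC_natr -[_ *+ K.+1]mulr_natr -[_ *+ 2]mulr_natr /=.
  by move: (u ^+ K) => W; ring.
rewrite -[X in pcong _ _ _ X]addr0; apply: pcongD; [exact: pcong_refl | exact: dg].
Qed.

(** For [K = 0] the differential equation of [inv_power_deriv] is the recursion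
    [half_binS] for the coefficients. *)
Lemma coef_inv_sqrt M (g : {poly R}) : g`_0 = 1 -> pcong 0 M (g ^+ 2 * u) 1 ->
  forall n, (n < M)%N -> g`_n = half_bin n.
Proof.
move=> g0; case: M => [|M] // gE; elim=> [|n IHn] lt_n; first by rewrite half_bin0.
have := @inv_power_deriv M 0 g g0; rewrite expr1 => /(_ gE n lt_n)[z].
rewrite mul0r coefB !coefZ mulrBl mul1r coefB coefX_deriv coef_deriv -mulr_natl => /eqP.
rewrite subr_eq0 mul1r => /eqP gn.
have {}gn : (n.+1).*2%:R * g`_n.+1 = (n.*2.+1)%:R * half_bin n.
  have -> : (n.*2.+1)%:R * half_bin n = g`_n + 2%:R * (n%:R * g`_n).
    by rewrite -(IHn (ltnW lt_n)) -natr1 -muln2 natrM; ring.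
  by rewrite -{1}gn -muln2 natrM; ring.
rewrite -half_binS in gn; apply/eqP; rewrite -subr_eq0; apply/eqP.
by apply: (@nat_reg n.*2.+1); rewrite -doubleS mulrBr gn subrr.
Qed.

Lemma inv_power_exists M K :
  exists g : {poly R}, g`_0 = 1 /\ pcong 0 M (g ^+ 2 * u ^+ K) 1.
Proof.
have [v vE] := pcong_inv_exists R M.+1.
have v0 : v`_0 = 1.
  have [z] := vE 0 isT.
  rewrite mul0r coefB coef1 coefM big_ord1 coefB coef1 coefX subr0 mul1r => /eqP.
  by rewrite subr_eq0 => /eqP.
have vK0 : (v ^+ K)`_0 = 1 by rewrite -horner_coef0 horner_exp horner_coef0 v0 expr1n.
have [s [s0 sE]] := pcong_sqrt_exists half2 M vK0.
exists s; split=> //.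
apply: (pcong_trans (g := v ^+ K * u ^+ K)).
  by apply: pcongM => //; apply: pcong_refl.
rewrite -exprMn mulrC; have := pcongX K vE; rewrite expr1n.
by apply: pcong_sub; [apply: rdvd_refl | apply: leqnSn].
Qed.

End HalfBinomial.

(** * The Frobenius eigenvalue *)

Section FrobeniusEigenvalue.
Variable R : comNzRingType.
Variables half iq alpha : R.
Variables (p q e a m N : nat) (G : {poly R}).
Hypothesis half2 : half * 2%:R = 1.
Hypothesis nat_reg : forall n (x : R), n.+1%:R * x = 0 -> x = 0.
Hypothesis iqE : q.-1%:R * iq = 1.
Hypothesis alphaE : q.-1%:R * alpha = a%:R.
Hypothesis qE : q = e.*2.+1.
Hypothesis lt_aq : (a < q)%N.
Hypothesis G_0 : G`_0 = 0.
Hypothesis sizeG : (size G <= q)%N.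
Hypothesis GE : 1 - 'X^q = (1 - 'X) ^+ q + p%:R *: G.
Hypothesis N_gt0 : (0 < N)%N.
Hypothesis leNE : (q * N <= e * m.*2.+1)%N.

Local Notation u := (1 - 'X : {poly R}).
Local Notation det := (twist_det m.+1 half).
Local Notation form := (twist_form m.+1 half).

(** The traces of both operators are sums of coefficients over a class of
    exponents modulo [q - 1]; [q - 1] times either of them is close to [J]. *)
Variable J : R.
Hypothesis JE : forall k (h : {poly R}),
  h`_0 = 1 -> (size h <= (e * k.*2.+1).+1)%N -> h.[1] = 0 ->
  (forall M, pcong p%:R M h (u ^+ (e * k.*2.+1))) ->
  (forall M, pcong (p%:R ^+ N) M (h ^+ 2) (geom R q ^+ k.*2.+1)) ->
  rdvd (p%:R ^+ N) (q.-1%:R * (\sum_(i < k.+1) h`_(q.-1 * i + a)) - J).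

Let q_gt0 : (0 < q)%N. Proof. by rewrite qE. Qed.

Lemma alpha_fixed : a%:R + alpha = q%:R * alpha.
Proof. by rewrite -alphaE -{2}(prednK q_gt0) -natr1 mulrDl mul1r. Qed.

(** The form depends polynomially on the exponent. *)
Lemma form_sub d (alpha' : R) P : rdvd d (alpha - alpha') ->
  rdvd d (form alpha P - form alpha' P).
Proof.
move=> dd; rewrite /twist_form /bidiag_form -sumrB; apply: rdvd_sum => l _.
rewrite -mulrBr -mulrBr; apply/rdvdMl/rdvdMl.
apply: rdvd_prod_sub => t _; rewrite /flip_offdiag.
by rewrite [_ - alpha]addrC addrKA opprK addrC -opprB; apply: rdvdN.
Qed.

Variable n : nat.

(** At the exponent [-n] the form is explicit. For [b = (1-X)^(-(m+3/2))],
    [b * twisted_der Q] is [X d/dX - n] applied to a power series, so its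
    coefficient of [X^n] vanishes; thus [P |-> (b P)_n] is a multiple of the form,
    and its value at [(1-X)^(m+1)] is the [n]-th coefficient of [(1-X)^(-1/2)]. *)
Lemma form_half_bin : exists b : {poly R}, [/\ b`_0 = 1,
    pcong 0 n.+2 (b ^+ 2 * u ^+ (m.+1).*2.+1) 1 &
    forall P : {poly R}, (size P <= m.+2)%N ->
      half_bin half n * form (- n%:R) P = det * (b * P)`_n].
Proof.
have [b [b0 bE]] := inv_power_exists half2 n.+2 (m.+1).*2.+1.
exists b; split=> // P leP.
have dE (Q : {poly R}) : (b * twisted_der m.+1 half (- n%:R) Q)`_n = 0.
  have := inv_power_deriv b0 bE; set dd := pcong _ _ => bd.
  have -> : b * twisted_der m.+1 half (- n%:R) Q =
     ('X * (u * b * Q)^`() + (- n%:R) *: (u * b * Q)) + half *: ('X * Q *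
      ((m.+1).*2.+1%:R *: b - 2%:R *: (u * b^`()))).
    have kE : half%:P * (m.+1).*2.+1%:R%:P = m.+1%:R%:P - half%:P + 1 :> {poly R}.
      rewrite -polyCM -natr1 -muln2 natrM mulrDr mulrCA half2 !mulr1 polyCD.
      have <- : half%:P + half%:P = 1 :> {poly R}.
        by rewrite -polyCD -{1 2}(mulr1 half) -mulrDr half2.
      by ring.
    have half2P : half%:P * 2%:R%:P = 1 :> {poly R} by rewrite -polyCM half2.
    rewrite /twisted_der !derivM derivB derivX derivC -!mul_polyC polyCB.
    set A := half%:P in half2P kE *; set B := 2%:R%:P in half2P *.
    set K := (m.+1).*2.+1%:R%:P in kE *.
    transitivity (('X * ((0 - 1) * b * Q + u * b^`() * Q + u * b * Q^`())
       + (- n%:R)%:P * (u * b * Q)) + ('X * Q * ((A * K) * b - (A * B) * (u * b^`()))));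
      last by ring.
    by rewrite kE half2P; ring.
  rewrite coefD coefD coefX_deriv coefZ mulNr subrr add0r coefZ.
  suff -> : ('X * Q * ((m.+1).*2.+1%:R *: b - 2%:R *: (u * b^`())))`_n = 0 by rewrite mulr0.
  have /(_ n (leqnn _))[z] : pcong 0 n.+1 ('X * Q * ((m.+1).*2.+1%:R *: b - 2%:R *: (u * b^`()))) 0.
    rewrite -(mulr0 ('X * Q)); apply: pcongM; first exact: pcong_refl.
    by move=> i /(pcong_sym bd); rewrite subr0.
  by rewrite subr0 mul0r.
rewrite -coefZ scalerAr.
rewrite (_ : det *: P = twisted_der m.+1 half (- n%:R) (twist_inv m.+1 half (- n%:R) P)
   + form (- n%:R) P *: u ^+ m.+1); last by rewrite twist_invK // subrK.
rewrite mulrDr coefD dE add0r -scalerAr coefZ mulrC; congr (_ * _).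
apply/esym/(coef_inv_sqrt half2 nat_reg (M := n.+2)) => //.
  by rewrite coefM big_ord1 b0 mul1r subnn -horner_coef0 !hornerE subr0 expr1n.
rewrite exprMn -exprM muln2 -mulrA -exprSr; exact: bE.
Qed.

(** The congruence [b(n) J = - b(q n + a)] for the coefficients [b] of
    [(1-X)^(-1/2)], with explicit error terms because [det] and [b(n)] are not
    units. By the Lefschetz formula, [det J] is minus the value of the form at
    the image of [(1-X)^(m+1)] under the Frobenius operator. Replacing [alpha] by [-n]
    in the form costs a multiple of [p^M]; then the value is the coefficient of
    [X^n] of a Cartier image, which is the coefficient of [X^(q n + a)] in
    [(1-X^q)^(-(m+3/2)) h1 (1-X)^(m+1) = (1-X)^(-1/2)]. *)
Theorem frobenius_half_bin M y : (M <= N)%N -> alpha + n%:R = p%:R ^+ M * y ->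
  exists z z', half_bin half n * (det * J) + det * half_bin half (q * n + a)
    = det * (p%:R ^+ N * z) + half_bin half n * (p%:R ^+ M * z').
Proof.
move=> leMN alphaN.
have leNE1 : (q * N <= e * (m.+1).*2.+1)%N by rewrite (leq_trans leNE) // leq_mul2l; lia.
have [h1 [h1_0 size1 h1_1 h1p h1E]] := frobenius_poly_exists half2 qE G_0 sizeG GE N_gt0 leNE1.
have [h0 [h0_0 size0 h0_1 h0p h0E]] := frobenius_poly_exists half2 qE G_0 sizeG GE N_gt0 leNE.
pose A1 (P : {poly R}) := cartier q a (h1 * P); pose A0 (P : {poly R}) := cartier q a (h0 * P).
have szh k (h P : {poly R}) : (size h <= (e * k.*2.+1).+1)%N -> (size P <= k.+1)%N ->
    (size (h * P)%R <= q * k.+1 + a)%N.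
  move=> leh leP; apply: leq_trans (size_polyMleq _ _) _.
  have : (q * k.+1 = e * k.*2.+1 + k.+1 + e)%N by rewrite qE; nia.
  by lia.
have szA1 (P : {poly R}) : (size P <= m.+2)%N -> (size (A1 P) <= m.+2)%N.
  by move=> leP; apply/(size_cartier lt_aq)/szh.
have szA0 (P : {poly R}) : (size P <= m.+1)%N -> (size (A0 P) <= m.+1)%N.
  by move=> leP; apply/(size_cartier lt_aq)/szh.
have trE k (h : {poly R}) : ptrace k.+1 (fun P => cartier q a (h * P)) =
    \sum_(i < k.+1) h`_(q.-1 * i + a).
  apply: eq_bigr => i _; rewrite coef_cartier // coefMXn.
  have -> : (q * i + a < i)%N = false by rewrite ltnNge (leq_trans (leq_pmull i q_gt0)) ?leq_addr.
  by congr (h`_ _); rewrite -{1}(prednK q_gt0); lia.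
have [z1 lef] : rdvd (p%:R ^+ N) (det * (ptrace m.+2 A1 - q%:R * ptrace m.+1 A0)
     - form alpha (A1 (u ^+ m.+1))).
  apply: lefschetz_trace => //; try exact: cartierM_linear.
  by move=> Q i; apply: (cartier_twisted_der lt_aq half2 alpha_fixed h1_0 h0_0 h1E h0E).
have [z2 J1] := JE h1_0 size1 h1_1 h1p h1E.
have [z3 J0] := JE h0_0 size0 h0_1 h0p h0E.
rewrite -!trE -/A1 -/A0 in J1 J0.
have qE' : q%:R = q.-1%:R + 1 :> R by rewrite natr1 prednK.
move: lef J1 J0; set P := A1 (u ^+ m.+1).
move: (ptrace _ A1) (ptrace _ A0) => t1 t0 lef J1 J0.
have [z4 eig] : rdvd (p%:R ^+ N) (det * J + form alpha P).
  exists (iq * (det * (z2 - q%:R * z3) - q.-1%:R * z1)).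
  have T1 : q.-1%:R * t1 = p%:R ^+ N * z2 + J by rewrite -J1 subrK.
  have T0 : q.-1%:R * t0 = p%:R ^+ N * z3 + J by rewrite -J0 subrK.
  have F : form alpha P = det * (t1 - q%:R * t0) - p%:R ^+ N * z1.
    by rewrite -lef; ring.
  rewrite -[LHS]mul1r -[X in X * _ = _]iqE F qE'.
  transitivity (iq * (q.-1%:R * det * J + det * (q.-1%:R * t1)
     - (q.-1%:R + 1) * det * (q.-1%:R * t0) - q.-1%:R * (p%:R ^+ N * z1))).
    by move: (q.-1%:R) (p%:R ^+ N) => Q' pN; ring.
  by rewrite T1 T0; ring.
have [b [b0 bE formP]] := form_half_bin.
have szP : (size P <= m.+2)%N by apply/szA1/size_1subXn.
have [z5 bP] : rdvd (p%:R ^+ N) ((b * P)`_n - half_bin half (q * n + a)).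
  have [g [g0 gE]] := inv_power_exists half2 (q * n + a).+1 1.
  rewrite expr1 in gE.
  rewrite -(coef_inv_sqrt half2 nat_reg g0 gE (leqnn _)).
  rewrite /P /A1 -(cartier_comp_Xn lt_aq) coef_cartier // -coefB.
  suff : pcong (p%:R ^+ N) (q * n + a).+1 ((b \Po 'X^q) * (h1 * u ^+ m.+1)) g by apply.
  have bq0 : (b \Po 'X^q)`_0 = 1 by rewrite coef_comp_Xn // dvdn0 div0n.
  apply: (pcong_sqrt_uniq half2) => //.
    rewrite coefM big_ord1 bq0 mul1r coefM big_ord1 /= h1_0 mul1r.
    by rewrite -horner_coef0 !hornerE subr0 expr1n.
  have sub0 (f k : {poly R}) : pcong 0 (q * n + a).+1 f k -> pcong (p%:R ^+ N) (q * n + a).+1 f k.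
    by apply: pcong_sub (leqnn _); apply: rdvdr0.
  have u0 : u`_0 = 1 by rewrite -horner_coef0 !hornerE subr0.
  apply: (pcong_cancel u0); rewrite [u * g ^+ 2]mulrC.
  have gE' := pcong_sym (sub0 _ _ gE); apply: (pcong_trans (g := 1)) => //.
  have -> : u * ((b \Po 'X^q) * (h1 * u ^+ m.+1)) ^+ 2 =
      (b \Po 'X^q) ^+ 2 * (h1 ^+ 2 * u ^+ (m.+1).*2.+1).
    rewrite [u ^+ (m.+1).*2.+1]exprS -muln2 exprM; move: (u ^+ m.+1) => U; ring.
  apply: (pcong_trans (g := (b \Po 'X^q) ^+ 2 *
      (geom R q ^+ (m.+1).*2.+1 * u ^+ (m.+1).*2.+1))).
    by apply: pcongM; [apply: pcong_refl | apply: pcongM; [apply: h1E | apply: pcong_refl]].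
  rewrite -exprMn [_ * u]mulrC geomE //; apply: sub0.
  have := pcong_comp_Xn q_gt0 bE; rewrite rmorphM !rmorphXn rmorphB !rmorph1 /= comp_polyX.
  by apply: pcong_sub; [apply: rdvd_refl | rewrite !mulnS; lia].
have [z6 formE] : rdvd (p%:R ^+ M) (form alpha P - form (- n%:R) P).
  by apply: form_sub; rewrite opprK alphaN; exists y.
exists (- z5), (p%:R ^+ (N - M) * z4 - z6).
have pN : p%:R ^+ N = p%:R ^+ M * p%:R ^+ (N - M) :> R by rewrite -exprD subnKC.
have dJ : det * J = p%:R ^+ N * z4 - form alpha P by rewrite -eig addrK.
have fa : form alpha P = p%:R ^+ M * z6 + form (- n%:R) P by rewrite -formE subrK.
have b' : half_bin half (q * n + a) = (b * P)`_n - p%:R ^+ N * z5 by rewrite -bP; ring.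
rewrite dJ fa b' opprD !mulrDr mulrN [_ * - form _ _]mulrN (formP P szP) pN; ring.
Qed.

End FrobeniusEigenvalue.

(** * The p-adic integers *)

Lemma Posz_exp (n k : nat) : (n ^ k)%N%:Z = n%:Z ^+ k.
Proof. by elim: k => [|k IHk] //; rewrite expnS exprS PoszM IHk. Qed.

Section PadicIntegers.
Variables (p : nat) (p_pr : prime p).
Local Notation Zp := (padic_int p_pr).
Implicit Types (x y : Zp).

Let p_gt0 : (0 < p)%N. Proof. exact: prime_gt0. Qed.

Lemma padic_mod_nat (n k : nat) : padic_mod (n%:R : Zp) k = (n%:Z %% p%:Z ^+ k)%Z.
Proof.
elim: n => [|n IHn] //.
by rewrite -natr1 /= IHn modzDm -addn1 PoszD.
Qed.

Lemma padic_modB x y k : padic_mod (x - y) k = ((padic_mod x k - padic_mod y k) %% p%:Z ^+ k)%Z.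
Proof. by rewrite /= modzDmr. Qed.

Lemma padic_modM x y k : padic_mod (x * y) k = ((padic_mod x k * padic_mod y k) %% p%:Z ^+ k)%Z.
Proof. by []. Qed.

Lemma padic_mod0 k : padic_mod (0 : Zp) k = 0.
Proof. by rewrite /= mod0z. Qed.

Let P_gt0 n : 0 < p%:Z ^+ n. Proof. by rewrite exprn_gt0 // ltz_nat. Qed.

Section Quotient.
Variables (x : Zp) (n : nat).
Hypothesis xn0 : padic_mod x n = 0.

Fact padic_quot_subproof k :
  ((padic_mod x (n + k.+1) %/ p%:Z ^+ n)%Z %% p%:Z ^+ k)%Z
    = (padic_mod x (n + k) %/ p%:Z ^+ n)%Z.
Proof.
have [c cE] : exists c, padic_mod x (n + k.+1) = c * p%:Z ^+ n.
  exists (padic_mod x (n + k.+1) %/ p%:Z ^+ n)%Z.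
  by rewrite {1}(divz_eq (padic_mod x (n + k.+1)) (p%:Z ^+ n)) padic_mod_leq ?leq_addr // xn0 addr0.
rewrite -(padic_modP x (n + k)) -addnS cE exprD [c * _]mulrC.
by rewrite -mulz_modr // !mulKz // gt_eqF.
Qed.

(** Division by [p^n] shifts the sequence of residues by [n] places. *)
Definition padic_quot : Zp := PadicInt p_pr padic_quot_subproof.

Lemma padic_quotE : x = p%:R ^+ n * padic_quot.
Proof.
apply: padic_ext => k; rewrite mulrC padic_modM -natrX padic_mod_nat modzMmr /=.
have /divzK : (p%:Z ^+ n %| padic_mod x (n + k))%Z.
  by apply/dvdz_mod0P; rewrite padic_mod_leq ?leq_addr.
by rewrite Posz_exp => ->; rewrite padic_mod_leq ?leq_addl.
Qed.

End Quotient.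

Lemma padic_rdvdP x n : rdvd (p%:R ^+ n) x <-> padic_mod x n = 0.
Proof.
split=> [[y ->]|xn0]; last by exists (padic_quot xn0); apply: padic_quotE.
by rewrite padic_modM -natrX padic_mod_nat Posz_exp modzz mul0r mod0z.
Qed.

Lemma padic_separated x : (forall n, rdvd (p%:R ^+ n) x) -> x = 0.
Proof.
by move=> dx; apply: padic_ext => n; have /padic_rdvdP -> := dx n; rewrite padic_mod0.
Qed.

Lemma padic_nat_dense x n : exists m : nat, rdvd (p%:R ^+ n) (x - m%:R).
Proof.
exists `|padic_mod x n|%N; apply/padic_rdvdP.
rewrite padic_modB padic_mod_nat gez0_abs; last by rewrite -padic_mod_id modz_ge0 // gt_eqF.
by rewrite padic_mod_id subrr mod0z.
Qed.

Lemma padic_series (c : nat -> Zp) :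
  exists s, forall n, rdvd (p%:R ^+ n) (s - \sum_(k < n) p%:R ^+ k * c k).
Proof.
pose S n := \sum_(k < n) p%:R ^+ k * c k.
have SP n : (padic_mod (S n.+1) n.+1 %% p%:Z ^+ n)%Z = padic_mod (S n) n.
  rewrite padic_modP /S big_ord_recr /=.
  have /padic_rdvdP : rdvd (p%:R ^+ n) (p%:R ^+ n * c n) by apply/rdvdMr/rdvd_refl.
  by move=> /= ->; rewrite addr0 padic_mod_id.
by exists (PadicInt p_pr SP) => n; apply/padic_rdvdP; rewrite padic_modB /= subrr mod0z.
Qed.

(** The inverse is the sum of the geometric series. *)
Lemma padic_unit_1subp x : exists y, (1 - p%:R * x) * y = 1.
Proof.
have [s sE] := padic_series (fun k => x ^+ k); exists s.
apply/eqP; rewrite -subr_eq0; apply/eqP/padic_separated => n.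
have -> : (1 - p%:R * x) * s - 1 =
   (1 - p%:R * x) * (s - \sum_(k < n) p%:R ^+ k * x ^+ k) - p%:R ^+ n * x ^+ n.
  have geo : (1 - p%:R * x) * (\sum_(k < n) p%:R ^+ k * x ^+ k) = 1 - p%:R ^+ n * x ^+ n.
    under eq_bigr do rewrite -exprMn.
    by rewrite -opprB mulNr -subrX1 exprMn opprB.
  by rewrite mulrBr geo; ring.
by apply: rdvdB; [apply/rdvdMl/sE | apply/rdvdMr/rdvd_refl].
Qed.

(** An integer close to [x] is prime to [p]; its inverse modulo [p] is
    corrected by [padic_unit_1subp]. *)
Lemma padic_inv_exists x : ~ rdvd p%:R x -> exists y, x * y = 1.
Proof.
move=> ndx; have [m xm] := padic_nat_dense x 1; rewrite expr1 in xm.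
have co_pm : coprime p m.
  rewrite prime_coprime //; apply/negP => /dvdnP[k mE]; apply: ndx.
  rewrite -(subrK m%:R x); apply: rdvdD => //.
  by rewrite mE natrM mulrC; apply/rdvdMr/rdvd_refl.
have m_gt0 : (0 < m)%N by move: co_pm; rewrite lt0n; apply: contraTneq => ->; rewrite /coprime gcdn0 gtn_eqF // prime_gt1.
case: (egcdnP p m_gt0) => km kn kmE _.
have /eqP g1 : gcdn m p == 1%N by rewrite gcdnC.
rewrite g1 in kmE; have [z zE] := xm.
have [y yE] := padic_unit_1subp (- (km%:R * z + kn%:R)).
exists (km%:R * y); rewrite -[RHS]yE.
have -> : x = m%:R + p%:R * z by rewrite -zE addrC subrK.
suff -> : 1 - p%:R * - (km%:R * z + kn%:R) = km%:R * (m%:R + p%:R * z) by ring.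
have kmE' : km%:R * m%:R = kn%:R * p%:R + 1 :> Zp by rewrite -natrM kmE natrD natrM.
by rewrite mulrDr kmE'; ring.
Qed.

Lemma padic_nat_inv_exists m : ~~ (p %| m)%N -> exists y : Zp, m%:R * y = 1.
Proof.
move=> ndm; apply: padic_inv_exists; rewrite -[p%:R]expr1 => /padic_rdvdP.
rewrite padic_mod_nat expr1 => /eqP; rewrite modz_nat.
by rewrite eqz_nat -/(dvdn p m) (negPf ndm).
Qed.

Lemma padic_nat_neq0 n : (n.+1%:R : Zp) != 0.
Proof.
apply/eqP => /(congr1 (fun x => padic_mod x n.+1)).
rewrite padic_mod0 padic_mod_nat modz_small //=.
by rewrite -Posz_exp ltz_nat ltn_expl // prime_gt1.
Qed.

Lemma padic_unit_part x : x != 0 -> exists n y w, x = p%:R ^+ n * y /\ y * w = 1.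
Proof.
move=> x_neq0; have [n xn] : exists n, ~~ `[< rdvd (p%:R ^+ n) x >].
  apply: contrapT => dx; case/eqP: x_neq0; apply: padic_separated => n.
  by apply/asboolP; apply: contrapT => /negP ndx; apply: dx; exists n.
have [[|k] /asboolP ndk minn] := ex_minnP (ex_intro (fun k => ~~ `[< rdvd (p%:R ^+ k) x >]) n xn).
  by case: ndk; rewrite expr0; exists x; rewrite mul1r.
have /asboolP[y yE] : `[< rdvd (p%:R ^+ k) x >].
  by apply/negPn/negP => /minn; rewrite ltnn.
have [|w wE] := @padic_inv_exists y; last by exists k, y, w.
by move=> [t yt]; case: ndk; exists t; rewrite yE yt exprSr mulrA.
Qed.

End PadicIntegers.

(** * The integers of a finite extension of the p-adic field *)

Section PadicEmbedding.
Variables (p : nat) (p_pr : prime p) (K : fieldExtType (padic_num p_pr)).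
Local Notation Zp := (padic_int p_pr).
Local Notation Zq := (integer_ring K).

HB.instance Definition _ := GRing.RMorphism.copy (padic_in K) (in_alg K \o @tofrac Zp).

Lemma padic_in_inj : injective (padic_in K).
Proof.
move=> x y /fmorph_inj; rewrite /= => xy; apply/eqP; rewrite -subr_eq0 -tofrac_eq0.
by rewrite rmorphB /= xy subrr.
Qed.

Fact padic_inq_subproof (x : Zp) : padic_in K x \in integer_pred (K := K).
Proof. by apply/asboolP; apply: integral_id. Qed.

Definition padic_inq (x : Zp) : Zq := IntegerRing (padic_inq_subproof x).

Fact padic_inq_zmod : zmod_morphism padic_inq.
Proof. by move=> x y; apply: val_inj; rewrite /= !rmorphB. Qed.
Fact padic_inq_monoid : monoid_morphism padic_inq.
Proof. by split=> [|x y]; apply: val_inj; rewrite /= ?rmorph1 ?rmorphM. Qed.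
HB.instance Definition _ := GRing.isZmodMorphism.Build Zp Zq padic_inq padic_inq_zmod.
HB.instance Definition _ := GRing.isMonoidMorphism.Build Zp Zq padic_inq padic_inq_monoid.

Lemma integer_val_padic x : \val (padic_inq x) = padic_in K x.
Proof. by []. Qed.

Lemma integer_valM (x y : Zq) : integer_val (x * y) = integer_val x * integer_val y.
Proof. by rewrite -[LHS]/(val (x * y)) rmorphM. Qed.

Lemma padic_natK_neq0 n : n.+1%:R != 0 :> K.
Proof.
rewrite -(rmorph_nat (padic_in K)) -(rmorph0 (padic_in K)).
by rewrite (inj_eq padic_in_inj) padic_nat_neq0.
Qed.

Lemma integer_mulI (x y z : Zq) : x != 0 -> x * y = x * z -> y = z.
Proof.
move=> x0 /(congr1 val); rewrite !rmorphM /= => xyz; apply: val_inj.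
apply: (mulfI _ xyz); apply: contraNneq x0 => x0.
by apply/eqP/val_inj; rewrite [LHS]x0 rmorph0.
Qed.

Lemma integer_natr_reg n (x : Zq) : n.+1%:R * x = 0 -> x = 0.
Proof.
move=> nx; apply: (@integer_mulI n.+1%:R); last by rewrite nx mulr0.
apply: contraNneq (padic_natK_neq0 n) => n0.
by move/(congr1 val): n0; rewrite rmorph_nat rmorph0 => /eqP.
Qed.

End PadicEmbedding.

(** * Separation and completeness of the unramified integers *)

Section ResidueField.
Variables (p : nat) (p_pr : prime p) (K : fieldExtType (padic_num p_pr)).
Variable F : finFieldType.
Local Notation Zp := (padic_int p_pr).
Local Notation Zq := (integer_ring K).
Variable res : {rmorphism Zq -> F}.
Hypothesis hres : unramified_residue_map res.
Implicit Types (x y z : Zq).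

Let inq := padic_inq K.

Lemma res_eq0 x : res x = 0 <-> rdvd p%:R x.
Proof. by case: hres => _ /(_ x). Qed.

Lemma integer_p_neq0 : p%:R != 0 :> Zq.
Proof.
apply/eqP => p0; have := @integer_natr_reg p p_pr K p.-1 1.
rewrite prednK ?prime_gt0 // p0 mul0r => /(_ erefl)/eqP.
by rewrite oner_eq0.
Qed.

Lemma integer_pexp_neq0 n : p%:R ^+ n != 0 :> Zq.
Proof.
elim: n => [|n IHn]; first by rewrite expr0 oner_eq0.
apply/eqP => pn; case/eqP: IHn; apply: (integer_mulI integer_p_neq0).
by rewrite -exprS pn mulr0.
Qed.

(** [p] is a prime element: the quotient by it embeds into the field [F]. *)
Lemma rdvd_cancel n x y : rdvd (p%:R ^+ n) (x * y) -> res x != 0 -> rdvd (p%:R ^+ n) y.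
Proof.
move=> + rx; elim: n => [|n IHn]; first by exists y; rewrite expr0 mul1r.
rewrite exprSr => dxy; have [t yt] := IHn (rdvd_trans (rdvdMr _ (rdvd_refl _)) dxy).
have [z xyz] := dxy; have : x * t = p%:R * z.
  by apply: (integer_mulI (integer_pexp_neq0 n)); rewrite mulrCA -yt xyz -mulrA.
move=> xt; have /res_eq0 : rdvd p%:R (x * t) by exists z.
rewrite rmorphM => /eqP; rewrite mulf_eq0 (negPf rx) => /eqP/res_eq0[w tw].
by exists w; rewrite yt tw mulrA.
Qed.

(** If [x] is nonzero, an integral equation of [x] can be divided by a power of
    the variable so as to have a nonzero constant term; this is a multiple of [x],
    and it is [p^n] times a unit. If [x] were divisible by [p^(n+1)], then [p]
    would be invertible, against [res p = 0]. *)
Lemma integer_separated x : (forall n, rdvd (p%:R ^+ n) x) -> x = 0.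
Proof.
move=> dx; apply: contrapT => x0.
have vx0 : val x != 0 by apply/eqP => vx; apply: x0; apply: val_inj; rewrite vx rmorph0.
have /asboolP[f f_mon f_root] := integer_valP x.
have [k [g g0 fE]] : exists k, exists2 g : {poly Zp}, g`_0 != 0 & f = g * 'X^k.
  have f_neq0 : f != 0 := monic_neq0 f_mon.
  have [k fk mink] : exists2 k, f`_k != 0 & forall j, f`_j != 0 -> (k <= j)%N.
    have ex : exists k, f`_k != 0 by exists (size f).-1; rewrite -lead_coefE lead_coef_eq0.
    by case: (ex_minnP ex) => k fk mink; exists k.
  exists k; exists (drop_poly k f); first by rewrite coef_drop_poly.
  rewrite -{1}(poly_take_drop k f) (_ : take_poly k f = 0) ?add0r //.
  apply/polyP => i; rewrite coef_take_poly coef0; case: ifP => // lt_ik.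
  by apply/eqP; apply: contraLR lt_ik => /mink; rewrite -leqNgt.
have gx : (map_poly inq g).[x] = 0.
  apply: val_inj; rewrite rmorph0 -horner_map -map_poly_comp /=.
  move: f_root; rewrite fE rmorphM /= map_polyXn rootM /root !hornerE.
  rewrite expf_eq0 (negPf vx0) andbF orbF => /eqP <-.
  by congr (_.[_]); apply: eq_map_poly.
have [y xy] : exists y, inq g`_0 = x * y.
  exists (- (drop_poly 1 (map_poly inq g)).[x]).
  have := gx; rewrite -{1}(poly_take_drop 1 (map_poly inq g)) hornerD hornerM hornerX.
  rewrite (_ : take_poly 1 (map_poly inq g) = (inq g`_0)%:P) ?hornerC.
    by move/eqP; rewrite addr_eq0 => /eqP ->; rewrite mulrN mulrC.
  apply/polyP => i; rewrite coef_take_poly coefC coef_map /=; case: i => [|i] //.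
have [n [v [w [gE vw]]]] := padic_unit_part g0.
have [t xt] := dx n.+1.
have : p%:R * (t * y * inq w) = 1.
  apply: (integer_mulI (integer_pexp_neq0 n)).
  have e1 : p%:R ^+ n * inq v = p%:R ^+ n.+1 * t * y.
    by rewrite -xt -xy gE /inq rmorphM rmorphXn rmorph_nat.
  transitivity (p%:R ^+ n.+1 * t * y * inq w); first by rewrite exprSr; ring.
  by rewrite -e1 -mulrA -rmorphM vw rmorph1.
move=> p1; have /res_eq0 : rdvd p%:R (1 : Zq) by exists (t * y * inq w).
by move/eqP; rewrite rmorph1 oner_eq0.
Qed.

Lemma residue_lift : exists L : F -> Zq, cancel L res.
Proof. by have [/choice[L LE] _] := hres; exists L. Qed.

(** Every element is a p-adically convergent sum of lifts of residues, so the
    ring is spanned over the p-adic integers by finitely many lifts. *)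
Lemma residue_span (L : F -> Zq) : cancel L res ->
  forall x, exists c : F -> Zp, x = \sum_a inq (c a) * L a.
Proof.
move=> LK x.
have /choice[D DE] y : exists z, y - L (res y) = p%:R * z.
  by apply/res_eq0; rewrite rmorphB LK subrr.
pose X k := iter k D x.
have XE n : x = \sum_(k < n) p%:R ^+ k * L (res (X k)) + p%:R ^+ n * X n.
  elim: n => [|n IHn]; first by rewrite big_ord0 add0r expr0 mul1r.
  rewrite {1}IHn big_ord_recr /= -addrA; congr (_ + _).
  by rewrite exprSr -mulrA -DE -mulrDr addrC subrK.
have /choice[c cE] a := padic_series (fun k => ((res (X k) == a)%:R : Zp)).
exists c; apply/eqP; rewrite -subr_eq0; apply/eqP/integer_separated => n.
rewrite {1}(XE n) addrAC; apply: rdvdD; last exact/rdvdMr/rdvd_refl.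
have -> : \sum_(k < n) p%:R ^+ k * L (res (X k)) =
    \sum_a (inq (\sum_(k < n) p%:R ^+ k * (res (X k) == a)%:R) * L a).
  under [RHS]eq_bigr => a _ do rewrite /inq rmorph_sum mulr_suml.
  rewrite exchange_big; apply: eq_bigr => k _ /=.
  rewrite (bigD1 (res (X k))) //= eqxx big1 => [|a /negPf ne].
    by rewrite addr0 rmorphM rmorphXn !rmorph_nat mulr1.
  by rewrite eq_sym ne mulr0 rmorph0 mul0r.
rewrite -sumrB; apply: rdvd_sum => a _; rewrite -mulrBl -rmorphB.
apply: rdvdMr; have [z zE] := cE a n; exists (inq (- z)).
by rewrite -opprB zE -mulrN /inq rmorphM rmorphXn rmorph_nat.
Qed.

(** By [residue_span], completeness is inherited from the coordinates. *)
Lemma integer_series (y : nat -> Zq) :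
  exists z, forall n, rdvd (p%:R ^+ n) (z - \sum_(k < n) p%:R ^+ k * y k).
Proof.
have [L LK] := residue_lift.
have /choice[c cE] k := residue_span LK (y k).
have /choice[s sE] a := padic_series (fun k => c k a).
exists (\sum_a inq (s a) * L a) => n.
have -> : \sum_(k < n) p%:R ^+ k * y k =
    \sum_a inq (\sum_(k < n) p%:R ^+ k * c k a) * L a.
  under [RHS]eq_bigr => a _ do rewrite /inq rmorph_sum mulr_suml.
  rewrite exchange_big; apply: eq_bigr => k _ /=.
  rewrite {1}cE mulr_sumr; apply: eq_bigr => a _.
  by rewrite rmorphM rmorphXn rmorph_nat mulrA.
rewrite -sumrB; apply: rdvd_sum => a _; rewrite -mulrBl -rmorphB.
apply: rdvdMr; have [z zE] := sE a n; exists (inq z).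
by rewrite zE /inq rmorphM rmorphXn rmorph_nat.
Qed.

End ResidueField.

(** * Teichmuller representatives *)

Section FiniteField.
Variable F : finFieldType.

Lemma card_finField_gt1 : (1 < #|F|)%N.
Proof. exact: finNzRing_gt1. Qed.

Let F1_gt0 : (0 < #|F|.-1)%N. Proof. by have := card_finField_gt1; lia. Qed.

Lemma finField_expf1 (b : F) : b != 0 -> b ^+ #|F|.-1 = 1.
Proof.
move=> b0; apply: (mulfI b0); rewrite mulr1 -exprS prednK ?expf_card //.
exact: ltnW card_finField_gt1.
Qed.

Lemma finField_prim_root : exists w : F, #|F|.-1.-primitive_root w.
Proof.
have /hasP[w _ ww] : has #|F|.-1.-primitive_root (enum (predC1 (0 : F))).
  apply: has_prim_root => //; rewrite ?enum_uniq // -?cardE ?cardC1 //.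
  apply/allP => b; rewrite mem_enum inE => b0.
  by apply/unity_rootP/finField_expf1.
by exists w.
Qed.

Variable e : nat.
Hypothesis cardF : #|F| = e.*2.+1.

Lemma euler_criterion (b : F) : b != 0 ->
  b ^+ e = if [exists c, b == c ^+ 2] then 1 else -1.
Proof.
move=> b0; have be2 : (b ^+ e) ^+ 2 = 1.
  by rewrite -exprM muln2; have := finField_expf1 b0; rewrite cardF.
case: ifPn => [/existsP[c /eqP bE]|nsq].
  rewrite bE -exprM mul2n; have := @finField_expf1 c; rewrite cardF; apply.
  by apply: contraNneq b0 => c0; rewrite bE c0 expr0n.
move/eqP: be2; rewrite sqrf_eq1 => /orP[/eqP be1|/eqP //].
have [w ww] := finField_prim_root.
have b1 : b ^+ #|F|.-1 = 1 := finField_expf1 b0.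
have [i bE] : exists i : nat, b = w ^+ i by have [i ->] := prim_rootP ww b1; exists i.
case/existsP: nsq; exists (w ^+ i./2); rewrite -exprM muln2 bE.
have : (#|F|.-1 %| i * e)%N by rewrite (prim_order_dvd ww) exprM -bE be1.
rewrite cardF /= => dv; suff ev : ~~ odd i by rewrite -{1}(odd_double_half i) (negPf ev).
have e_gt0 : (0 < e)%N by move: F1_gt0; rewrite cardF /=; case: (e).
by move: dv; rewrite -mul2n dvdn_pmul2r // dvdn2.
Qed.

End FiniteField.

Section Teichmuller.
Variables (p : nat) (p_pr : prime p) (K : fieldExtType (padic_num p_pr)).
Variable F : finFieldType.
Local Notation Zq := (integer_ring K).
Variable res : {rmorphism Zq -> F}.
Hypothesis hres : unramified_residue_map res.
Variable r : nat.
Hypothesis r_gt0 : (0 < r)%N.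
Hypothesis cardF : #|F| = (p ^ r)%N.
Implicit Types (x y z : Zq).

Lemma res_p : p%:R = 0 :> F.
Proof. by rewrite -(rmorph_nat res); apply/(res_eq0 hres)/rdvd_refl. Qed.

(** Raising to the power [p] gains one power of [p]: the cofactor of [x - y]
    in [x^p - y^p] is congruent to [p x^(p-1)]. *)
Lemma rdvd_subX_card k x y : res x = res y ->
  rdvd (p%:R ^+ k) (x - y) -> rdvd (p%:R ^+ k.+1) (x ^+ #|F| - y ^+ #|F|).
Proof.
move=> rxy [d dE]; rewrite cardF -(prednK r_gt0) expnS !exprM.
apply: rdvd_subX; rewrite subrXX dE exprSr -mulrA; set S := \sum_(_ < _) _.
suff [z ->] : rdvd p%:R S by exists (d * z); move: (p%:R ^+ k) => pk; ring.
apply/(res_eq0 hres); rewrite /S rmorph_sum.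
under eq_bigr => i _.
  rewrite rmorphM !rmorphXn rxy -exprD subnK; last by rewrite -ltnS prednK ?prime_gt0.
  over.
by rewrite sumr_const card_ord -mulr_natl res_p mul0r.
Qed.

(** The representative is the limit of the powers [x^(q^k)] of a lift [x]. *)
Lemma teichmuller_exists (t : F) : t != 0 ->
  exists z, z ^+ #|F|.-1 = 1 /\ res z = t.
Proof.
move=> t0; have [L LK] := residue_lift hres; pose x := L t.
pose X k := x ^+ (#|F| ^ k).
have XS k : X k.+1 = X k ^+ #|F| by rewrite /X expnSr exprM.
have resX k : res (X k) = t.
  elim: k => [|k IHk]; first by rewrite /X expn0 expr1 LK.
  by rewrite /X expnSr exprM rmorphXn -/(X k) IHk expf_card.
have dX k : rdvd (p%:R ^+ k.+1) (X k.+1 - X k).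
  elim: k => [|k IHk]; first by apply/(res_eq0 hres); rewrite rmorphB !resX subrr.
  by have := rdvd_subX_card (etrans (resX k.+1) (esym (resX k))) IHk; rewrite -!XS.
have /choice[w wE] := dX.
have [z zE] := integer_series hres (fun k => p%:R * w k).
have zX n : rdvd (p%:R ^+ n) (z + x - X n).
  suff -> : z + x - X n = z - \sum_(k < n) p%:R ^+ k * (p%:R * w k) by [].
  rewrite -(big_mkord xpredT (fun k => p%:R ^+ k * (p%:R * w k))).
  under eq_bigr => k _ do rewrite mulrA -exprSr -wE.
  by rewrite telescope_sumr // /X expn0 expr1 opprB addrA addrAC.
have rz : res (z + x) = t.
  apply/eqP; rewrite -subr_eq0 -(resX 1) -rmorphB; apply/eqP/(res_eq0 hres).
  by rewrite -[p%:R]expr1; apply: zX.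
exists (z + x); split=> //.
have zq : (z + x) ^+ #|F| = z + x.
  apply/eqP; rewrite -subr_eq0; apply/eqP/(integer_separated hres) => n.
  have -> : (z + x) ^+ #|F| - (z + x) =
     ((z + x) ^+ #|F| - X n.+1) - (z + x - X n.+1) by ring.
  apply: rdvdB; last by apply: rdvd_trans (zX n.+1); apply: rdvd_exp.
  by rewrite /X expnSr exprM; apply: rdvd_subX; apply: zX.
apply: (@integer_mulI _ _ K (z + x)).
  by apply: contraNneq t0 => zx0; rewrite -rz zx0 rmorph0.
by rewrite -exprS prednK ?zq ?mulr1 // (ltn_trans _ (card_finField_gt1 F)).
Qed.

(** [x - y = x^q - y^q] gains a factor [p] at each use of this equality. *)
Lemma teichmuller_unique x y :
  x ^+ #|F|.-1 = 1 -> y ^+ #|F|.-1 = 1 -> res x = res y -> x = y.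
Proof.
have powq z : z ^+ #|F|.-1 = 1 -> z ^+ #|F| = z.
  move=> z1; rewrite -[in LHS](prednK (ltnW (card_finField_gt1 F))) exprS z1 mulr1 //.
move=> x1 y1 rxy; apply/eqP; rewrite -subr_eq0; apply/eqP/(integer_separated hres).
elim=> [|n IHn]; first by exists (x - y); rewrite expr0 mul1r.
by rewrite -(powq x x1) -(powq y y1); apply: rdvd_subX_card.
Qed.

Local Notation teich := (teichmuller res).

Lemma teichmullerP (t : F) : t != 0 -> teich t ^+ #|F|.-1 = 1 /\ res (teich t) = t.
Proof.
move=> /teichmuller_exists[z zP]; rewrite /teichmuller.
by case: xgetP => [y -> //|/(_ z)].
Qed.

Lemma teichmuller1 : teich 1 = 1.
Proof.
have [t1 rt] := teichmullerP (oner_neq0 F).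
by apply: teichmuller_unique; rewrite ?expr1n ?rmorph1.
Qed.

Lemma teichmullerM (s t : F) : s != 0 -> t != 0 -> teich (s * t) = teich s * teich t.
Proof.
move=> s0 t0; have [s1 rs] := teichmullerP s0; have [t1 rt] := teichmullerP t0.
have [st1 rst] := teichmullerP (mulf_neq0 s0 t0).
by apply: teichmuller_unique; rewrite ?exprMn ?s1 ?t1 ?mulr1 // rmorphM rs rt.
Qed.

Lemma sum_teichmuller j :
  \sum_(t : F | t != 0) teich t ^+ j = if (#|F|.-1 %| j)%N then #|F|.-1%:R else 0.
Proof.
case: ifPn => [/dvdnP[k ->]|ndj].
  rewrite (eq_bigr (fun=> 1)) => [|t t0]; last first.
    by rewrite mulnC exprM; have [-> _] := teichmullerP t0; rewrite expr1n.
  by rewrite sumr_const cardC1.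
have [w ww] := finField_prim_root F.
have w0 : w != 0
  by apply: contra_eq_neq (prim_expr_order ww) => ->; rewrite expr0n gtn_eqF ?(prim_order_gt0 ww) // eq_sym oner_eq0.
set S := \sum_(_ | _) _; have wS : teich w ^+ j * S = S.
  rewrite {2}/S (reindex_inj (mulfI w0)) mulr_sumr /=.
  apply: eq_big => [t|t t0]; first by rewrite mulf_eq0 (negPf w0).
  by rewrite -exprMn teichmullerM.
apply: (@integer_mulI _ _ K (teich w ^+ j - 1)); last by rewrite mulr0 mulrBl wS mul1r subrr.
apply: contraNneq ndj => wj; rewrite (prim_order_dvd ww).
move/(congr1 res): wj; rewrite rmorphB rmorphXn rmorph1 rmorph0.
by have [_ ->] := teichmullerP w0; move/eqP; rewrite subr_eq0.
Qed.

End Teichmuller.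

(** * Jacobi sums of the quadratic character as traces *)

Section JacobiSum.
Variables (p : nat) (p_pr : prime p) (K : fieldExtType (padic_num p_pr)).
Variable F : finFieldType.
Local Notation Zq := (integer_ring K).
Variable res : {rmorphism Zq -> F}.
Hypothesis hres : unramified_residue_map res.
Variables r e : nat.
Hypothesis r_gt0 : (0 < r)%N.
Hypothesis cardF : #|F| = (p ^ r)%N.
Hypothesis cardFe : #|F| = e.*2.+1.
Implicit Types (x y z : Zq).

Local Notation teich := (teichmuller res).
Local Notation q := #|F|.

(** [quad_char] with values in the integer ring, where congruences make
    sense. *)
Definition quad_charq (b : F) : Zq :=
  if b == 0 then 0 else if [exists c, b == c ^+ 2] then 1 else -1.

Lemma val_quad_charq b : \val (quad_charq b) = quad_char K b.
Proof.
by rewrite /quad_charq /quad_char; case: ifP => // _; case: ifP => // _; rewrite ?rmorph1 ?rmorphN1.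
Qed.

(** The negative power of the character is written with the exponent
    [q - 1 - a]; the term [t = 0], at which it vanishes, is left out. *)
Definition jacobi_sum a : Zq :=
  \sum_(t : F | t != 0) quad_charq (1 - t) * teich t ^+ (q.-1 - a).

Let e_gt0 : (0 < e)%N.
Proof. by have := card_finField_gt1 F; rewrite cardFe; lia. Qed.

Lemma two_neq0 : 2%:R != 0 :> F.
Proof.
apply/eqP => two0; have /eqP := expf_card (1 + 1 : F).
have : (q%:R = 1 :> F) by rewrite cardFe -addn1 natrD -mul2n natrM two0 mul0r add0r.
rewrite cardF -(prednK r_gt0) expnS natrM (res_p hres) mul0r => /eqP.
by rewrite eq_sym oner_eq0.
Qed.

(** [y] and the character value are both square roots of 1 modulo [p^N], and
    equal modulo [p] by Euler's criterion; so their sum is a unit, as [p] is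
    odd. *)
Lemma quad_charq_cong N b y : (0 < N)%N -> b != 0 ->
  rdvd (p%:R ^+ N) (y ^+ 2 - 1) -> res y = b ^+ e -> rdvd (p%:R ^+ N) (y - quad_charq b).
Proof.
move=> N_gt0 b0 y2 ry; pose s : Zq := quad_charq b.
have s2 : s ^+ 2 = 1.
  by rewrite /s /quad_charq (negPf b0); case: ifP => _; rewrite ?sqrrN expr1n.
have rs : res s = b ^+ e.
  rewrite (euler_criterion cardFe b0) /s /quad_charq (negPf b0).
  by case: ifP => _; rewrite ?rmorphN1 ?rmorph1.
apply: (@rdvd_cancel _ _ _ _ _ hres _ (y + s)).
  by rewrite mulrC -subr_sqr s2.
rewrite rmorphD ry rs -mulr2n -mulr_natl mulf_neq0 ?two_neq0 //.
by rewrite expf_neq0.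
Qed.

Lemma horner_rdvd (c : Zq) (f g : {poly Zq}) x :
  (forall M, pcong c M f g) -> rdvd c (f.[x] - g.[x]).
Proof.
move=> fg; rewrite -hornerN -hornerD horner_coef; apply: rdvd_sum => i _.
by apply/rdvdMr/(fg i.+1).
Qed.

(** At a root of unity [T] of order dividing [q - 1], other than 1,
    [(1-X^q)/(1-X)] takes the value 1, so that [h(T)] is a square root of 1; and
    modulo [p] it is an odd power of [(1-t)^((q-1)/2)]. At [T = 1] both sides
    vanish. *)
Lemma horner_teichmuller_cong N k (h : {poly Zq}) (t : F) : (0 < N)%N -> t != 0 ->
  h.[1] = 0 ->
  (forall M, pcong p%:R M h ((1 - 'X) ^+ (e * k.*2.+1))) ->
  (forall M, pcong (p%:R ^+ N) M (h ^+ 2) (geom _ q ^+ k.*2.+1)) ->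
  rdvd (p%:R ^+ N) (h.[teich t] - quad_charq (1 - t)).
Proof.
move=> N_gt0 t0 h1 hp hE; have [-> | t1] := eqVneq t 1.
  by rewrite (teichmuller1 hres r_gt0 cardF) h1 subrr /quad_charq eqxx subr0; apply: rdvdr0.
have b0 : 1 - t != 0 by rewrite subr_eq0 eq_sym.
have [tt rt] := teichmullerP hres r_gt0 cardF t0.
have ttq : teich t ^+ q = teich t.
  by rewrite -(prednK (ltnW (card_finField_gt1 F))) exprS tt mulr1.
have gt1 : (geom _ q).[teich t] = 1.
  apply: (@integer_mulI _ _ K (1 - teich t)).
    by apply: contraNneq b0 => /(congr1 res); rewrite rmorphB rmorph1 rt rmorph0 => ->.
  have := congr1 (fun f => f.[teich t]) (@geomE Zq q).
  by rewrite !hornerE ttq => ->.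
apply: quad_charq_cong => //.
  by have := horner_rdvd (teich t) hE; rewrite !horner_exp gt1 expr1n.
have be2 : ((1 - t) ^+ e) ^+ 2 = 1.
  by rewrite -exprM muln2; have := finField_expf1 b0; rewrite cardFe.
have := horner_rdvd (teich t) hp; move/(res_eq0 hres)/eqP.
rewrite rmorphB subr_eq0 => /eqP ->.
rewrite !hornerE rmorphXn rmorphB rmorph1 rt exprM exprS -mul2n exprM be2 expr1n.
by rewrite mulr1.
Qed.

Lemma sum_class_mod (V : nmodType) (f : nat -> V) d k :
  \sum_(0 <= j < d * k) f j = \sum_(i < k) \sum_(b < d) f (d * i + b)%N.
Proof.
rewrite mulnC big_nat_mul big_mkord; apply: eq_bigr => i _.
rewrite -{1}[(i * d)%N]add0n big_addn -mulnBl subSnn mul1n big_mkord.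
by apply: eq_bigr => b _; rewrite addnC mulnC.
Qed.

(** The sum of [h(T) T^(-a)] over the roots of unity [T] picks out the
    coefficients of [h] whose index is congruent to [a] modulo [q - 1]. *)
Lemma jacobi_sum_cong N a k (h : {poly Zq}) : (0 < N)%N -> (a < q.-1)%N ->
  (size h <= (e * k.*2.+1).+1)%N -> h.[1] = 0 ->
  (forall M, pcong p%:R M h ((1 - 'X) ^+ (e * k.*2.+1))) ->
  (forall M, pcong (p%:R ^+ N) M (h ^+ 2) (geom _ q ^+ k.*2.+1)) ->
  rdvd (p%:R ^+ N) (q.-1%:R * (\sum_(i < k.+1) h`_(q.-1 * i + a)) - jacobi_sum a).
Proof.
move=> N_gt0 lt_a size_h h1 hp hE.
have q1 : q.-1 = e.*2 by rewrite cardFe.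
have size_h' : (size h <= q.-1 * k.+1)%N by apply: leq_trans size_h _; rewrite q1; nia.
suff -> : q.-1%:R * (\sum_(i < k.+1) h`_(q.-1 * i + a)) =
    \sum_(t : F | t != 0) h.[teich t] * teich t ^+ (q.-1 - a).
  rewrite -sumrB; apply: rdvd_sum => t t0; rewrite -mulrBl; apply: rdvdMr.
  exact: horner_teichmuller_cong.
under [RHS]eq_bigr => t _.
  rewrite (horner_coef_wide _ size_h') -(big_mkord xpredT (fun j => h`_j * teich t ^+ j)).
  rewrite sum_class_mod mulr_suml.
  under eq_bigr do rewrite mulr_suml.
  over.
rewrite exchange_big mulr_sumr; apply: eq_bigr => i _ /=.
rewrite exchange_big (bigD1 (Ordinal lt_a)) //= [X in _ + X]big1 ?addr0 => [|b ne_b].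
  under eq_bigr do rewrite -mulrA -exprD.
  rewrite -mulr_sumr (sum_teichmuller hres r_gt0 cardF) ifT; first by rewrite mulrC.
  by rewrite -addnA subnKC ?(ltnW lt_a) // dvdn_add ?dvdn_mulr // dvdnn.
under eq_bigr do rewrite -mulrA -exprD.
rewrite -mulr_sumr (sum_teichmuller hres r_gt0 cardF) ifF ?mulr0 //.
apply/negP; rewrite -addnA dvdn_addr ?dvdn_mulr // => dvd_ba.
have ne_ba : nat_of_ord b <> a by move=> ba; case/eqP: ne_b; apply: val_inj.
have [c] := dvdnP dvd_ba; have := ltn_ord b; have a_lt := lt_a.
clear ne_b dvd_ba lt_a; move: (nat_of_ord b) ne_ba a_lt; move: (q.-1) => d {}b.
by case: c => [|[|c]]; rewrite ?mul0n ?mul1n ?mulSn; lia.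
Qed.

End JacobiSum.

(** * The theorem of Wilson modulo prime powers *)

Section FirstOrderExpansions.
Variable R : comNzRingType.
Implicit Types (x d : R).

Lemma prod_shift_expand (I : Type) (s : seq I) (f : I -> R) :
  exists d, forall y, exists t, \prod_(i <- s) (f i + y) = \prod_(i <- s) f i + y * d + y ^+ 2 * t.
Proof.
elim: s => [|i s [d IHs]].
  by exists 0 => y; exists 0; rewrite !big_nil; ring.
exists (f i * d + \prod_(i <- s) f i) => y; have [t tE] := IHs y.
exists (d + f i * t + y * t); rewrite !big_cons tE; ring.
Qed.

Lemma prod_arith_expand x d k :
  exists t, \prod_(0 <= i < k) (x + i%:R * d) = x ^+ k + d * ('C(k, 2)%:R * x ^+ k.-1) + d ^+ 2 * t.
Proof.
elim: k => [|k [t IHk]]; first by exists 0; rewrite big_geq // bin0n expr0 /=; ring.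
rewrite big_nat_recr //= IHk binS bin1 natrD.
case: k {IHk} => [|k] /=; first by exists (t * x); rewrite expr0 bin0n /=; ring.
exists (t * (x + k.+1%:R * d) + 'C(k.+1, 2)%:R * x ^+ k * k.+1%:R).
by rewrite !exprS; move: (x ^+ k) (t) => X T; ring.
Qed.

Lemma expr_add_expand x d k :
  exists t, (x + d) ^+ k = x ^+ k + d * (k%:R * x ^+ k.-1) + d ^+ 2 * t.
Proof.
elim: k => [|k [t IHk]]; first by exists 0; rewrite !expr0; ring.
rewrite exprS IHk; case: k {IHk} => [|k] /=; first by exists (t * (x + d)); rewrite !expr0 expr1; ring.
exists (t * (x + d) + k.+1%:R * x ^+ k).
by rewrite !exprS -!natr1; move: (x ^+ k) (t) => X T; ring.
Qed.

End FirstOrderExpansions.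

Section PadicGammaFunction.
Variables (p : nat) (p_pr : prime p).
Hypothesis p_odd : odd p.
Local Notation Zp := (padic_int p_pr).
Implicit Types (x y : Zp) (m n N : nat).

Let p_gt0 : (0 < p)%N. Proof. exact: prime_gt0. Qed.
Let p_gt1 : (1 < p)%N. Proof. exact: prime_gt1. Qed.

Lemma rdvd_nat n : rdvd (p%:R : Zp) n%:R <-> (p %| n)%N.
Proof.
rewrite -[p%:R]expr1 padic_rdvdP padic_mod_nat expr1 modz_nat.
by split=> [[/eqP]|/eqP ->].
Qed.

Lemma padic_cancel N x y : ~ rdvd p%:R x -> rdvd (p%:R ^+ N) (x * y) -> rdvd (p%:R ^+ N) y.
Proof.
move=> /padic_inv_exists[w xw] dxy; have -> : y = w * (x * y) by rewrite mulrA (mulrC w) xw mul1r.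
exact: rdvdMl.
Qed.

(** The factor of [x] prime to [p] in the functional equation of the gamma function. *)
Definition prime_factor x : Zp := if `[< rdvd p%:R x >] then 1 else x.

Lemma prime_factor_ndvd x : ~ rdvd p%:R (prime_factor x).
Proof.
rewrite /prime_factor; case: asboolP => // _ d1.
have : (p %| 1)%N by apply/rdvd_nat.
by rewrite dvdn1 gtn_eqF.
Qed.

Lemma prime_factor_nat n : prime_factor n%:R = if (p %| n)%N then 1 else n%:R.
Proof.
by rewrite /prime_factor; case: asboolP => [/rdvd_nat ->|/rdvd_nat/negP/negPf ->].
Qed.

Lemma prime_factor_cong N x y : (0 < N)%N -> rdvd (p%:R ^+ N) (x - y) ->
  rdvd (p%:R ^+ N) (prime_factor x - prime_factor y).
Proof.
move=> N_gt0 dxy; have d1 : rdvd p%:R (x - y).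
  by apply: rdvd_trans dxy; rewrite -{1}[p%:R]expr1; apply: rdvd_exp.
have d2 : rdvd p%:R (y - x) by rewrite -opprB; apply: rdvdN.
rewrite /prime_factor; case: asboolP => dx; case: asboolP => dy //.
- by rewrite subrr; apply: rdvdr0.
- by case: dy; apply: rdvd_congl dx.
by case: dx; apply: rdvd_congl dy.
Qed.

Definition unit_block n N : Zp := \prod_(0 <= j < p ^ N) prime_factor (n + j)%:R.

(** Moving the block by one place replaces a factor by a congruent one. *)
Lemma unit_block_shift n N : (0 < N)%N -> rdvd (p%:R ^+ N) (unit_block n N - unit_block 0 N).
Proof.
move=> N_gt0; elim: n => [|n IHn]; first by rewrite subrr; apply: rdvdr0.
suff : rdvd (p%:R ^+ N) (unit_block n.+1 N - unit_block n N).
  by move=> /rdvdD/(_ IHn); rewrite addrA subrK.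
apply: (@padic_cancel _ (prime_factor n%:R)); first exact: prime_factor_ndvd.
have eB : prime_factor n%:R * unit_block n.+1 N =
    unit_block n N * prime_factor (n + p ^ N)%:R.
  rewrite /unit_block -[RHS](@big_nat_recr _ _ _ _ _ (fun j => prime_factor (n + j)%:R)) //.
  rewrite [RHS]big_nat_recl // addn0; congr (_ * _).
  by apply: eq_bigr => j _; rewrite addSnnS.
rewrite mulrBr eB mulrC -mulrBl mulrC; apply: rdvdMl.
apply: prime_factor_cong => //.
by rewrite natrD addrC addKr natrX; apply: rdvd_refl.
Qed.

(** By induction on [N], splitting the block of length [p^(N+1)] into [p]
    translates of the block [X] of length [p^N]. Modulo [p^(N+1)] they are
    [X + i p^N d] for a common [d], and their product is [X^p]: the sum of the
    [i] is [p (p - 1) / 2], divisible by [p] as [p] is odd. Finally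
    [(-1 + p^N z)^p = -1] modulo [p^(N+1)]. *)
Lemma wilson_prime_power N : (0 < N)%N -> rdvd (p%:R ^+ N) (unit_block 0 N + 1).
Proof.
case: N => // N _; elim: N => [|N [z IHN]].
  rewrite expr1 /unit_block expn1 (big_ltn p_gt0) prime_factor_nat dvdn0 mul1r.
  have -> : \prod_(1 <= i < p) prime_factor (0 + i)%:R = (p.-1`!)%:R :> Zp.
    rewrite fact_prod natr_prod prednK //; apply: eq_big_nat => i /andP[i_gt0 lt_ip].
    by rewrite prime_factor_nat gtnNdvd.
  rewrite natr1; apply/rdvd_nat; rewrite -Wilson //.
have [d dE] := prod_shift_expand [seq j <- index_iota 0 (p ^ N.+1) | ~~ (p %| j)%N] (fun j => j%:R : Zp).
pose X := unit_block 0 N.+1.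
have XE : \prod_(j <- index_iota 0 (p ^ N.+1) | ~~ (p %| j)%N) (j%:R : Zp) = X.
  rewrite /X /unit_block big_mkcond; apply: eq_bigr => j _.
  by rewrite prime_factor_nat; case: (p %| j)%N.
have step : rdvd (p%:R ^+ N.+2) (unit_block 0 N.+2 - \prod_(0 <= i < p) (X + i%:R * (p%:R ^+ N.+1 * d))).
  rewrite /unit_block [(p ^ N.+2)%N]expnS big_nat_mul; apply: rdvd_prod_sub => i _.
  rewrite -{1}[(i * _)%N]add0n big_addn -mulnBl subSnn mul1n.
  have [t tE] := dE (i%:R * p%:R ^+ N.+1).
  rewrite !big_filter XE in tE.
  suff -> : \prod_(0 <= j < p ^ N.+1) prime_factor (0 + (j + i * p ^ N.+1))%:R =
       \prod_(j <- index_iota 0 (p ^ N.+1) | ~~ (p %| j)%N) (j%:R + i%:R * p%:R ^+ N.+1).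
    exists (p%:R ^+ N * i%:R ^+ 2 * t).
    rewrite tE !exprS; move: (p%:R ^+ N) => pN; ring.
  rewrite [RHS]big_mkcond; apply: eq_bigr => j _.
  have dv : (p %| i * p ^ N.+1)%N by rewrite dvdn_mull // expnS dvdn_mulr.
  rewrite add0n prime_factor_nat dvdn_addl //.
  by case: (p %| j)%N => //=; rewrite natrD natrM natrX.
have [t tE] := prod_arith_expand X (p%:R ^+ N.+1 * d) p.
have Xz : X = -1 + p%:R ^+ N.+1 * z by rewrite -IHN /X; ring.
have [t' t'E] := expr_add_expand (-1) (p%:R ^+ N.+1 * z) p.
have [c cE] : exists c, 'C(p, 2)%:R = p%:R * c :> Zp.
  by apply/rdvd_nat/prime_dvd_bin => //; case: (p) p_odd p_gt1 => [|[|[]]].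
rewrite -Xz -signr_odd p_odd expr1 in t'E.
have -> : unit_block 0 N.+2 + 1 = (unit_block 0 N.+2 - \prod_(0 <= i < p) (X + i%:R * (p%:R ^+ N.+1 * d)))
   + (\prod_(0 <= i < p) (X + i%:R * (p%:R ^+ N.+1 * d)) + 1) by ring.
apply: rdvdD => //; rewrite tE t'E cE.
exists (d * c * X ^+ p.-1 + p%:R ^+ N * d ^+ 2 * t + z * (-1) ^+ p.-1 + p%:R ^+ N * z ^+ 2 * t').
rewrite !exprS; move: (p%:R ^+ N) (X ^+ p.-1) ((-1) ^+ p.-1) => pN X' s; ring.
Qed.

End PadicGammaFunction.

(** * The p-adic gamma function *)

Section PadicGammaTheory.
Variables (p : nat) (p_pr : prime p).
Hypothesis p_odd : odd p.
Local Notation Zp := (padic_int p_pr).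
Local Notation pf := (@prime_factor p p_pr).
Implicit Types (x y : Zp) (m n N : nat).

Let p_gt0 : (0 < p)%N. Proof. exact: prime_gt0. Qed.
Let p_gt1 : (1 < p)%N. Proof. exact: prime_gt1. Qed.

Lemma padic_natr_neq0 n : (0 < n)%N -> n%:R != 0 :> Zp.
Proof. by case: n => // n _; apply: padic_nat_neq0. Qed.

Definition gamma_nat n : Zp := (padic_gamma_nat p n)%:~R.

Lemma gamma_natE n : gamma_nat n = (-1) ^+ n * \prod_(0 <= j < n) pf j%:R.
Proof.
rewrite /gamma_nat /padic_gamma_nat rmorphM rmorphXn rmorphN1 rmorph_prod; congr (_ * _).
case: n => [|n]; first by rewrite !big_geq.
rewrite big_ltn // prime_factor_nat dvdn0 mul1r big_mkcond.
by apply: eq_bigr => j _; rewrite prime_factor_nat; case: (p %| j)%N.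
Qed.

Lemma gamma_natS n : gamma_nat n.+1 = - pf n%:R * gamma_nat n.
Proof. by rewrite !gamma_natE big_nat_recr //= exprS; ring. Qed.

(** A block of length [p^N] contributes [-1] by Wilson's theorem, and the sign
    [(-1)^(p^N) = -1] compensates it. *)
Lemma gamma_nat_period n k N :
  rdvd (p%:R ^+ N) (gamma_nat (n + k * p ^ N) - gamma_nat n).
Proof.
case: N => [|N]; first by rewrite expr0; eexists; rewrite mul1r.
elim: k => [|k IHk]; first by rewrite addn0 subrr; apply: rdvdr0.
suff : rdvd (p%:R ^+ N.+1) (gamma_nat (n + k.+1 * p ^ N.+1) - gamma_nat (n + k * p ^ N.+1)).
  by move=> /rdvdD/(_ IHk); rewrite addrA subrK.
rewrite mulSn addnCA addnC; move: (n + _)%N => {IHk k}n.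
have -> : gamma_nat (n + p ^ N.+1) = - gamma_nat n * unit_block p_pr n N.+1.
  rewrite !gamma_natE exprD -[(-1) ^+ (p ^ _)]signr_odd oddX p_odd orbT expr1.
  have -> : unit_block p_pr n N.+1 = \prod_(n <= j < n + p ^ N.+1) pf j%:R.
    by rewrite -{2}[n]add0n big_addn addKn; apply: eq_bigr => j _; rewrite addnC.
  by rewrite (@big_cat_nat _ _ _ n) ?leq_addr //=; ring.
have [z zE] := wilson_prime_power p_pr p_odd (ltn0Sn N).
have [t tE] := unit_block_shift p_pr n (ltn0Sn N).
exists (- gamma_nat n * (z + t)).
have -> : unit_block p_pr n N.+1 = p%:R ^+ N.+1 * (z + t) - 1.
  by rewrite mulrDr -zE -tE; ring.
by ring.
Qed.

Lemma gamma_nat_cong m n N : rdvd (p%:R ^+ N) (m%:R - n%:R : Zp) ->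
  rdvd (p%:R ^+ N) (gamma_nat m - gamma_nat n).
Proof.
wlog le_nm : m n / (n <= m)%N => [hw|].
  case: (leqP n m) => [/hw //|/ltnW/hw {}hw]; rewrite -opprB => /rdvdN.
  by rewrite opprK => /hw /rdvdN; rewrite opprB.
rewrite -natrB // => /padic_rdvdP; rewrite padic_mod_nat -Posz_exp modz_nat => -[/eqP].
by move=> /dvdnP[k kE]; rewrite -(subnKC le_nm) kE; apply: gamma_nat_period.
Qed.

(** The values at natural numbers tending to [x] form a Cauchy sequence by
    [gamma_nat_cong]. *)
Lemma gamma_extension : exists f : Zp -> Zp, forall x N m,
  rdvd (p%:R ^+ N) (x - m%:R) -> rdvd (p%:R ^+ N) (f x - gamma_nat m).
Proof.
suff /choice[f fE] : forall x, exists y, forall N m,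
  rdvd (p%:R ^+ N) (x - m%:R) -> rdvd (p%:R ^+ N) (y - gamma_nat m) by exists f.
move=> x.
have /choice[M ME] := padic_nat_dense x.
have cong N m : rdvd (p%:R ^+ N) (x - m%:R) -> rdvd (p%:R ^+ N) (gamma_nat (M N) - gamma_nat m).
  move=> xm; apply: gamma_nat_cong; have := rdvdB xm (ME N).
  by congr rdvd; ring.
have /choice[c cE] N : exists c, gamma_nat (M N.+1) - gamma_nat (M N) = p%:R ^+ N * c.
  have [z zE] : rdvd (p%:R ^+ N) (gamma_nat (M N) - gamma_nat (M N.+1)).
    by apply/cong/rdvd_trans/(ME N.+1)/rdvd_exp.
  by exists (- z); rewrite mulrN -zE opprB.
have [s sE] := padic_series c.
exists (s + gamma_nat (M 0)) => N m /cong.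
have := sE N; rewrite -(big_mkord xpredT (fun k => p%:R ^+ k * c k)).
under eq_bigr => k _ do rewrite -cE.
by rewrite telescope_sumr // => /rdvdD h /h; congr rdvd; ring.
Qed.

Local Notation Gamma := (@padic_gamma p p_pr).

(** Whichever continuous extension [padic_gamma] selects, it agrees with the one
    of [gamma_extension], as the natural numbers are dense. *)
Lemma padic_gammaP x N m :
  rdvd (p%:R ^+ N) (x - m%:R) -> rdvd (p%:R ^+ N) (Gamma x - gamma_nat m).
Proof.
have [f fE] := gamma_extension.
have fnat n : f n%:R = gamma_nat n.
  apply/eqP; rewrite -subr_eq0; apply/eqP/padic_separated => k.
  by apply: fE; rewrite subrr; apply: rdvdr0.
suff -> : Gamma x = f x by apply: fE.
rewrite /padic_gamma; case: xgetP => [g _ [gcont gnat]|/(_ f)[]]; last first.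
  split=> // y k; exists k => z [t yz].
  have [n yn] := padic_nat_dense y k.
  have zn : rdvd (p%:R ^+ k) (z - n%:R).
    by apply: rdvd_congl yn; exists t; rewrite mulrC -yz; ring.
  have [w wE] := rdvdB (fE _ _ _ yn) (fE _ _ _ zn).
  by exists w; rewrite mulrC -wE; ring.
apply/eqP; rewrite -subr_eq0; apply/eqP/padic_separated => k.
have [k' gk] := gcont x k; have [n xn] := padic_nat_dense x (maxn k k').
have [z zE] : rdvd (p%:R ^+ k) (g x - g n%:R).
  have [|w wE] := gk n%:R.
    have [t tE] : rdvd (p%:R ^+ k') (x - n%:R).
      by apply: rdvd_trans xn; apply: rdvd_exp; apply: leq_maxr.
    by exists t; rewrite tE mulrC.
  by exists w; rewrite wE mulrC.
have [t tE] : rdvd (p%:R ^+ k) (f x - gamma_nat n).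
  by apply/fE/rdvd_trans/xn/rdvd_exp/leq_maxl.
by exists (z - t); rewrite mulrBr -zE -tE gnat -/(gamma_nat n); ring.
Qed.

Lemma padic_gamma_nat_val n : Gamma n%:R = gamma_nat n.
Proof.
apply/eqP; rewrite -subr_eq0; apply/eqP/padic_separated => k.
by apply: padic_gammaP; rewrite subrr; apply: rdvdr0.
Qed.

Lemma padic_gamma0 : Gamma 0 = 1.
Proof. by rewrite (padic_gamma_nat_val 0) gamma_natE big_geq // mulr1. Qed.

Lemma padic_gamma_cong N x y :
  rdvd (p%:R ^+ N) (x - y) -> rdvd (p%:R ^+ N) (Gamma x - Gamma y).
Proof.
move=> xy; have [n xn] := padic_nat_dense x N.
have yn : rdvd (p%:R ^+ N) (y - n%:R).
  have := rdvdB xn xy; congr rdvd; ring.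
by have := rdvdB (padic_gammaP xn) (padic_gammaP yn); congr rdvd; ring.
Qed.

Lemma padic_gammaS x : Gamma (x + 1) = - pf x * Gamma x.
Proof.
apply/eqP; rewrite -subr_eq0; apply/eqP/padic_separated => N.
have [n xn] := padic_nat_dense x N.+1.
suff : rdvd (p%:R ^+ N.+1) (Gamma (x + 1) - - pf x * Gamma x).
  by apply: rdvd_trans; apply: rdvd_exp.
have [z1 e1] : rdvd (p%:R ^+ N.+1) (Gamma (x + 1) - gamma_nat n.+1).
  by apply: padic_gammaP; have := xn; congr rdvd; rewrite -natr1; ring.
have [z2 e2] := prime_factor_cong (ltn0Sn N) xn.
have [z3 e3] := padic_gammaP xn.
exists (z1 + z2 * gamma_nat n + pf x * z3).
rewrite !mulrDr mulrA -e1 -e2 [_ * (pf x * z3)]mulrCA -e3 gamma_natS; ring.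
Qed.

Lemma padic_gammaD x n :
  Gamma (x + n%:R) = (-1) ^+ n * Gamma x * \prod_(0 <= k < n) pf (x + k%:R).
Proof.
elim: n => [|n IHn]; first by rewrite addr0 big_geq // expr0; ring.
by rewrite -natr1 addrA padic_gammaS IHn big_nat_recr //= exprS; ring.
Qed.

Lemma prime_factorN x : pf (- x) = if `[< rdvd p%:R x >] then pf x else - pf x.
Proof.
rewrite /prime_factor; have -> : rdvd p%:R (- x) = rdvd p%:R x.
  by apply/propext; split=> /rdvdN; rewrite ?opprK.
by case: asboolP.
Qed.

(** In passing from [n] to [n + 1] the functional equation changes both factors,
    and their product changes sign unless [p] divides [n + 1]. *)
Lemma padic_gamma_reflection n :
  Gamma (- n%:R) * Gamma (n%:R + 1) = (-1) ^+ (n - n %/ p).+1.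
Proof.
elim: n => [|n IHn].
  rewrite oppr0 padic_gammaS padic_gamma0 /prime_factor ifT; first by rewrite div0n; ring.
  by apply/asboolP; apply: rdvdr0.
have := padic_gammaS (- n.+1%:R); have -> : - n.+1%:R + 1 = - n%:R :> Zp.
  by rewrite -natr1; ring.
rewrite prime_factorN => g1; rewrite padic_gammaS.
have pf_neq0 : pf n.+1%:R != 0.
  by apply/eqP => pf0; apply: (@prime_factor_ndvd _ p_pr n.+1%:R); rewrite pf0; apply: rdvdr0.
rewrite natr1 in IHn; rewrite divnS //.
have le_d : (n %/ p <= n)%N := leq_div n p.
case: asboolP g1 => [/rdvd_nat dv|/rdvd_nat/negP ndv] g1.
  rewrite dv add1n subSS -IHn g1 ; ring.
rewrite (negPf ndv) add0n subSn // exprS -IHn g1; ring.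
Qed.

Variable half : Zp.
Hypothesis half2 : half * 2%:R = 1.

Definition half_poch n : Zp := \prod_(0 <= k < n) (half + k%:R).

(** The factors [1/2 + k] divisible by [p] are those with [k = p l + h], and they
    are equal to [p (1/2 + l)]. *)
Lemma half_poch_factor h n : p = h.*2.+1 ->
  half_poch n = (\prod_(0 <= k < n) pf (half + k%:R)) *
    p%:R ^+ ((n + h) %/ p) * half_poch ((n + h) %/ p).
Proof.
move=> pE; elim: n => [|n IHn].
  rewrite /half_poch divn_small ?big_geq ?expr0 ?mulr1 //; lia.
have hpS k : half_poch k.+1 = half_poch k * (half + k%:R) by rewrite /half_poch big_nat_recr.
rewrite hpS IHn big_nat_recr //= addSn divnS //.
have hE : half + n%:R = half * n.*2.+1%:R.
  by rewrite -natr1 -muln2 natrM mulrDr mulr1 [in RHS]mulrCA half2 mulr1 addrC.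
have dvdE : rdvd p%:R (half + n%:R) <-> (p %| (n + h).+1)%N.
  have -> : (p %| (n + h).+1)%N = (p %| n.*2.+1)%N.
    rewrite -(@Gauss_dvdr p 2 (n + h).+1); last by rewrite coprimen2.
    by rewrite (_ : 2 * (n + h).+1 = p + n.*2.+1)%N ?dvdn_addr // pE; lia.
  rewrite hE; split=> [hd|/(rdvd_nat p_pr) hd]; last exact: rdvdMl.
  by apply/(rdvd_nat p_pr); have := rdvdMr 2%:R hd; rewrite mulrAC half2 mul1r.
have -> : pf (half + n%:R) = if (p %| (n + h).+1)%N then 1 else half + n%:R.
  rewrite /prime_factor; case: asboolP => [/(proj1 dvdE) -> //|ndv].
  by rewrite ifF //; apply/negP => /(proj2 dvdE).
case: ifPn => [dv|_]; last by rewrite add0n; ring.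
rewrite add1n exprS hpS.
suff -> : half + n%:R = p%:R * (half + ((n + h) %/ p)%:R) by ring.
have nhE : (n.*2.+1 = p * ((n + h) %/ p).*2.+1)%N.
  have := divnK dv; rewrite divnS // dv add1n => e1.
  by move: e1; move: ((n + h) %/ p)%N => L; rewrite pE; nia.
have -> : half + ((n + h) %/ p)%:R = half * ((n + h) %/ p).*2.+1%:R.
  by rewrite -natr1 -muln2 natrM mulrDr mulr1 [in RHS]mulrCA half2 mulr1 addrC.
by rewrite hE nhE natrM; ring.
Qed.

Lemma fact_factor n : n`!%:R = (\prod_(0 <= k < n.+1) pf k%:R) *
    p%:R ^+ (n %/ p) * (n %/ p)`!%:R :> Zp.
Proof.
elim: n => [|n IHn].
  by rewrite div0n big_nat1 prime_factor_nat dvdn0 expr0; ring.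
rewrite factS natrM IHn [in RHS]big_nat_recr //= divnS // prime_factor_nat.
case: (boolP (p %| n.+1)%N) => [dv|_]; last by rewrite add0n; ring.
have {1}-> : (n.+1 = p * (n %/ p).+1)%N.
  by have := divnK dv; rewrite divnS // dv add1n mulnC => ->.
by rewrite add1n exprS factS !natrM; ring.
Qed.

Lemma half_bin_poch n : half_bin half n * n`!%:R = half_poch n.
Proof.
elim: n => [|n IHn]; first by rewrite half_bin0 /half_poch big_geq // mulr1.
rewrite /half_poch big_nat_recr //= -/(half_poch n) -IHn factS natrM.
have := half_binS half2 n; rewrite -(addnn n.+1) => bS.
have -> : half_bin half n.+1 * (n.+1%:R * n`!%:R) =
   half * ((n.+1 + n.+1)%:R * half_bin half n.+1) * n`!%:R.
  have -> : (n.+1 + n.+1)%:R = n.+1%:R * 2%:R :> Zp by rewrite -natrM muln2 addnn.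
  by rewrite -[LHS]mul1r -[X in X * _ = _]half2; ring.
rewrite bS (_ : half + n%:R = half * n.*2.+1%:R); first by ring.
by rewrite -natr1 -muln2 natrM mulrDr mulr1 [in RHS]mulrCA half2 mulr1 addrC.
Qed.

(** The Pochhammer symbol of 1/2 of length [n + c], divided by [n!]. When [p n + d]
    loses its last digit, the number of multiples of [p] in the Pochhammer symbol
    may exceed that in the factorial by 1, so that the recursion needs both values
    of [c]. *)
Definition half_bin_carry n (c : bool) : Zp := half_bin half n * (half + n%:R) ^+ c.

(** The parts prime to [p] of the Pochhammer symbol and of the factorial are
    quotients of gamma values. The multiples of [p] form the same products for
    [n], with the factor [1/2 + n] present exactly when [d + c] exceeds [h]. *)
Lemma half_bin_carry_step h n d (c : bool) : p = h.*2.+1 -> (d < p)%N ->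
  half_bin_carry (p * n + d) c * (Gamma ((p * n + d)%:R + 1) * Gamma half)
  = p%:R ^+ (h < d + c)%N * half_bin_carry n (h < d + c)%N
     * - ((-1) ^+ c * Gamma (half + (p * n + d)%:R + c%:R)).
Proof.
move=> pE lt_dp; set N := (p * n + d)%N; set c' := (h < d + c)%N.
have carryE k (b : bool) : half_bin_carry k b * k`!%:R = half_poch (k + b).
  rewrite /half_bin_carry mulrAC half_bin_poch; case: b; rewrite ?addn0 ?mulr1 //.
  by rewrite addn1 /half_poch big_nat_recr.
have Nh : ((N + c + h) %/ p = n + c')%N.
  rewrite /N /c' -!addnA mulnC divnMDl //; congr (_ + _)%N.
  case: ltnP => dh; last by rewrite divn_small //; lia.
  by rewrite (_ : (d + (c + h)) = 1 * p + (d + c - h.+1))%N ?divnMDl ?divn_small //;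
    case: (c) dh => /=; lia.
have Np : (N %/ p = n)%N by rewrite /N mulnC divnMDl // divn_small ?addn0.
have e1 := carryE N c; rewrite (half_poch_factor _ pE) Nh exprD in e1.
have e2 := fact_factor N; rewrite Np in e2.
have e3 := carryE n c'.
have e4 := padic_gammaD half (N + c); rewrite exprD in e4.
have e5 := padic_gammaD 0 N.+1; rewrite add0r padic_gamma0 mulr1 in e5.
rewrite (eq_bigr (fun k : nat => pf k%:R)) in e5; last by move=> k _; rewrite add0r.
have pn0 : p%:R ^+ n * n`!%:R != 0 :> Zp.
  rewrite mulf_neq0 ?expf_neq0 //.
    exact: padic_natr_neq0.
  exact/padic_natr_neq0/fact_gt0.
apply: (mulfI pn0).
set U1 := \prod_(0 <= k < N + c) _ in e1 e4; set U2 := \prod_(0 <= k < N.+1) _ in e2 e5.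
have s2 k : (-1) ^+ k * (-1) ^+ k = 1 :> Zp by rewrite -exprMn mulrNN mulr1 expr1n.
rewrite natr1 e5 -addrA -natrD e4.
transitivity ((-1) ^+ N.+1 * Gamma half * (half_bin_carry N c * N`!%:R)).
  by rewrite e2; ring.
rewrite e1 -e3 exprS.
transitivity (((-1) ^+ c * (-1) ^+ c) * (-1 * (-1) ^+ N * Gamma half *
   (U1 * (p%:R ^+ n * p%:R ^+ c') * (half_bin_carry n c' * n`!%:R)))).
  by rewrite s2 mul1r.
by ring.
Qed.

End PadicGammaTheory.

(** * Valuations and the choice of the precision *)

Section Valuations.
Variables (p : nat) (p_pr : prime p).
Hypothesis p_odd : odd p.
Local Notation Zp := (padic_int p_pr).

Let p_gt0 : (0 < p)%N. Proof. exact: prime_gt0. Qed.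
Let p_gt1 : (1 < p)%N. Proof. exact: prime_gt1. Qed.
Let p_gt2 : (2 < p)%N. Proof. exact: odd_prime_gt2. Qed.

(** In Legendre's formula for the factorials, each of the powers [p^i] with
    [i <= k] contributes at most 1, and the others contribute 0. *)
Lemma logn_central_bin n k : (n.*2 < p ^ k.+1)%N -> (logn p 'C(n.*2, n) <= k)%N.
Proof.
move=> lt_n; have := bin_fact (leq_addr n n); rewrite addnn.
have -> : (n.*2 - n = n)%N by lia.
move/(congr1 (logn p)); rewrite lognM ?fact_gt0 ?bin_gt0 //; [|lia|by rewrite muln_gt0 fact_gt0].
rewrite lognM ?fact_gt0 // !logn_fact // => logE.
have ext : (\sum_(1 <= i < n.+1) n %/ p ^ i = \sum_(1 <= i < n.*2.+1) n %/ p ^ i)%N.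
  rewrite (@big_cat_nat _ _ _ n.+1 1 n.*2.+1) //=; last lia.
  rewrite [X in (_ + X)%N]big1_seq ?addn0 // => i; rewrite mem_index_iota => /and3P[_ lt_ni _].
  by rewrite divn_small // (leq_trans lt_ni) // ltnW // ltn_expl.
rewrite ext in logE.
have le2 : (\sum_(1 <= i < n.*2.+1) n.*2 %/ p ^ i <=
   \sum_(1 <= i < n.*2.+1) (n %/ p ^ i + n %/ p ^ i + (i <= k)))%N.
  rewrite !big_nat; apply: leq_sum => i /andP[i_gt0 _].
  have pi_gt0 : (0 < p ^ i)%N by rewrite expn_gt0 p_gt0.
  case: (leqP i k) => [_|lt_ki].
    by rewrite -addnn addn1 -addn1 leq_divDl.
  rewrite divn_small ?leq0n //; apply: leq_trans lt_n _.
  by rewrite leq_exp2l.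
have cnt L : (\sum_(1 <= i < L.+1) (i <= k) = minn L k)%N.
  elim: L => [|L IHL]; first by rewrite big_geq // min0n.
  by rewrite big_nat_recr //= IHL; case: leqP; lia.
by move: le2; rewrite !big_split /= cnt -logE; have := geq_minr n.*2 k; lia.
Qed.

Lemma half_bin_dvd (half : Zp) n k : half * 2%:R = 1 -> (n.*2 < p ^ k.+1)%N ->
  rdvd (half_bin half n) (p%:R ^+ k).
Proof.
move=> half2 /logn_central_bin le_k.
have C_gt0 : (0 < 'C(n.*2, n))%N by rewrite bin_gt0; lia.
have [u co CE] := pfactor_coprime p_pr C_gt0.
have [w wE] : exists w : Zp, u%:R * w = 1 by apply: padic_nat_inv_exists; rewrite -prime_coprime.
have half_unit : rdvd (half ^+ n.*2) 1.
  by exists (2%:R ^+ n.*2); rewrite -exprMn half2 expr1n.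
rewrite -[p%:R ^+ k]mulr1 /half_bin; apply: rdvdM => //.
rewrite CE natrM natrX mulrC -[X in rdvd _ X]mulr1.
by apply: rdvdM; [apply: rdvd_exp | exists w].
Qed.

(** The half-integer [1/2 + k] is divisible by [p] once every [p] steps; for
    [m = (p^t + 1)/2] the quotients form the same kind of product, with
    [m = (p^(t-1) + 1)/2]. *)
Lemma half_poch_dvd (half : Zp) t : half * 2%:R = 1 ->
  rdvd (half_poch half (p ^ t).+1./2) (p%:R ^+ (\sum_(i < t) (p ^ i).+1./2)).
Proof.
move=> half2; elim: t => [|t IHt].
  by rewrite big_ord0 expn0 /half_poch big_nat1; exists 2%:R; rewrite addr0 half2 expr0.
have pE : p = (p./2).*2.+1 by rewrite -[LHS]odd_double_half p_odd.
have pt_odd : odd (p ^ t) by rewrite oddX p_odd orbT.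
have ptE : (p ^ t)%N = (((p ^ t)./2).*2.+1)%N by rewrite -[LHS]odd_double_half pt_odd.
have mE : (((p ^ t.+1).+1./2 + p./2) %/ p = (p ^ t).+1./2)%N.
  have -> : ((p ^ t.+1).+1./2 = (p ^ t)./2 * p + p./2.+1)%N.
    have -> : (p ^ t.+1 = ((p ^ t)./2 * p + p./2).*2.+1)%N.
      rewrite expnSr; move: ptE pE; move: (p ^ t)%N (p ^ t)%N./2 p./2 => X A B -> ->.
      by nia.
    by lia.
  rewrite -addnA divnMDl // (_ : (p./2.+1 + p./2 = p)%N); last by lia.
  by rewrite divnn p_gt0; lia.
rewrite (half_poch_factor p_odd half2 _ pE) mE big_ord_recr /= exprD.
rewrite [X in rdvd _ X]mulrC -[X in rdvd _ X]mul1r -mulrA.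
apply: rdvdM; last by apply: rdvdM => //; apply: rdvd_refl.
elim/big_rec: _ => [|k x _ IHx]; first exact: rdvd_refl.
rewrite -[X in rdvd _ X]mulr1; apply: rdvdM => //.
have [w wE] := padic_inv_exists (@prime_factor_ndvd _ p_pr (half + k%:R)).
by exists w.
Qed.

Lemma sum_half_exp t : ((\sum_(i < t) (p ^ i).+1./2) * 4 <= p ^ t + t.*2)%N.
Proof.
elim: t => [|t IHt]; first by rewrite big_ord0.
rewrite big_ord_recr /= expnS.
have : (3 * p ^ t <= p * p ^ t)%N by rewrite leq_mul2r p_gt2 orbT.
move: IHt; move: (\sum_(_ < t) _)%N (p * p ^ t)%N => S Y.
by move: (p ^ t)%N => X; lia.
Qed.

(** The sum bounds the valuation of the product of [half_poch_dvd] and grows like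
    [p^t / 4], whereas the precision of the Frobenius polynomial, on the right of
    the last inequality, is at least [p^t / 3]. For large [t] there is room
    between them for [r s], which bounds the valuation of the binomial
    coefficient and measures the distance of its index to the exponent;
    [E] is the precision wanted in the end. *)
Lemma precision_exists r E : (0 < r)%N -> exists t s,
  [/\ (r <= t)%N, (\sum_(i < t) (p ^ i).+1./2 + E <= r * s)%N &
      (r * s + E <= (p ^ r)./2 * p ^ (t - r))%N].
Proof.
(* With this [u], the slack of order [p^u] absorbs [E], [r] and the linear term
   of [sum_half_exp]. *)
move=> r_gt0; pose u := (8 * E + 6 * r)%N.
exists (r + u)%N; set v := (\sum_(i < _) _)%N.
exists ((v + E) %/ r).+1; rewrite leq_addr addKn; split=> //.
  by rewrite mulnC ltnW // ltn_ceil.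
have le_s : (r * ((v + E) %/ r).+1 <= v + E + r)%N.
  by rewrite mulnS mulnC addnC leq_add2r leq_trunc_div.
have := sum_half_exp (r + u); rewrite -/v expnD => le_v.
have pu : (3 * u <= p ^ u)%N.
  elim: (u) => [|k IHk]; first by rewrite muln0.
  rewrite expnS; have : (3 * p ^ k <= p * p ^ k)%N by rewrite leq_mul2r p_gt2 orbT.
  by have := ltn_expl k p_gt1; lia.
have q_ge : (3 <= p ^ r)%N by rewrite -(prednK r_gt0) expnS (leq_trans p_gt2) // leq_pmulr // expn_gt0 p_gt0.
have q_odd : odd (p ^ r) by rewrite oddX p_odd orbT.
have qE : (p ^ r)%N = (((p ^ r)./2).*2.+1)%N by rewrite -[LHS]odd_double_half q_odd.
move: le_v; rewrite qE; move: ((p ^ r)%N./2) qE q_ge => e qE q_ge.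
have e_gt0 : (0 < e)%N by lia.
have : ((p ^ u) <= e * p ^ u)%N by rewrite leq_pmull.
move: (p ^ u)%N pu => P; rewrite /u; nia.
Qed.

End Valuations.

(** * Digits and carries of a/(q-1) *)

Section Digits.
Variables p r a : nat.
Hypothesis p_odd : odd p.
Local Notation Q := (p ^ r).-1%N.
Hypothesis lt_aQ : (a < Q)%N.

Let Q_gt0 : (0 < Q)%N. Proof. exact: leq_ltn_trans lt_aQ. Qed.
Let p_gt0 : (0 < p)%N. Proof. exact: odd_gt0. Qed.

(** [a p^i / (q - 1)] has integer part [quo_pow i] and fractional part
    [rem_pow i / (q - 1)]. The [digit i] are the base [p] digits of [a], the most
    significant first, and [carry i] tells whether the fractional part exceeds
    1/2. *)
Definition quo_pow i := (a * p ^ i %/ Q)%N.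
Definition rem_pow i := (a * p ^ i %% Q)%N.
Definition digit i := (p * rem_pow i %/ Q)%N.
Definition carry i := (Q < (rem_pow i).*2)%N.

Lemma quo_rem_pow i : (a * p ^ i = quo_pow i * Q + rem_pow i)%N.
Proof. exact: divn_eq. Qed.

Lemma rem_pow_lt i : (rem_pow i < Q)%N.
Proof. by rewrite ltn_mod. Qed.

Lemma quo_powS i : quo_pow i.+1 = (p * quo_pow i + digit i)%N.
Proof.
rewrite {1}/quo_pow expnSr mulnA quo_rem_pow mulnDl mulnAC [(_ * p)%N]mulnC.
by rewrite divnMDl // [(rem_pow i * p)%N]mulnC.
Qed.

Lemma rem_powS i : (p * rem_pow i = digit i * Q + rem_pow i.+1)%N.
Proof.
rewrite /digit {1}(divn_eq (p * rem_pow i) Q); congr (_ + _)%N.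
by rewrite {1}/rem_pow modnMmr {1}/rem_pow expnS mulnCA.
Qed.

Lemma digit_lt i : (digit i < p)%N.
Proof. by rewrite ltn_divLR // ltn_pmul2l ?rem_pow_lt. Qed.

Lemma quo_pow0 : quo_pow 0 = 0%N.
Proof. by rewrite /quo_pow expn0 muln1 divn_small. Qed.

Lemma rem_pow0 : rem_pow 0 = a.
Proof. by rewrite /rem_pow expn0 muln1 modn_small. Qed.

Let arE : (a * p ^ r = a * Q + a)%N.
Proof. by rewrite -{1}(prednK (_ : 0 < p ^ r)%N) ?expn_gt0 ?p_gt0 // mulnS addnC. Qed.

Lemma quo_powr : quo_pow r = a.
Proof. by rewrite /quo_pow arE divnMDl // divn_small ?addn0. Qed.

Lemma rem_powr : rem_pow r = a.
Proof. by rewrite /rem_pow arE modnMDl modn_small. Qed.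

(** The fractional part exceeds 1/2 when its first digit exceeds [(p - 1) / 2],
    or is equal to it and the next fractional part exceeds 1/2. *)
Lemma carryE i : carry i = (p./2 < digit i + carry i.+1)%N.
Proof.
have pE : p = (p./2).*2.+1 by rewrite -[LHS]odd_double_half p_odd.
have := rem_powS i; have := rem_pow_lt i.+1; have := rem_pow_lt i; rewrite /carry.
move: (rem_pow i) (rem_pow i.+1) (digit i) Q_gt0 => x x' d; move: Q => q' q_gt0.
rewrite {1}pE; move: p./2 => h lt_x lt_x' xE.
case: (ltngtP d h) => dh.
- have -> : (h < d + (q' < x'.*2))%N = false by apply/negbTE; case: (q' < _)%N => /=; lia.
  by apply/negbTE; rewrite -leqNgt; nia.
- have -> : (h < d + (q' < x'.*2))%N by lia.
  by nia.
rewrite dh in xE *; case: (ltnP q' x'.*2) => hx /=; rewrite ?addn1 ?addn0 ?ltnSn ?ltnn.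
  by nia.
by apply/negbTE; rewrite -leqNgt; nia.
Qed.

Lemma prod_sign_digits (R : comNzRingType) : \prod_(i < r) ((-1) ^+ digit i : R) = (-1) ^+ a.
Proof.
suff H k : \prod_(i < k) ((-1) ^+ digit i : R) = (-1) ^+ quo_pow k by rewrite H quo_powr.
elim: k => [|k IHk]; first by rewrite big_ord0 quo_pow0.
by rewrite big_ord_recr /= IHk quo_powS exprD -[in RHS]signr_odd oddM p_odd signr_odd.
Qed.

End Digits.

Lemma prod_cycle (R : comNzRingType) (f : nat -> R) r : f r = f 0%N ->
  \prod_(i < r) f i.+1 = \prod_(i < r) f i.
Proof.
case: r => [|r] fr; first by rewrite !big_ord0.
by rewrite big_ord_recr big_ord_recl /= fr mulrC.
Qed.

(** * Gamma values along the digits of the exponent *)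

Section JacobiSumEvaluation.
Variables (p : nat) (p_pr : prime p).
Hypothesis p_odd : odd p.
Local Notation Zp := (padic_int p_pr).
Local Notation Gamma := (@padic_gamma p p_pr).
Variables r a : nat.
Hypothesis r_gt0 : (0 < r)%N.
Local Notation q := (p ^ r)%N.
Hypothesis lt_aQ : (a < q.-1)%N.
Variables half iq : Zp.
Hypothesis half2 : half * 2%:R = 1.
Hypothesis iqE : q.-1%:R * iq = 1.

Let p_gt0 : (0 < p)%N. Proof. exact: prime_gt0. Qed.
Let q_gt0 : (0 < q)%N. Proof. by rewrite expn_gt0 p_gt0. Qed.

(** The fractional part of [a p^i / (q - 1)] as a p-adic integer. *)
Definition rot_exp i : Zp := (rem_pow p r a i)%:R * iq.

Local Notation y := rot_exp.
Local Notation c := (carry p r a).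
Local Notation d := (digit p r a).

(** The digits of [a] repeated [s] times, followed by the first [i] of them:
    these numbers tend to [- rot_exp i]. *)
Definition approx s i : nat := (p ^ i * (a * \sum_(j < s) q ^ j) + quo_pow p r a i)%N.

Lemma approx0S s : approx s.+1 0 = approx s r.
Proof.
rewrite /approx quo_pow0 // quo_powr // expn0 mul1n addn0 big_ord_recl expn0.
by under eq_bigr do rewrite expnS; rewrite -big_distrr /= mulnDr muln1 addnC mulnCA.
Qed.

Lemma approxS s i : approx s i.+1 = (p * approx s i + d i)%N.
Proof. by rewrite /approx quo_powS // expnS -mulnA addnA -mulnDr. Qed.

Lemma rot_expE i : p%:R ^+ i * y 0 = (quo_pow p r a i)%:R + y i.
Proof.
rewrite /rot_exp rem_pow0 // mulrA -natrX -natrM mulnC (quo_rem_pow p r a i) natrD natrM mulrDl.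
by rewrite -mulrA iqE mulr1.
Qed.

Lemma approx_cong s i : rdvd (p%:R ^+ (r * s)) ((approx s i)%:R + y i).
Proof.
have s0 : a%:R * (\sum_(j < s) q ^ j)%:R + y 0 = p%:R ^+ (r * s) * y 0.
  have geo : q.-1%:R * (\sum_(j < s) q ^ j)%:R = p%:R ^+ (r * s) - 1 :> Zp.
    have -> : q.-1%:R = p%:R ^+ r - 1 :> Zp.
      by rewrite -natrX -{2}(prednK q_gt0) -natr1 addrK.
    rewrite exprM [RHS]subrX1 natr_sum; congr (_ * _).
    by apply: eq_bigr => j _; rewrite !natrX.
  have -> : p%:R ^+ (r * s) = q.-1%:R * (\sum_(j < s) q ^ j)%:R + 1 :> Zp by rewrite geo subrK.
  rewrite mulrDl mul1r {2}/rot_exp rem_pow0 //; congr (_ + _).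
  by rewrite -[LHS]mul1r -[X in X * _ = _]iqE; ring.
exists (p%:R ^+ i * y 0).
rewrite mulrCA -s0 mulrDr rot_expE /approx natrD natrM natrX natrM; ring.
Qed.

Definition gamma_den i : Zp := Gamma (1 - y i) * Gamma half.
Definition gamma_num i : Zp := - ((-1) ^+ c i * Gamma (half - y i + (c i)%:R)).

Definition gamma_den_approx s i : Zp := Gamma ((approx s i)%:R + 1) * Gamma half.
Definition gamma_num_approx s i : Zp :=
  - ((-1) ^+ c i * Gamma (half + (approx s i)%:R + (c i)%:R)).

Lemma gamma_den_cong s i : rdvd (p%:R ^+ (r * s)) (gamma_den_approx s i - gamma_den i).
Proof.
rewrite -mulrBl; apply/rdvdMr/padic_gamma_cong => //.
by have := approx_cong s i; congr rdvd; ring.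
Qed.

Lemma gamma_num_cong s i : rdvd (p%:R ^+ (r * s)) (gamma_num_approx s i - gamma_num i).
Proof.
have h : rdvd (p%:R ^+ (r * s)) (half + (approx s i)%:R + (c i)%:R - (half - y i + (c i)%:R)).
  by have := approx_cong s i; congr rdvd; ring.
have [z zE] := padic_gamma_cong p_odd h.
exists (- (-1) ^+ c i * z); rewrite mulrCA -zE /gamma_num_approx /gamma_num; ring.
Qed.

(** This is [half_bin_carry_step] for each of the [r] digits of [a]. The carry
    after the last digit is the one before the first, so that the correcting
    factors are of the same kind at both ends. *)
Lemma approx_chain s :
  half_bin_carry half (approx s.+1 0) (c 0) * \prod_(i < r) gamma_den_approx s i.+1
  = half_bin_carry half (approx s 0) (c 0) *
    ((\prod_(i < r) p%:R ^+ c i) * \prod_(i < r) gamma_num_approx s i.+1).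
Proof.
have cr : c r = c 0 by rewrite /carry rem_powr // rem_pow0.
suff H k : half_bin_carry half (approx s k) (c k) * \prod_(i < k) gamma_den_approx s i.+1
  = half_bin_carry half (approx s 0) (c 0) *
    ((\prod_(i < k) p%:R ^+ c i) * \prod_(i < k) gamma_num_approx s i.+1).
  by rewrite approx0S -[in LHS]cr H.
elim: k => [|k IHk]; first by rewrite !big_ord0 !mulr1.
rewrite !big_ord_recr /=.
have pE : p = (p./2).*2.+1 by rewrite -[LHS]odd_double_half p_odd.
have := half_bin_carry_step p_odd half2 (approx s k) (c k.+1) pE (digit_lt p_odd lt_aQ k).
rewrite -approxS -carryE // -/(gamma_den_approx s k.+1) => step.
rewrite -/(gamma_num_approx s k.+1) in step.
transitivity ((half_bin_carry half (approx s k.+1) (c k.+1) * gamma_den_approx s k.+1) *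
  \prod_(i < k) gamma_den_approx s i.+1); first by ring.
rewrite step.
transitivity (p%:R ^+ c k * gamma_num_approx s k.+1 *
  (half_bin_carry half (approx s k) (c k) * \prod_(i < k) gamma_den_approx s i.+1)); first by ring.
by rewrite IHk; ring.
Qed.

(** The reflection formula at the natural numbers [approx s i.+1], whose sign
    depends on their last digit [digit i] only, as [p - 1] is even. *)
Lemma rot_exp_reflection i :
  Gamma (y i.+1) * Gamma (1 - y i.+1) = - (-1) ^+ d i.
Proof.
apply/eqP; rewrite -subr_eq0; apply/eqP/padic_separated => s.
suff h : rdvd (p%:R ^+ (r * s)) (Gamma (y i.+1) * Gamma (1 - y i.+1) - - (-1) ^+ d i).
  by apply: rdvd_trans h; apply: rdvd_exp; rewrite leq_pmull.
pose n := approx s i.+1.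
have -> : - (-1) ^+ d i = Gamma (- n%:R) * Gamma (n%:R + 1) :> Zp.
  rewrite padic_gamma_reflection // /n approxS exprS mulN1r; congr (- _).
  rewrite mulnC divnMDl // divn_small ?(digit_lt p_odd lt_aQ) // addn0.
  have p1_even : odd p.-1 = false by apply: negbTE; rewrite -oddS prednK.
  have -> : (approx s i * p + d i - approx s i = approx s i * p.-1 + d i)%N.
    by rewrite -[X in (_ * X + _ - _)%N](prednK p_gt0) mulnS -addnA addKn.
  by rewrite -[LHS]signr_odd -[RHS]signr_odd oddD oddM p1_even andbF.
have h := approx_cong s i.+1; rewrite -/n in h.
have [z1 e1] : rdvd (p%:R ^+ (r * s)) (Gamma (y i.+1) - Gamma (- n%:R)).
  by apply: padic_gamma_cong => //; have := h; congr rdvd; ring.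
have [z2 e2] : rdvd (p%:R ^+ (r * s)) (Gamma (n%:R + 1) - Gamma (1 - y i.+1)).
  by apply: padic_gamma_cong => //; have := h; congr rdvd; ring.
exists (z1 * Gamma (1 - y i.+1) - Gamma (- n%:R) * z2).
by rewrite mulrBr mulrA -e1 [_ * (Gamma _ * _)]mulrCA -e2; ring.
Qed.

End JacobiSumEvaluation.

(** * Evaluation of the Jacobi sums *)

(** [p] divides the inner binomial coefficients of exponent [p ^ r]. *)
Lemma frobenius_lift_poly (R : comNzRingType) p r : prime p -> odd p -> (0 < r)%N ->
  exists G : {poly R}, [/\ G`_0 = 0, (size G <= p ^ r)%N &
    1 - 'X^(p ^ r) = (1 - 'X) ^+ (p ^ r) + p%:R *: G].
Proof.
move=> p_pr p_odd r_gt0; set q := (p ^ r)%N.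
have q_odd : odd q by rewrite oddX p_odd orbT.
have dvd_bin i : (0 < i < q)%N -> (p %| 'C(q, i))%N.
  case: i => // i /andP[_ lt_iq]; rewrite -[(p %| _)%N]negbK -prime_coprime //.
  apply/negP => co; have := mul_bin_diag q i; rewrite -/q => binE.
  have : (q %| i.+1)%N.
    by rewrite -(@Gauss_dvdl q _ 'C(q, i.+1)) ?coprimeXl // -binE dvdn_mulr.
  by move=> /(dvdn_leq (ltn0Sn i)); rewrite leqNgt lt_iq.
pose G : {poly R} := \poly_(i < q) (if i == 0%N then 0 else - (-1) ^+ i * ('C(q, i) %/ p)%:R).
exists G; split; [by rewrite coef_poly; case: ifP | exact: size_poly |].
apply/polyP => k; rewrite coefB coefD coef1 coefXn coefZ coef_poly.
have -> : ((1 - 'X) ^+ q : {poly R})`_k = (-1) ^+ k * 'C(q, k)%:R.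
  rewrite exprDn coef_sum.
  under eq_bigr => i _ do rewrite expr1n mul1r exprNn coefMn -signr_odd -polyC1 -polyCN -polyC_exp coefCM coefXn.
  case: (ltnP k q.+1) => [lt_kq|lt_qk].
    rewrite (bigD1 (Ordinal lt_kq)) //= eqxx mulr1 big1 ?addr0.
      by rewrite signr_odd mulr_natr.
    move=> i; rewrite -(inj_eq val_inj) /= eq_sym => /negPf ->.
    by rewrite mulr0 mul0rn.
  rewrite bin_small // mulr0 big1 // => i _.
  by rewrite gtn_eqF ?mulr0 ?mul0rn // (leq_trans (ltn_ord i)).
have [-> | k0] := eqVneq k 0%N.
  by rewrite (odd_gt0 q_odd) /= ltn_eqF ?odd_gt0 // expr0 bin0 /=; ring.
case: (ltngtP k q) => [lt_kq|lt_qk|->].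
- have /divnK CE : (p %| 'C(q, k))%N by apply: dvd_bin; rewrite lt0n k0.
  by rewrite -{1}CE natrM /=; ring.
- by rewrite bin_small //=; ring.
by rewrite binn -signr_odd q_odd /=; ring.
Qed.

Section JacobiSumFormula.
Variables (p : nat) (p_pr : prime p) (K : fieldExtType (padic_num p_pr)).
Variable F : finFieldType.
Local Notation Zp := (padic_int p_pr).
Local Notation Zq := (integer_ring K).
Variable res : {rmorphism Zq -> F}.
Hypothesis hres : unramified_residue_map res.
Hypothesis p_odd : odd p.
Variables r a : nat.
Hypothesis r_gt0 : (0 < r)%N.
Hypothesis cardF : #|F| = (p ^ r)%N.
Local Notation q := (p ^ r)%N.
Hypothesis lt_aQ : (a < q.-1)%N.
Variables half iq : Zp.
Hypothesis half2 : half * 2%:R = 1.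
Hypothesis iqE : q.-1%:R * iq = 1.

Local Notation inq := (padic_inq K).
Local Notation Gamma := (@padic_gamma p p_pr).
Local Notation J := (jacobi_sum res a).
Local Notation y := (rot_exp r a iq).
Local Notation c := (carry p r a).

Let q_odd : odd q. Proof. by rewrite oddX p_odd orbT. Qed.
Let qE : q = (q./2).*2.+1. Proof. by rewrite -[LHS]odd_double_half q_odd. Qed.

Lemma twist_det_half_poch m : twist_det m (inq half) = inq (half_poch half m).
Proof.
rewrite /twist_det /bidiag_det /half_poch big_nat_rev rmorph_prod.
apply: eq_big_nat => i /andP[_ lt_im]; rewrite add0n /flip_diag rmorphD rmorph_nat.
have -> : m%:R = (m - i.+1)%:R + (i%:R + inq half * 2%:R) :> Zq.
  by rewrite -[2%:R](rmorph_nat inq) -rmorphM half2 rmorph1 natr1 -natrD subnK.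
by ring.
Qed.

Lemma half_bin_inq n : half_bin (inq half) n = inq (half_bin half n).
Proof. by rewrite /half_bin rmorphM rmorphXn rmorph_nat. Qed.

Lemma rdvd_inq x z : rdvd x z -> rdvd (inq x) (inq z).
Proof. by move=> [t ->]; exists (inq t); rewrite rmorphM. Qed.

Lemma approx_bound s : ((approx p r a s 0).*2 < p ^ (r * s).+1)%N.
Proof.
rewrite /approx expn0 mul1n quo_pow0 // addn0 expnS expnM.
have := predn_exp q s; have : (0 < q ^ s)%N by rewrite !expn_gt0 prime_gt0.
move: (\sum_(j < s) q ^ j)%N (q ^ s)%N lt_aQ (odd_prime_gt2 p_odd p_pr) => S P.
move: (q.-1) => Q lt_a p_gt2 P_gt0 PE.
have : (a * S <= Q * S)%N by rewrite leq_mul2r ltnW ?orbT.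
have : (3 * P <= p * P)%N by rewrite leq_mul2r p_gt2 orbT.
move: (a * S)%N (p * P)%N PE => X Y; lia.
Qed.

Lemma frobenius_half_bin_jacobi t s : (r <= t)%N -> (r * s <= q./2 * p ^ (t - r))%N ->
  exists z z', let b n := inq (half_bin half n) in
    let det := inq (half_poch half (p ^ t).+1./2) in
    b (approx p r a s 0) * (det * J) + det * b (approx p r a s.+1 0)
    = det * (p%:R ^+ (q./2 * p ^ (t - r)) * z)
      + b (approx p r a s 0) * (p%:R ^+ (r * s) * z').
Proof.
move=> le_rt le_sN.
have [G [G0 sizeG GE]] := frobenius_lift_poly Zq p_pr p_odd r_gt0.
have half2' : inq half * 2%:R = 1 by rewrite -[2%:R](rmorph_nat inq) -rmorphM half2 rmorph1.
have iqE' : q.-1%:R * inq iq = 1 by rewrite -[q.-1%:R](rmorph_nat inq) -rmorphM iqE rmorph1.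
have alphaE' : q.-1%:R * inq (y 0) = a%:R.
  by rewrite /rot_exp rem_pow0 // rmorphM rmorph_nat mulrCA iqE' mulr1.
have lt_aq : (a < q)%N by rewrite (leq_trans lt_aQ) // leq_pred.
have pt_odd : odd (p ^ t) by rewrite oddX p_odd orbT.
have ptE : (p ^ t)%N = (((p ^ t)./2).*2.+1)%N by rewrite -[LHS]odd_double_half pt_odd.
have N_gt0 : (0 < q./2 * p ^ (t - r))%N.
  rewrite muln_gt0 expn_gt0 (prime_gt0 p_pr) andbT.
  by have := card_finField_gt1 F; rewrite cardF; lia.
have leNE : (q * (q./2 * p ^ (t - r)) <= q./2 * ((p ^ t)./2).*2.+1)%N.
  by rewrite -ptE mulnCA -expnD subnKC.
have cardFe : #|F| = (q./2).*2.+1 by rewrite cardF.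
have JE k (h : {poly Zq}) : h`_0 = 1 -> (size h <= (q./2 * k.*2.+1).+1)%N -> h.[1] = 0 ->
  (forall M, pcong p%:R M h ((1 - 'X) ^+ (q./2 * k.*2.+1))) ->
  (forall M, pcong (p%:R ^+ (q./2 * p ^ (t - r))) M (h ^+ 2) (geom Zq q ^+ k.*2.+1)) ->
  rdvd (p%:R ^+ (q./2 * p ^ (t - r)))
     (q.-1%:R * (\sum_(i < k.+1) h`_(q.-1 * i + a)) - J).
  move=> _ sz h1 hp hE; have := jacobi_sum_cong hres r_gt0 cardF cardFe N_gt0 _ sz h1 hp.
  by rewrite cardF; apply.
have [z0 z0E] := approx_cong lt_aQ iqE s 0.
have alphaN : inq (y 0) + (approx p r a s 0)%:R = p%:R ^+ (r * s) * inq z0.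
  by rewrite -[(approx _ _ _ _ _)%:R](rmorph_nat inq) -rmorphD addrC z0E rmorphM rmorphXn rmorph_nat.
have [z [z' E]] := frobenius_half_bin half2' (@integer_natr_reg p p_pr K) iqE' alphaE' qE lt_aq
  G0 sizeG GE N_gt0 leNE JE le_sN alphaN.
exists z, z'; move: E; rewrite twist_det_half_poch !half_bin_inq /=.
rewrite (_ : (q * approx p r a s 0 + a)%N = approx p r a s.+1 0); last first.
  by rewrite approx0S // /approx quo_powr // quo_pow0 // expn0 mul1n addn0.
by rewrite (_ : (p ^ t)./2.+1 = (p ^ t).+1./2)%N //; lia.
Qed.

Local Notation den := (\prod_(i < r) gamma_den r a half iq i.+1).
Local Notation num := ((\prod_(i < r) p%:R ^+ c i) * \prod_(i < r) gamma_num r a half iq i.+1).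

Lemma approx_limit s : exists w1 w2 : Zp,
  let x i := (half + (approx p r a i 0)%:R) ^+ c 0 in
  (half - y 0) ^+ c 0 * den
    = x s.+1 * (\prod_(i < r) gamma_den_approx r a half s i.+1) + p%:R ^+ (r * s) * w1 /\
  (half - y 0) ^+ c 0 * num
    = x s * ((\prod_(i < r) p%:R ^+ c i) * \prod_(i < r) gamma_num_approx r a half s i.+1)
      + p%:R ^+ (r * s) * w2.
Proof.
have xE i : (s <= i)%N -> rdvd (p%:R ^+ (r * s)) ((half - y 0) ^+ c 0 - (half + (approx p r a i 0)%:R) ^+ c 0).
  move=> le_si; apply: rdvd_subX.
  suff : rdvd (p%:R ^+ (r * s)) ((approx p r a i 0)%:R + y 0).
    by move/rdvdN; congr rdvd; ring.
  by apply: rdvd_trans (approx_cong lt_aQ iqE i 0); apply: rdvd_exp; rewrite leq_mul2l le_si orbT.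
have denE : rdvd (p%:R ^+ (r * s)) (den - \prod_(i < r) gamma_den_approx r a half s i.+1).
  apply: rdvd_prod_sub => i _; rewrite -opprB; apply: rdvdN.
  exact: (gamma_den_cong p_odd lt_aQ half iqE).
have numE : rdvd (p%:R ^+ (r * s)) (num - (\prod_(i < r) p%:R ^+ c i) * \prod_(i < r) gamma_num_approx r a half s i.+1).
  rewrite -mulrBr; apply/rdvdMl/rdvd_prod_sub => i _; rewrite -opprB; apply: rdvdN.
  exact: (gamma_num_cong p_odd lt_aQ half iqE).
have [w1 w1E] := rdvd_congM (xE s.+1 (leqnSn s)) denE.
have [w2 w2E] := rdvd_congM (xE s (leqnn s)) numE.
by exists w1, w2; rewrite -w1E -w2E; split; ring.
Qed.

(** The limit for [s] tending to infinity of [frobenius_half_bin_jacobi] combined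
    with [approx_chain]. The factors [half_bin] and [half_poch] to be cancelled
    are not units, but their valuations are bounded, and [precision_exists] leaves
    an arbitrary power [p^E] after the cancellation. The correcting factor
    [(1/2 - y 0) ^ c 0] is cancelled as well; it is nonzero since
    [y 0 = a / (q - 1)] is not 1/2 when there is a carry. *)
Lemma jacobi_sum_limit : J * inq den = - inq num.
Proof.
have Z0 : (half - y 0) ^+ c 0 != 0.
  rewrite /carry rem_pow0 //; case: ltnP => [lt_Qa|_]; last by rewrite expr0 oner_eq0.
  rewrite expr1 /rot_exp rem_pow0 //; apply/eqP => hy.
  have : q.-1%:R = a.*2%:R :> Zp.
    rewrite -muln2 natrM; move/eqP: hy; rewrite subr_eq0 => /eqP hy.
    transitivity (half * 2%:R * q.-1%:R); first by rewrite half2 mul1r.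
    by rewrite hy; transitivity (a%:R * 2%:R * (q.-1%:R * iq)); [ring | rewrite iqE mulr1].
  move/eqP; rewrite eq_sym -subr_eq0 -natrB 1?ltnW // => /eqP aQ.
  by have := @padic_natr_neq0 p p_pr (a.*2 - q.-1); rewrite subn_gt0 lt_Qa aQ eqxx => /(_ isT).
suff XE : inq ((half - y 0) ^+ c 0) * (J * inq den + inq num) = 0.
  apply/eqP; rewrite -subr_eq0 opprK; apply/eqP.
  apply: (@integer_mulI _ _ K (inq ((half - y 0) ^+ c 0))); last by rewrite XE mulr0.
  apply: contraNneq Z0 => Z0; apply/eqP/(@padic_in_inj p p_pr K).
  by rewrite rmorph0 -integer_val_padic Z0 rmorph0.
apply: (integer_separated hres) => E.
(* [b'] and [d'] below complete [half_bin] and [half_poch] to powers of [p]. *)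
have [t [s [le_rt le_vM le_MN]]] := precision_exists p_pr p_odd E r_gt0.
have [z [z' eqJ]] := frobenius_half_bin_jacobi le_rt (leq_trans (leq_addr _ _) le_MN).
cbv beta zeta in eqJ.
have [w1 [w2 /= [eqZU eqZV]]] := approx_limit s.
have chain := approx_chain p_odd lt_aQ half2 s.
have [b' bb'] := rdvd_inq (half_bin_dvd p_odd half2 (approx_bound s)).
have [d' dd'] := rdvd_inq (half_poch_dvd p_odd t half2).
rewrite !rmorphXn !rmorph_nat in bb' dd'.
set v := (\sum_(i < t) _)%N in le_vM dd'; set N := (_ * p ^ (t - r))%N in le_MN eqJ.
have [pM [pN [pME pNE]]] : exists pM pN : Zq,
    p%:R ^+ (r * s) = p%:R ^+ v * p%:R ^+ E * pM /\
    p%:R ^+ N = p%:R ^+ (r * s) * p%:R ^+ E * pN.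
  exists (p%:R ^+ (r * s - (v + E))), (p%:R ^+ (N - (r * s + E))).
  by rewrite -!exprD !subnKC.
pose x i : Zp := (half + (approx p r a i 0)%:R) ^+ c 0.
pose Us : Zp := \prod_(i < r) gamma_den_approx r a half s i.+1.
pose Vs : Zp := (\prod_(i < r) p%:R ^+ c i) * \prod_(i < r) gamma_num_approx r a half s i.+1.
exists (inq (x s.+1 * Us) * (b' * pN * z + d' * pM * z')
        + p%:R ^+ v * pM * (J * inq w1 + inq w2)).
apply: (@integer_mulI _ _ K (p%:R ^+ (r * s) * p%:R ^+ v)).
  by rewrite -exprD; apply: integer_pexp_neq0.
have -> : inq ((half - y 0) ^+ c 0) * (J * inq den + inq num) =
    J * (inq (x s.+1 * Us) + p%:R ^+ (r * s) * inq w1) + (inq (x s * Vs) + p%:R ^+ (r * s) * inq w2).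
  have pE : p%:R ^+ (r * s) = inq (p%:R ^+ (r * s)) by rewrite rmorphXn rmorph_nat.
  by rewrite pE -!rmorphM -!rmorphD -eqZU -eqZV !rmorphM; ring.
rewrite /half_bin_carry -/(x s) -/(x s.+1) -/Us -/Vs in chain.
have {}chain : inq (half_bin half (approx p r a s.+1 0)) * inq (x s.+1 * Us)
    = inq (half_bin half (approx p r a s 0)) * inq (x s * Vs).
  by rewrite -!rmorphM mulrA chain mulrA.
move: eqJ chain bb' dd' pME pNE.
move: (inq (half_bin half (approx p r a s 0))) (inq (half_bin half (approx p r a s.+1 0))).
move: (inq (half_poch half (p ^ t).+1./2)) (inq (x s.+1 * Us)) (inq (x s * Vs)).
move: (p%:R ^+ (r * s)) (p%:R ^+ v) (p%:R ^+ E) (p%:R ^+ N) (inq w1) (inq w2).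
move=> M V PE PN W1 W2 D XU XV b bS eqJ chain bb' dd' pME pNE.
transitivity (XU * (b' * d') * (b * (D * J) + D * bS)
   + d' * D * b' * (b * XV - bS * XU) + (b' * b) * (d' * D) * (M * (J * W1 + W2))).
  rewrite bb' dd'; ring.
rewrite -chain eqJ subrr.
transitivity (XU * ((d' * D) * b' * PN * z + (b' * b) * d' * M * z')
   + (b' * b) * (d' * D) * (M * (J * W1 + W2))); first by ring.
rewrite [d' * D]mulrC [b' * b]mulrC -bb' -dd' pNE pME.
ring.
Qed.

(** The formula of Gross and Koblitz for these sums: in [jacobi_sum_limit], the
    reflection formula turns the denominators [Gamma (1 - y i)] into
    numerators, and the indices are rotated by one place. *)
Theorem jacobi_sum_formula :
  (-1) ^+ a * J * inq (Gamma half ^+ r) =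
  - inq (\prod_(i < r) ((- p%:R) ^+ c i * Gamma (half - y i + (c i)%:R) * Gamma (y i))).
Proof.
have yr : y r = y 0 by rewrite /rot_exp rem_powr // rem_pow0.
have cr : c r = c 0 by rewrite /carry rem_powr // rem_pow0.
have prodE (x : Zp) : x ^+ r = \prod_(i < r) x by rewrite prodr_const card_ord.
have denE : den * \prod_(i < r) Gamma (y i.+1) = (-1) ^+ r * (-1) ^+ a * Gamma half ^+ r.
  rewrite -big_split /= -(prod_sign_digits p_odd lt_aQ) !prodE -!big_split; apply: eq_bigr => i _ /=.
  transitivity (Gamma half * (Gamma (y i.+1) * Gamma (1 - y i.+1))).
    by rewrite /gamma_den; ring.
  by rewrite (rot_exp_reflection p_odd r_gt0 lt_aQ iqE); ring.
have numE : num * \prod_(i < r) Gamma (y i.+1) = (-1) ^+ r *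
    \prod_(i < r) ((- p%:R) ^+ c i * Gamma (half - y i + (c i)%:R) * Gamma (y i)).
  rewrite (prod_cycle (f := gamma_num r a half iq)); last by rewrite /gamma_num yr cr.
  rewrite (prod_cycle (f := fun i => Gamma (y i))) ?yr //.
  rewrite prodE -!big_split; apply: eq_bigr => i _ /=.
  rewrite /gamma_num -[- p%:R]mulN1r exprMn; ring.
have := congr1 (fun x => x * inq (\prod_(i < r) Gamma (y i.+1))) jacobi_sum_limit.
rewrite -mulrA mulNr -!rmorphM denE numE !rmorphM !rmorphXn !rmorphN1 => E.
apply: (@integer_mulI _ _ K ((-1) ^+ r)); first by rewrite signr_eq0.
by rewrite mulrN -E; ring.
Qed.

End JacobiSumFormula.

(** * Gamma values and floors at the rational arguments *)

Section RationalGamma.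
Variables (p : nat) (p_pr : prime p) (K : fieldExtType (padic_num p_pr)).
Hypothesis p_odd : odd p.
Local Notation Zp := (padic_int p_pr).
Local Notation Gamma := (@padic_gamma p p_pr).

Lemma padic_ratr (x : rat) (n : int) (D : nat) : ~~ (p %| D)%N ->
  x * D%:R = n%:~R -> D%:R * ratr x = n%:~R :> Zp.
Proof.
move=> ndD xE; have numE : numq x * D%:Z = n * denq x.
  apply/eqP; rewrite -(eqr_int rat) !rmorphM /= -xE mulrAC; apply/eqP.
  by rewrite -{2}(divq_num_den x) mulrVK // unitfE intr_eq0 denq_neq0.
have denE : (`|denq x|%N)%:Z = denq x by rewrite absz_denq.
have dvd_den : (`|denq x| %| D)%N.
  rewrite -(@Gauss_dvdr _ `|numq x|) ?(coprime_sym _ `|numq x|) ?coprime_num_den //.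
  have := congr1 absz numE; rewrite !abszM absz_nat => ->; exact: dvdn_mull.
have [|w wE] := @padic_nat_inv_exists p p_pr `|denq x|.
  by apply: contra ndD => /dvdn_trans; apply.
have denU : (denq x)%:~R \is a @GRing.unit Zp.
  by rewrite -denE -pmulrn; apply/unitrP; exists w; rewrite mulrC wE.
apply: (mulrI denU); rewrite /ratr mulrCA [_ * (_ / _)]mulrC mulrVK //.
by rewrite mulrC pmulrn -!intrM numE mulrC.
Qed.

Lemma padic_gamma_neq0 (x : Zp) : Gamma x != 0.
Proof.
apply/eqP => g0; have [n xn] := padic_nat_dense x 1.
have := padic_gammaP p_odd xn; rewrite g0 sub0r expr1 => /rdvdN; rewrite opprK.
elim: n {xn} => [|n IHn].
  rewrite gamma_natE big_geq // expr0 mulr1 => d1.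
  by have /(rdvd_nat p_pr) : rdvd (p%:R : Zp) 1%:R by []; rewrite dvdn1 gtn_eqF // prime_gt1.
rewrite gamma_natS mulNr => /rdvdN; rewrite opprK -[p%:R]expr1.
move=> /(padic_cancel (@prime_factor_ndvd _ p_pr _)); rewrite expr1; exact: IHn.
Qed.

Lemma gammaQ0 : gammaQ K 0 = 1.
Proof. by rewrite /gammaQ (ratr_nat _ 0) padic_gamma0 // rmorph1. Qed.

End RationalGamma.

Lemma frac_part_eq (x f : rat) (n : int) : x = n%:~R + f -> 0 <= f < 1 -> frac_part x = f.
Proof.
move=> xE fP; rewrite /frac_part (@floor_def _ _ n); first by rewrite xE addrC addKr.
by rewrite intrD xE lerDl ltrD2l.
Qed.

Lemma floor_eq_add (x f : rat) (n : int) : x = n%:~R + f -> 0 <= f < 1 -> Num.floor x = n.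
Proof. by move=> xE fP; apply: floor_def; rewrite intrD xE lerDl ltrD2l. Qed.

Section GaussSumTerm.
Variables (p : nat) (p_pr : prime p) (K : fieldExtType (padic_num p_pr)).
Hypothesis p_odd : odd p.
Variables r a : nat.
Local Notation Q := (p ^ r).-1%N.
Hypothesis r_gt0 : (0 < r)%N.
Hypothesis lt_aQ : (a < Q)%N.
Variables half iq : padic_int p_pr.
Hypothesis half2 : half * 2%:R = 1.
Hypothesis iqE : Q%:R * iq = 1.

Local Notation Gamma := (@padic_gamma p p_pr).
Local Notation z := (a%:R / Q%:R : rat).
Local Notation c := (carry p r a).
Local Notation f i := ((rem_pow p r a i)%:R / Q%:R : rat).

Let Q_gt0 : (0 < Q)%N. Proof. exact: leq_ltn_trans lt_aQ. Qed.
Let Q0 : Q%:R != 0 :> rat. Proof. by rewrite pnatr_eq0 -lt0n. Qed.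

Lemma exponent_pow i : z * p%:R ^+ i = (quo_pow p r a i)%:Z%:~R + f i.
Proof.
rewrite mulrAC -natrX -natrM (quo_rem_pow p r a i) natrD natrM mulrDl mulfK //.
Qed.

Lemma frac_exponent_bound i : 0 <= f i < 1.
Proof.
rewrite divr_ge0 ?ler0n //= ltr_pdivrMr ?ltr0n // mul1r ltr_nat.
exact: (rem_pow_lt lt_aQ).
Qed.

Lemma half_pow i : 2%:R^-1 * p%:R ^+ i = ((p ^ i)./2)%:Z%:~R + 2%:R^-1 :> rat.
Proof.
have pi_odd : odd (p ^ i) by rewrite oddX p_odd orbT.
have piE : (p ^ i)%N = (((p ^ i)./2).*2.+1)%N by rewrite -[LHS]odd_double_half pi_odd.
have -> : p%:R ^+ i = ((p ^ i)./2)%:R * 2%:R + 1 :> rat.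
  by rewrite -natrX -natrM muln2 natr1 -piE.
by rewrite -pmulrn; field.
Qed.

(** [c i] is the correction that brings [1/2 - f i] back to the unit
    interval. *)
Lemma carry_bound i : 0 <= 2%:R^-1 - f i + (c i)%:R < 1.
Proof.
have /andP[f0 f1] := frac_exponent_bound i.
have fQ : f i * Q%:R = (rem_pow p r a i)%:R by rewrite mulfVK.
have Qpos : 0 < Q%:R :> rat by rewrite ltr0n.
rewrite /carry; case: ltnP => [lt_Q|le_Q].
  have : Q%:R < f i * Q%:R * 2%:R by rewrite fQ -natrM ltr_nat muln2.
  rewrite mulrAC -{1}[Q%:R]mul1r ltr_pM2r //= => h.
  by apply/andP; split; lra.
have : f i * Q%:R * 2%:R <= Q%:R by rewrite fQ -natrM ler_nat muln2.
rewrite mulrAC -{3}[Q%:R]mul1r ler_pM2r //= => h.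
by apply/andP; split; lra.
Qed.

Let np : ~~ (p %| 2 * Q)%N.
Proof.
rewrite Euclid_dvdM // negb_or; apply/andP; split.
  by rewrite gtnNdvd // odd_prime_gt2.
apply/negP => dv; have : (p %| p ^ r)%N by rewrite -(prednK r_gt0) expnS dvdn_mulr.
rewrite -(prednK (_ : 0 < p ^ r)%N) ?expn_gt0 ?prime_gt0 // -addn1 dvdn_addr //.
by rewrite dvdn1 gtn_eqF // prime_gt1.
Qed.

Lemma natr_2Q_inj (x y : padic_int p_pr) : (2 * Q)%:R * x = (2 * Q)%:R * y -> x = y.
Proof. by apply: mulfI; apply: padic_natr_neq0; rewrite muln_gt0. Qed.

Lemma gammaQ_frac_half i : gammaQ K (frac_part (2%:R^-1 * p%:R ^+ i)) = padic_in K (Gamma half).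
Proof.
rewrite (frac_part_eq (half_pow i)) //; congr (padic_in K (Gamma _)).
apply: natr_2Q_inj; rewrite (@padic_ratr p p_pr _ Q%:Z) //.
  rewrite -pmulrn natrM; transitivity (half * 2%:R * Q%:R); first by rewrite half2 mul1r.
  by ring.
by rewrite natrM mulrA mulVf // mul1r.
Qed.

Lemma gammaQ_frac_exponent i :
  gammaQ K (frac_part (z * p%:R ^+ i)) = padic_in K (Gamma (rot_exp r a iq i)).
Proof.
rewrite (frac_part_eq (exponent_pow i)) ?frac_exponent_bound //.
congr (padic_in K (Gamma _)); apply: natr_2Q_inj.
rewrite (@padic_ratr p p_pr _ (2 * rem_pow p r a i)%N%:Z) //.
  rewrite -pmulrn /rot_exp !natrM.
  by transitivity (2%:R * (rem_pow p r a i)%:R * (Q%:R * iq)); [rewrite iqE mulr1 | ring].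
by rewrite -pmulrn !natrM mulrA mulrAC mulfVK // mulrC.
Qed.

Lemma gammaQ_frac_half_exponent i :
  gammaQ K (frac_part ((2%:R^-1 - z) * p%:R ^+ i))
  = padic_in K (Gamma (half - rot_exp r a iq i + (c i)%:R)).
Proof.
have xE : (2%:R^-1 - z) * p%:R ^+ i = (((p ^ i)./2)%:Z - (quo_pow p r a i)%:Z - (c i)%:Z)%:~R
    + (2%:R^-1 - f i + (c i)%:R).
  by rewrite mulrBl half_pow exponent_pow !intrB -!pmulrn; ring.
rewrite (frac_part_eq xE) ?carry_bound //; congr (padic_in K (Gamma _)); apply: natr_2Q_inj.
rewrite (@padic_ratr p p_pr _ (Q%:Z - (2 * rem_pow p r a i)%N%:Z + (2 * Q * c i)%N%:Z)) //.
  rewrite intrD intrB -!pmulrn /rot_exp !natrM.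
  transitivity ((half * 2%:R) * Q%:R - 2%:R * (rem_pow p r a i)%:R * (Q%:R * iq)
     + 2%:R * Q%:R * (c i)%:R); first by rewrite half2 iqE; ring.
  by ring.
rewrite intrD intrB -!pmulrn !natrM.
by move: Q0; move: (Q%:R : rat) => q' q0; field.
Qed.

Lemma floor_half_exponent i :
  Num.floor (frac_part (2%:R^-1 * p%:R ^+ i) - z * p%:R ^+ i) = - (quo_pow p r a i)%:Z - (c i)%:Z.
Proof.
rewrite (frac_part_eq (half_pow i)) //.
apply: (floor_eq_add _ (carry_bound i)).
by rewrite exponent_pow intrB rmorphN /= -!pmulrn; ring.
Qed.

Lemma floor_exponent i :
  Num.floor (0 + z * p%:R ^+ i) = (quo_pow p r a i)%:Z.
Proof.
by rewrite add0r; apply: (floor_eq_add (exponent_pow i)); apply: frac_exponent_bound.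
Qed.

End GaussSumTerm.

(** * The terms of the hypergeometric functions *)

Section McCarthyTerms.
Variables (p : nat) (p_pr : prime p) (K : fieldExtType (padic_num p_pr)).
Variable F : finFieldType.
Variable res : {rmorphism integer_ring K -> F}.
Variable r : nat.

Definition upper_factor (m : nat) (x : rat) : K :=
  \prod_(0 <= i < r)
    ((- p%:R) ^ (- Num.floor (frac_part (x * p%:R ^+ i) - m%:R / (p ^ r).-1%:R * p%:R ^+ i))
     * (gammaQ K (frac_part ((x - m%:R / (p ^ r).-1%:R) * p%:R ^+ i))
          / gammaQ K (frac_part (x * p%:R ^+ i)))).

Definition lower_factor (m : nat) (x : rat) : K :=
  \prod_(0 <= i < r)
    ((- p%:R) ^ (- Num.floor (frac_part (- x * p%:R ^+ i) + m%:R / (p ^ r).-1%:R * p%:R ^+ i))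
     * (gammaQ K (frac_part ((- x + m%:R / (p ^ r).-1%:R) * p%:R ^+ i))
          / gammaQ K (frac_part (- x * p%:R ^+ i)))).

Lemma opp_p_neq0 : - p%:R != 0 :> K.
Proof.
have natK n : (0 < n)%N -> n%:R != 0 :> K by case: n => // n _; apply: padic_natK_neq0.
by rewrite oppr_eq0 natK // prime_gt0.
Qed.

Lemma mccarthyG_split n (a b : 'I_n -> rat) (t : F) :
  mccarthyG res r a b t = - 1 / (p ^ r).-1%:R *
    \sum_(0 <= m < (p ^ r).-1) (-1) ^+ (m * n) * teichmuller_inv res m t *
      ((\prod_(j < n) upper_factor m (a j)) * (\prod_(j < n) lower_factor m (b j))).
Proof.
rewrite /mccarthyG; congr (_ * _); apply: eq_bigr => m _; congr (_ * _).
rewrite -big_split; apply: eq_bigr => j _ /=.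
rewrite -big_split; apply: eq_bigr => i _ /=.
by rewrite (expfzDr _ _ opp_p_neq0) -mulrA mulrACA.
Qed.

Hypothesis hres : unramified_residue_map res.
Hypothesis p_odd : odd p.
Hypothesis r_gt0 : (0 < r)%N.
Hypothesis cardF : #|F| = (p ^ r)%N.

Lemma teichmuller_invM m (x t : F) :
  teichmuller_inv res m (x * t) = teichmuller_inv res m x * teichmuller_inv res m t.
Proof.
rewrite /teichmuller_inv mulf_eq0; case: eqVneq => [_|x0] /=; first by rewrite mul0r.
case: eqVneq => [_|t0] /=; first by rewrite mulr0.
by rewrite (teichmullerM hres r_gt0 cardF) // integer_valM exprMn invfM.
Qed.

Lemma jacobi_sum_val m : (m < (p ^ r).-1)%N ->
  \sum_(t : F) quad_char K (1 - t) * teichmuller_inv res m t = \val (jacobi_sum res m).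
Proof.
move=> lt_m; rewrite /jacobi_sum rmorph_sum.
rewrite (bigD1 0) //=.
have -> : teichmuller_inv res m 0 = 0 by rewrite /teichmuller_inv eqxx.
rewrite mulr0 add0r; apply: eq_bigr => t t0.
rewrite ?rmorphM ?integer_valM val_quad_charq /teichmuller_inv (negPf t0); congr (_ * _).
have [t1 _] := teichmullerP hres r_gt0 cardF t0; rewrite cardF in t1 *.
have tK : (\val (teichmuller res t) : K) ^+ (p ^ r).-1 = 1 by rewrite -rmorphXn t1 rmorph1.
have tm0 : (\val (teichmuller res t) : K) ^+ m != 0.
  apply/eqP => tm; have := oner_neq0 K; rewrite -tK -(subnK (ltnW lt_m)) exprD tm mulr0 eqxx //.
apply: (mulfI tm0); rewrite mulfV // -[integer_val (_ ^+ _)]/(\val (_ ^+ _)).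
by rewrite rmorphXn -exprD subnKC ?(ltnW lt_m).
Qed.

Section HalfFactors.
Variables (m : nat) (half iq : padic_int p_pr).
Hypothesis lt_m : (m < (p ^ r).-1)%N.
Hypothesis half2 : half * 2%:R = 1.
Hypothesis iqE : (p ^ r).-1%:R * iq = 1.

Lemma upper_factor_half : upper_factor m 2%:R^-1 =
  \prod_(i < r) ((- p%:R) ^ ((quo_pow p r m i)%:Z + (carry p r m i)%:Z)
    * (padic_in K (padic_gamma (half - rot_exp r m iq i + (carry p r m i)%:R))
       / padic_in K (padic_gamma half))).
Proof.
rewrite /upper_factor big_mkord; apply: eq_bigr => i _.
rewrite (gammaQ_frac_half_exponent K p_odd r_gt0 lt_m half2 iqE).
rewrite (gammaQ_frac_half K p_odd r_gt0 lt_m half2) (floor_half_exponent p_odd lt_m).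
by rewrite -opprD opprK.
Qed.

Lemma lower_factor_0 : lower_factor m 0 =
  \prod_(i < r) ((- p%:R) ^ (- (quo_pow p r m i)%:Z)
    * padic_in K (padic_gamma (rot_exp r m iq i))).
Proof.
have f0 : frac_part 0 = 0 by apply: (@frac_part_eq _ _ 0); rewrite ?addr0.
rewrite /lower_factor big_mkord oppr0; apply: eq_bigr => i _.
rewrite mul0r f0 (floor_exponent lt_m) add0r.
by rewrite (gammaQ_frac_exponent K p_odd r_gt0 lt_m iqE) (gammaQ0 K p_odd) divr1.
Qed.

End HalfFactors.

(** Up to sign, the pair of parameters 1/2 and 0 contributes the Jacobi sum. *)
Lemma jacobi_sum_factors m : (m < (p ^ r).-1)%N ->
  \val (jacobi_sum res m) =
    - ((-1) ^+ m * (upper_factor m 2%:R^-1 * lower_factor m 0)).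
Proof.
move=> lt_m.
have [half half2] : exists half : padic_int p_pr, half * 2%:R = 1.
  have [|w wE] := @padic_nat_inv_exists p p_pr 2; last by exists w; rewrite mulrC.
  by rewrite gtnNdvd // odd_prime_gt2.
have [iq iqE] : exists iq : padic_int p_pr, (p ^ r).-1%:R * iq = 1.
  apply: padic_nat_inv_exists; apply/negP => dv.
  have : (p %| p ^ r)%N by rewrite -(prednK r_gt0) expnS dvdn_mulr.
  rewrite -(prednK (_ : 0 < p ^ r)%N) ?expn_gt0 ?prime_gt0 // -addn1 dvdn_addr //.
  by rewrite dvdn1 gtn_eqF // prime_gt1.
have G0 : padic_in K (padic_gamma half) != 0.
  by rewrite -(rmorph0 (padic_in K)) (inj_eq (@padic_in_inj _ _ _)) padic_gamma_neq0.
have factE : upper_factor m 2%:R^-1 * lower_factor m 0 * padic_in K (padic_gamma half) ^+ r =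
    padic_in K (\prod_(i < r) ((- p%:R) ^+ carry p r m i
      * padic_gamma (half - rot_exp r m iq i + (carry p r m i)%:R)
      * padic_gamma (rot_exp r m iq i))).
  rewrite (upper_factor_half lt_m half2 iqE) (lower_factor_0 lt_m iqE).
  have -> : padic_in K (padic_gamma half) ^+ r = \prod_(i < r) padic_in K (padic_gamma half).
    by rewrite prodr_const card_ord.
  rewrite -big_split -big_split rmorph_prod; apply: eq_bigr => i _ /=.
  have cancel e1 e2 e3 g1 g2 g3 : e1 * e2 = 1 -> g3 != 0 ->
      e1 * e3 * (g1 / g3) * (e2 * g2) * g3 = e3 * g1 * g2 :> K.
    move=> e12 g30; transitivity (e1 * e2 * (e3 * g1 * g2)); last by rewrite e12 mul1r.
    by field.
  rewrite (expfzDr _ _ opp_p_neq0) cancel //.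
    by rewrite !rmorphM rmorphXn rmorphN rmorph_nat.
  by rewrite -(expfzDr _ _ opp_p_neq0) subrr expr0z.
have J : (-1) ^+ m * \val (jacobi_sum res m) * padic_in K (padic_gamma half) ^+ r =
    - (upper_factor m 2%:R^-1 * lower_factor m 0 * padic_in K (padic_gamma half) ^+ r).
  have := congr1 val (jacobi_sum_formula hres p_odd r_gt0 cardF lt_m half2 iqE).
  by rewrite factE -rmorphXn rmorphM rmorphN rmorphM rmorph_sign.
have G0r : padic_in K (padic_gamma half) ^+ r != 0 by rewrite expf_neq0.
have {}J : (-1) ^+ m * \val (jacobi_sum res m) = - (upper_factor m 2%:R^-1 * lower_factor m 0).
  by apply: (mulIf G0r); rewrite J mulNr.
by rewrite -mulrN -J mulrA -exprMn mulrNN mulr1 expr1n mul1r.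
Qed.

End McCarthyTerms.

(** * The summation *)

Theorem theorem1p7 (d k : nat) (hk : (2 <= k)%N) (hkd : (k < d)%N)
    (hd : ~~ odd d)
    (p : nat) (p_pr : prime p) (hp : odd p)
    (hpd : ~~ (p %| d * k * (d - k))%N)
    (r : nat) (hr : (1 <= r)%N)
    (F : finFieldType) (hF : #|F| = (p ^ r)%N)
    (K : fieldExtType (padic_num p_pr))
    (res : {rmorphism integer_ring K -> F})
    (hres : unramified_residue_map res)
    (c : (d - 2).-tuple rat)
    (hc : perm_eq c ([seq i%:R / k%:R | i <- index_iota 1 k] ++
                     [seq i%:R / (d - k)%:R | i <- index_iota 1 (d - k)]))
    (x : F) :
  \sum_(t : F) quad_char K (1 - t) *
    mccarthyG res r
      (fun j : 'I_(d - 2) =>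
         [seq i%:R / d%:R | i <- index_iota 1 d & i != d./2]`_j)
      (tnth c) (x * t)
  = - mccarthyG res r
        (fun j : 'I_(d - 1) => [seq i%:R / d%:R | i <- index_iota 1 d]`_j)
        (fun j : 'I_(d - 1) =>
           ([seq i%:R / k%:R | i <- index_iota 0 k] ++
            [seq i%:R / (d - k)%:R | i <- index_iota 1 (d - k)])`_j)
        x.
Proof.
have prod_nth n (s : seq rat) (f : rat -> K) : size s = n ->
    \prod_(j < n) f s`_j = \prod_(z <- s) f z.
  by move=> <-; rewrite (big_nth 0) big_mkord.
have half_in : d./2 \in index_iota 1 d by rewrite mem_index_iota; lia.
have half_d : (d./2)%:R / d%:R = 2%:R^-1 :> rat.
  have {2}-> : d = (d./2 * 2)%N by rewrite muln2 -[LHS]odd_double_half (negPf hd).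
  by rewrite natrM; field; rewrite pnatr_eq0; lia.
have upperE m : \prod_(j < d - 1) upper_factor K r m [seq i%:R / d%:R | i <- index_iota 1 d]`_j =
    upper_factor K r m 2%:R^-1 * \prod_(j < d - 2)
      upper_factor K r m [seq i%:R / d%:R | i <- index_iota 1 d & i != d./2]`_j.
  have size_f : size [seq i <- index_iota 1 d | i != d./2] = (d - 2)%N.
    have := count_predC (pred1 d./2) (index_iota 1 d).
    rewrite count_uniq_mem ?iota_uniq // half_in size_iota size_filter.
    by rewrite (eq_count (a2 := fun i => i != d./2)) //; lia.
  rewrite !prod_nth ?size_map ?size_iota //.
  by rewrite !big_map big_filter (bigD1_seq d./2) ?iota_uniq //= half_d.
have lowerE m : \prod_(j < d - 1) lower_factor K r m
    ([seq i%:R / k%:R | i <- index_iota 0 k] ++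
            [seq i%:R / (d - k)%:R | i <- index_iota 1 (d - k)])`_j =
    lower_factor K r m 0 * \prod_(j < d - 2) lower_factor K r m (tnth c j).
  rewrite prod_nth; last by rewrite size_cat !size_map !size_iota; lia.
  rewrite -(big_tuple _ _ _ xpredT) (perm_big _ hc) /=.
  have -> : index_iota 0 k = 0%N :: index_iota 1 k.
    by rewrite -(prednK (ltnW hk)) /index_iota subn1.
  by rewrite /= big_cons mul0r.
rewrite mccarthyG_split.
under eq_bigr => t _ do rewrite mccarthyG_split mulrCA mulr_sumr.
rewrite -mulr_sumr exchange_big -mulrN; congr (_ * _).
rewrite -sumrN; apply: eq_big_nat => m /andP[_ lt_m].
rewrite upperE lowerE.
under eq_bigr => t _ do rewrite (teichmuller_invM hres hr hF).
set U := \prod_(_ < _) _; set L := \prod_(_ < _) _.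
transitivity ((-1) ^+ (m * (d - 2)) * teichmuller_inv res m x * (U * L) *
    \sum_(t : F) quad_char K (1 - t) * teichmuller_inv res m t).
  by rewrite mulr_sumr; apply: eq_bigr => t _; ring.
rewrite (jacobi_sum_val hres hr hF lt_m) (jacobi_sum_factors hres hp hr hF lt_m).
have -> : (d - 1 = (d - 2).+1)%N by lia.
rewrite mulnS exprD; ring.
Qed.
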